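(* Burnside's function $x(\tau)=\dfrac{\wp(1|2,2\tau)-\wp(2|2,2\tau)}{\wp(\tau|2,2\tau)-\wp(2|2,2\tau)}$, $\operatorname{Im}\tau>0$, is a ratio of two holomorphic modular forms of weight $2$ with respect to the group $\Gamma(4)$: $$x(\tau)=\frac{\Theta_1(\tau)}{\Theta_2(\tau)},\qquad \Theta_1(\tau)=\wp(1|2,2\tau)-\wp(2|2,2\tau),\qquad \Theta_2(\tau)=\wp(\tau|2,2\tau)-\wp(2|2,2\tau).$$
   Context: $\wp(z|\omega,\omega')$ is the Weierstrass elliptic function with half-periods $\omega,\omega'$ (period lattice $2\omega\mathbb{Z}+2\omega'\mathbb{Z}$). $\Gamma(4)$ is the principal congruence subgroup of level 4 of the modular group. An automorphic form of weight $n$ for a group is an analytic function $\Theta$ with $\Theta\big(\frac{a\tau+b}{c\tau+d}\big)=(c\tau+d)^n\Theta(\tau)$ for all substitutions of the group; holomorphic means everywhere finite, including at the cusps. *)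

(* Defs.v *)
From Stdlib Require Import Reals ZArith Bool.
From Coquelicot Require Import Coquelicot.
Open Scope C_scope.

Definition ZtoC (k : Z) : C := RtoC (IZR k).

Definition CLim_seq (u : nat -> C) : C :=
  (real (Lim_seq (fun N => Re (u N))), real (Lim_seq (fun N => Im (u N)))).

(* The arguments w, w' are half-periods: the period lattice is 2wZ + 2w'Z. *)
Definition period (w w' : C) (m n : Z) : C := 2 * ZtoC m * w + 2 * ZtoC n * w'.

Definition wp_term (z w w' : C) (m n : Z) : C :=
  if ((m =? 0) && (n =? 0))%Z then RtoC 0
  else / (z - period w w' m n) ^ 2 - / (period w w' m n) ^ 2.

Definition wp_partial (z w w' : C) (N : nat) : C :=
  sum_n (fun i : nat =>
    sum_n (fun j : nat =>
      wp_term z w w' (Z.of_nat i - Z.of_nat N) (Z.of_nat j - Z.of_nat N))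
      (2 * N)) (2 * N).

(* Weierstrass function wp(z | w, w').  The lattice series converges absolutely
   when w, w' are linearly independent over the reals and z is not a period, so
   summing it by squares is only a choice of enumeration. *)
Definition wp (z w w' : C) : C := / z ^ 2 + CLim_seq (wp_partial z w w').

Definition SL2Z (a b c d : Z) : Prop := (a * d - b * c = 1)%Z.

Definition Gamma (N : Z) (a b c d : Z) : Prop :=
  SL2Z a b c d /\
  (N | a - 1)%Z /\ (N | b)%Z /\ (N | c)%Z /\ (N | d - 1)%Z.

Definition automorphy (c d : Z) (tau : C) : C := ZtoC c * tau + ZtoC d.

Definition mobius (a b c d : Z) (tau : C) : C :=
  (ZtoC a * tau + ZtoC b) / automorphy c d tau.

(* Neighbourhoods of the cusp at infinity: half-planes Im tau > M. *)
Definition at_i_infty (P : C -> Prop) : Prop :=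
  exists M : R, forall tau : C, (M < Im tau)%R -> P tau.

(* The cusps of a congruence subgroup are the images of infinity under the full
   modular group; the value of f at the cusp a/c is the limit of
   (c tau + d)^(-n) f((a tau + b)/(c tau + d)) as Im tau -> +oo. *)
Definition finite_at_cusps (n : nat) (f : C -> C) : Prop :=
  forall a b c d : Z, SL2Z a b c d ->
    exists l : C,
      filterlim (fun tau : C => f (mobius a b c d tau) / automorphy c d tau ^ n)
                at_i_infty (locally l).

(* G is a congruence subgroup, given as a predicate on the matrix entries.
   Only the values of f on the upper half-plane matter. *)
Definition holomorphic_modular_form
    (G : Z -> Z -> Z -> Z -> Prop) (n : nat) (f : C -> C) : Prop :=
  (forall tau : C, (0 < Im tau)%R ->
     ex_derive (K := C_AbsRing) (V := C_NormedModule) f tau) /\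
  (forall a b c d : Z, G a b c d ->
     forall tau : C, (0 < Im tau)%R ->
       f (mobius a b c d tau) = automorphy c d tau ^ n * f tau) /\
  finite_at_cusps n f.

Definition burnside_x (tau : C) : C :=
  (wp 1 2 (2 * tau) - wp 2 2 (2 * tau)) /
  (wp tau 2 (2 * tau) - wp 2 2 (2 * tau)).

Definition Theta1 (tau : C) : C := wp 1 2 (2 * tau) - wp 2 2 (2 * tau).

Definition Theta2 (tau : C) : C := wp tau 2 (2 * tau) - wp 2 2 (2 * tau).

(* Main.v *)
Require Import Defs.
From Stdlib Require Import Reals ZArith Bool Lra Lia Psatz List Permutation FinFun.
From Coquelicot Require Import Coquelicot.
Open Scope C_scope.

(* Scaling by 4 replaces wp(z | 2, 2 tau) by the function of the lattice L = Z + Z tau, so that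
   Theta1 and Theta2 become differences of values of wp at points of (1/4)L.  Reindexing the
   absolutely convergent sums by SL2(Z) permutes these points, and Gamma(4) fixes them modulo L;
   the cusp limits come from estimating the rows of the lattice that move off to infinity.

   Theta2 has no zero, that is wp(tau/4) <> wp(1/2): by Liouville's theorem wp'' - 6 wp^2 is
   constant, so wp(1/2) = wp(tau/4) would give, through the first integral, wp'(tau/4) = 0 =
   wp'(1/2), and uniqueness for the differential equation would make wp(1/2 - s) and
   wp(tau/4 - s) agree up to s = 1/2, where only the first one has a pole.  Liouville's theorem is
   proved without Cauchy's formula, by an energy identity for the integral of f' conj f over a
   period. *)

(** Division in [C] is total, so the equation for [burnside_x] has its intended content only
    together with the nonvanishing of [Theta2]. Classically this is a count of zeros: wp - wp(1/2)
    has order two and a double zero at 1/2, hence none at tau/4. The count rests on residues; the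
    differential equation replaces it, because it asks only for calculus of a real variable along
    segments.

    The analysis rests on one notion, a quadratic Taylor remainder bounded uniformly over the
    lattice by a summable weight. It survives products and summation, so that termwise
    differentiation in z and in tau is the same estimate. Its price is that the terms must visibly
    decay like the cube of the inverse distance: the two inverse squares in a term of wp are
    therefore always recombined into a product of three inverses.

    Parity is used twice beyond symmetry itself: it makes wp(z) - 1/z^2 divisible by z^2, which
    removes the whole pole of wp'' - 6 wp^2 at the origin, and it gives the boundary values of the
    energy integral, whose monotonicity takes the place of a maximum principle. *)

Lemma C_ext (x y : C) : Re x = Re y -> Im x = Im y -> x = y.
Proof. destruct x, y; simpl; congruence. Qed.

Lemma Cmod_le_Re_Im (c : C) : (Cmod c <= Rabs (Re c) + Rabs (Im c))%R.
Proof.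
  replace c with (RtoC (Re c) + RtoC (Im c) * Ci)
    by (apply C_ext; simpl; ring).
  eapply Rle_trans; [apply Cmod_triangle|].
  rewrite Cmod_mult, Cmod_Ci, !Cmod_R, Rmult_1_r.
  replace (Re (RtoC (Re c) + RtoC (Im c) * Ci)) with (Re c) by (simpl; ring).
  replace (Im (RtoC (Re c) + RtoC (Im c) * Ci)) with (Im c) by (simpl; ring).
  apply Rle_refl.
Qed.

Lemma im_le_Cmod (c : C) : (Rabs (Im c) <= Cmod c)%R.
Proof. eapply Rle_trans; [apply Rmax_r | apply Rmax_Cmod]. Qed.

Lemma Cmod_minus_sym (x y : C) : Cmod (x - y) = Cmod (y - x).
Proof. rewrite <- Cmod_opp. f_equal. ring. Qed.

Lemma Cmod_triangle_minus (x y : C) : (Cmod (x - y) <= Cmod x + Cmod y)%R.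
Proof. unfold Cminus. rewrite <- (Cmod_opp y). apply Cmod_triangle. Qed.

Lemma Cmod_triangle_inv (x y : C) : (Cmod x - Cmod y <= Cmod (x + y))%R.
Proof.
  pose proof (Cmod_triangle_minus (x + y) y) as H.
  replace (x + y - y) with x in H by ring. lra.
Qed.

(** * Finite sums over lists *)

Definition csum {I : Type} (F : I -> C) (l : list I) : C :=
  fold_right (fun p acc => F p + acc) (RtoC 0) l.

Definition rsum {I : Type} (F : I -> R) (l : list I) : R :=
  fold_right (fun p acc => (F p + acc)%R) 0%R l.

Section FiniteSums.
Context {I : Type}.
Implicit Types (F G : I -> C) (W V : I -> R) (l : list I).

Lemma csum_app F l l' : csum F (l ++ l') = csum F l + csum F l'.
Proof. induction l; simpl; [ring | rewrite IHl; ring]. Qed.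

Lemma csum_plus F G l : csum (fun p => F p + G p) l = csum F l + csum G l.
Proof. induction l; simpl; [ring | rewrite IHl; ring]. Qed.

Lemma csum_scal c F l : csum (fun p => c * F p) l = c * csum F l.
Proof. induction l; simpl; [ring | rewrite IHl; ring]. Qed.

Lemma csum_ext F G l : (forall p, In p l -> F p = G p) -> csum F l = csum G l.
Proof.
  induction l as [|a l IH]; simpl; intros H; [easy|].
  rewrite H, IH; auto.
Qed.

Lemma csum_map {J : Type} F (s : J -> I) (k : list J) :
  csum F (map s k) = csum (fun p => F (s p)) k.
Proof. induction k as [|a k IH]; simpl; [easy | now rewrite IH]. Qed.

Lemma Re_csum F l : Re (csum F l) = rsum (fun p => Re (F p)) l.
Proof. induction l; simpl; [easy | now rewrite <- IHl]. Qed.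

Lemma Im_csum F l : Im (csum F l) = rsum (fun p => Im (F p)) l.
Proof. induction l; simpl; [easy | now rewrite <- IHl]. Qed.

Lemma Cmod_csum_le F W l :
  (forall p, In p l -> (Cmod (F p) <= W p)%R) -> (Cmod (csum F l) <= rsum W l)%R.
Proof.
  induction l as [|a l IH]; simpl; intros H; [rewrite Cmod_0; lra|].
  eapply Rle_trans; [apply Cmod_triangle|].
  apply Rplus_le_compat; auto.
Qed.

Lemma rsum_app W l l' : rsum W (l ++ l') = (rsum W l + rsum W l')%R.
Proof. induction l; simpl; [ring | rewrite IHl; ring]. Qed.

Lemma rsum_plus W V l : rsum (fun p => W p + V p)%R l = (rsum W l + rsum V l)%R.
Proof. induction l; simpl; [ring | rewrite IHl; ring]. Qed.

Lemma rsum_scal c W l : rsum (fun p => c * W p)%R l = (c * rsum W l)%R.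
Proof. induction l; simpl; [ring | rewrite IHl; ring]. Qed.

Lemma rsum_map {J : Type} W (s : J -> I) (k : list J) :
  rsum W (map s k) = rsum (fun p => W (s p)) k.
Proof. induction k as [|a k IH]; simpl; [easy | now rewrite IH]. Qed.

Lemma rsum_le W V l : (forall p, In p l -> (W p <= V p)%R) -> (rsum W l <= rsum V l)%R.
Proof.
  induction l as [|a l IH]; simpl; intros H; [lra|].
  apply Rplus_le_compat; auto.
Qed.

Lemma rsum_const c l : rsum (fun _ => c) l = (INR (length l) * c)%R.
Proof.
  induction l as [|a l IH]; [simpl; ring|].
  change (length (a :: l)) with (S (length l)). rewrite S_INR. simpl. rewrite IH. ring.
Qed.

Lemma rsum_incl W l l' :
  (forall p, 0 <= W p)%R -> NoDup l -> incl l l' -> (rsum W l <= rsum W l')%R.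
Proof.
  intros HW; revert l'; induction l as [|a l IH]; intros l' ND Hi.
  - simpl. clear Hi. induction l'; simpl; [lra|]. specialize (HW a). lra.
  - destruct (in_split a l') as [l1 [l2 E]]; [apply Hi; now left|]. subst l'.
    inversion ND; subst.
    assert (Hle : (rsum W l <= rsum W (l1 ++ l2))%R).
    { apply IH; auto. intros x Hx.
      assert (Hx' : In x (l1 ++ a :: l2)) by (apply Hi; now right).
      apply in_app_or in Hx'. apply in_or_app.
      destruct Hx' as [|[->|]]; auto. contradiction. }
    rewrite rsum_app in *. simpl. lra.
Qed.

End FiniteSums.

Lemma csum_list_prod {I J : Type} (F : I * J -> C) l l' :
  csum F (list_prod l l') = csum (fun i => csum (fun j => F (i, j)) l') l.
Proof.
  induction l as [|a l IH]; simpl; [easy|].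
  rewrite csum_app, csum_map, IH. easy.
Qed.

Lemma rsum_list_prod {I J : Type} (F : I * J -> R) l l' :
  rsum F (list_prod l l') = rsum (fun i => rsum (fun j => F (i, j)) l') l.
Proof.
  induction l as [|a l IH]; simpl; [easy|].
  rewrite rsum_app, rsum_map, IH. easy.
Qed.

(** * Unconditional sums over the integer lattice *)

Definition idx : Type := (Z * Z)%type.

Definition idx_dec (p q : idx) : {p = q} + {p <> q}.
Proof. decide equality; apply Z.eq_dec. Defined.

(** Convergence along the net of finite sets makes reindexing by SL2(Z), by negation and by
    translation immediate, which sums over squares do not allow; [has_sum_box] recovers the squares
    that define [wp]. *)
Definition has_sum (F : idx -> C) (s : C) : Prop :=
  forall eps : R, (0 < eps)%R -> exists l0, forall l, NoDup l -> incl l0 l ->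
    (Cmod (csum F l - s) < eps)%R.

Lemma common_finset (l1 l2 : list idx) :
  exists l, NoDup l /\ incl l1 l /\ incl l2 l.
Proof.
  exists (nodup idx_dec (l1 ++ l2)). split; [apply NoDup_nodup|].
  split; intros x Hx; apply nodup_In, in_or_app; auto.
Qed.

Lemma has_sum_plus F G s t :
  has_sum F s -> has_sum G t -> has_sum (fun p => F p + G p) (s + t).
Proof.
  intros HF HG eps He.
  destruct (HF (eps / 2)%R) as [l1 H1]; [lra|].
  destruct (HG (eps / 2)%R) as [l2 H2]; [lra|].
  exists (l1 ++ l2). intros l ND Hi.
  specialize (H1 l ND (fun x Hx => Hi x (in_or_app _ _ _ (or_introl Hx)))).
  specialize (H2 l ND (fun x Hx => Hi x (in_or_app _ _ _ (or_intror Hx)))).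
  rewrite csum_plus.
  replace (csum F l + csum G l - (s + t)) with ((csum F l - s) + (csum G l - t)) by ring.
  eapply Rle_lt_trans; [apply Cmod_triangle | lra].
Qed.

Lemma has_sum_scal c F s : has_sum F s -> has_sum (fun p => c * F p) (c * s).
Proof.
  intros HF eps He.
  pose proof (Cmod_ge_0 c).
  destruct (HF (eps / (Cmod c + 1))%R) as [l1 H1]; [apply Rdiv_lt_0_compat; lra|].
  exists l1. intros l ND Hi. specialize (H1 l ND Hi).
  rewrite csum_scal. replace (c * csum F l - c * s) with (c * (csum F l - s)) by ring.
  rewrite Cmod_mult.
  apply Rle_lt_trans with (Cmod c * (eps / (Cmod c + 1)))%R.
  - apply Rmult_le_compat_l; lra.
  - assert (E : (eps = (Cmod c + 1) * (eps / (Cmod c + 1)))%R) by (field; lra).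
    assert (0 < eps / (Cmod c + 1))%R by (apply Rdiv_lt_0_compat; lra).
    nra.
Qed.

Lemma has_sum_ext F G s : (forall p, F p = G p) -> has_sum F s -> has_sum G s.
Proof.
  intros E HF eps He. destruct (HF eps He) as [l0 H]. exists l0. intros l ND Hi.
  rewrite <- (csum_ext F G l); auto.
Qed.

Lemma has_sum_minus F G s t :
  has_sum F s -> has_sum G t -> has_sum (fun p => F p - G p) (s - t).
Proof.
  intros HF HG. apply (has_sum_scal (-1)) in HG.
  replace (s - t) with (s + -1 * t) by ring.
  apply has_sum_ext with (fun p => F p + -1 * G p); [intros; ring|].
  now apply has_sum_plus.
Qed.

Lemma has_sum_bound F W B s :
  (forall p, Cmod (F p) <= W p)%R -> (forall l, NoDup l -> rsum W l <= B)%R ->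
  has_sum F s -> (Cmod s <= B)%R.
Proof.
  intros HW HB HF. apply le_epsilon. intros eps He.
  destruct (HF eps He) as [l0 H].
  destruct (common_finset l0 nil) as [l [ND [Hi _]]].
  specialize (H l ND Hi).
  pose proof (Cmod_triangle_minus (csum F l) (csum F l - s)) as T.
  replace (csum F l - (csum F l - s)) with s in T by ring.
  pose proof (Cmod_csum_le F W l (fun p _ => HW p)). specialize (HB l ND). lra.
Qed.

Lemma has_sum_unique F s t : has_sum F s -> has_sum F t -> s = t.
Proof.
  intros H1 H2. pose proof (has_sum_minus F F s t H1 H2) as H.
  assert (Cmod (s - t) <= 0)%R.
  { apply (has_sum_bound (fun p => F p - F p) (fun _ => 0%R) 0 (s - t)); auto.
    - intros p. replace (F p - F p) with (RtoC 0) by ring. rewrite Cmod_0. lra.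
    - intros l _. rewrite rsum_const. lra. }
  assert (E : s - t = 0) by (apply Cmod_eq_0; pose proof (Cmod_ge_0 (s - t)); lra).
  replace s with ((s - t) + t) by ring. rewrite E. ring.
Qed.

Lemma has_sum_reindex F s (f g : idx -> idx) :
  (forall p, g (f p) = p) -> (forall p, f (g p) = p) ->
  has_sum F s -> has_sum (fun p => F (f p)) s.
Proof.
  intros gf fg HF eps He. destruct (HF eps He) as [l0 H].
  exists (map g l0). intros l ND Hi. rewrite <- csum_map. apply H.
  - apply Injective_map_NoDup; auto. intros x y E.
    now rewrite <- (gf x), <- (gf y), E.
  - intros x Hx. rewrite <- (fg x). apply in_map. apply Hi. now apply in_map.
Qed.

Lemma has_sum_single (p0 : idx) c :
  has_sum (fun p => if idx_dec p p0 then c else RtoC 0) c.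
Proof.
  intros eps He. exists (p0 :: nil). intros l ND Hi.
  assert (E : csum (fun p => if idx_dec p p0 then c else RtoC 0) l = c).
  2:{ rewrite E. replace (c - c) with (RtoC 0) by ring. now rewrite Cmod_0. }
  destruct (in_split p0 l (Hi p0 (or_introl eq_refl))) as [l1 [l2 ->]].
  rewrite csum_app. simpl. destruct (idx_dec p0 p0) as [_|]; [|easy].
  apply NoDup_remove_2 in ND.
  assert (Z0 : forall l', ~ In p0 l' ->
    csum (fun p => if idx_dec p p0 then c else RtoC 0) l' = 0).
  { induction l' as [|a l' IH]; simpl; intros Hn; [easy|].
    destruct (idx_dec a p0); [subst; exfalso; apply Hn; now left|].
    rewrite IH; [ring|]. intros ?; apply Hn; now right. }
  rewrite !Z0; [ring | |]; intros Hin; apply ND, in_or_app; auto.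
Qed.

Lemma rsum_net_lub (G : idx -> R) B :
  (forall p, 0 <= G p)%R -> (forall l, NoDup l -> rsum G l <= B)%R ->
  exists s, forall eps, (0 < eps)%R -> exists l0, forall l, NoDup l -> incl l0 l ->
    (Rabs (rsum G l - s) < eps)%R.
Proof.
  intros G0 HB.
  destruct (completeness (fun x => exists l, NoDup l /\ x = rsum G l)) as [s [Hub Hl]].
  - exists B. intros x [l [ND ->]]. now apply HB.
  - exists 0%R, nil. split; [constructor | easy].
  - exists s. intros eps He.
    assert (E : exists l0, NoDup l0 /\ (s - eps < rsum G l0)%R).
    { destruct (Classical_Prop.classic (exists l0, NoDup l0 /\ (s - eps < rsum G l0)%R))
        as [|N]; auto.
      exfalso. assert (s <= s - eps)%R; [|lra]. apply Hl.
      intros x [l [ND ->]]. apply Rnot_lt_le. intros Hlt. apply N. now exists l. }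
    destruct E as [l0 [ND0 H0]]. exists l0. intros l ND Hi.
    assert (rsum G l <= s)%R by (apply Hub; now exists l).
    pose proof (rsum_incl G l0 l G0 ND0 Hi).
    apply Rabs_def1; lra.
Qed.

(** Writing [G] as [(G + W) - W] leaves two nonnegative families, whose sums are the suprema of
    their finite sums. *)
Lemma rsum_net_dominated (G W : idx -> R) B :
  (forall p, Rabs (G p) <= W p)%R -> (forall l, NoDup l -> rsum W l <= B)%R ->
  exists s, forall eps, (0 < eps)%R -> exists l0, forall l, NoDup l -> incl l0 l ->
    (Rabs (rsum G l - s) < eps)%R.
Proof.
  intros HW HB.
  assert (W0 : forall p, (0 <= W p)%R)
    by (intros p; eapply Rle_trans; [apply Rabs_pos | apply HW]).
  destruct (rsum_net_lub W B W0 HB) as [sW H1].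
  destruct (rsum_net_lub (fun p => G p + W p)%R (2 * B)%R) as [sG H2].
  - intros p. specialize (HW p). apply Rabs_le_between in HW. lra.
  - intros l ND. rewrite rsum_plus. specialize (HB l ND).
    assert (rsum G l <= rsum W l)%R; [|lra].
    apply rsum_le. intros p _. eapply Rle_trans; [apply Rle_abs | apply HW].
  - exists (sG - sW)%R. intros eps He.
    destruct (H1 (eps / 2)%R) as [l1 K1]; [lra|].
    destruct (H2 (eps / 2)%R) as [l2 K2]; [lra|].
    exists (l1 ++ l2). intros l ND Hi.
    specialize (K1 l ND (fun x Hx => Hi x (in_or_app _ _ _ (or_introl Hx)))).
    specialize (K2 l ND (fun x Hx => Hi x (in_or_app _ _ _ (or_intror Hx)))).
    rewrite rsum_plus in K2.
    apply Rabs_def2 in K1. apply Rabs_def2 in K2. apply Rabs_def1; lra.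
Qed.

Lemma has_sum_dominated F W B :
  (forall p, Cmod (F p) <= W p)%R -> (forall l, NoDup l -> rsum W l <= B)%R ->
  exists s, has_sum F s.
Proof.
  intros HW HB.
  destruct (rsum_net_dominated (fun p => Re (F p)) W B) as [a Ha]; auto.
  { intros p. eapply Rle_trans; [apply re_le_Cmod | apply HW]. }
  destruct (rsum_net_dominated (fun p => Im (F p)) W B) as [b Hb]; auto.
  { intros p. eapply Rle_trans; [apply im_le_Cmod | apply HW]. }
  exists (a, b). intros eps He.
  destruct (Ha (eps / 2)%R) as [l1 K1]; [lra|].
  destruct (Hb (eps / 2)%R) as [l2 K2]; [lra|].
  exists (l1 ++ l2). intros l ND Hi.
  specialize (K1 l ND (fun x Hx => Hi x (in_or_app _ _ _ (or_introl Hx)))).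
  specialize (K2 l ND (fun x Hx => Hi x (in_or_app _ _ _ (or_intror Hx)))).
  rewrite <- Re_csum in K1. rewrite <- Im_csum in K2.
  eapply Rle_lt_trans; [apply Cmod_le_Re_Im|].
  change (Rabs (Re (csum F l) - a) + Rabs (Im (csum F l) - b) < eps)%R. lra.
Qed.

(** * Summation over growing squares *)

Definition zrange (N : nat) : list Z :=
  map (fun i => (Z.of_nat i - Z.of_nat N)%Z) (seq 0 (2 * N + 1)).

Definition box (N : nat) : list idx := list_prod (zrange N) (zrange N).

Lemma in_zrange N k : In k (zrange N) <-> (Z.abs k <= Z.of_nat N)%Z.
Proof.
  unfold zrange. rewrite in_map_iff. split.
  - intros [i [<- Hi]]. apply in_seq in Hi. lia.
  - intros H. exists (Z.to_nat (k + Z.of_nat N)). rewrite in_seq. lia.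
Qed.

Lemma NoDup_zrange N : NoDup (zrange N).
Proof. apply Injective_map_NoDup; [intros x y; lia | apply seq_NoDup]. Qed.

Lemma NoDup_list_prod {I J : Type} (l : list I) (l' : list J) :
  NoDup l -> NoDup l' -> NoDup (list_prod l l').
Proof.
  intros ND ND'. induction ND as [|a l Ha ND IH]; simpl; [constructor|].
  apply NoDup_app; auto.
  - apply Injective_map_NoDup; auto. intros x y E. now injection E.
  - intros [i j] H1 H2. apply in_map_iff in H1. destruct H1 as [x [E _]].
    injection E as <- <-. apply in_prod_iff in H2. tauto.
Qed.

Lemma NoDup_box N : NoDup (box N).
Proof. apply NoDup_list_prod; apply NoDup_zrange. Qed.

Lemma incl_box (l : list idx) : exists N0, forall N, (N0 <= N)%nat -> incl l (box N).
Proof.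
  induction l as [|[m n] l [N0 H]].
  - exists 0%nat. intros N _ x [].
  - exists (Nat.max N0 (Z.to_nat (Z.abs m + Z.abs n))). intros N HN x [<-|Hx].
    + apply in_prod; apply in_zrange; lia.
    + apply (H N); auto. lia.
Qed.

Lemma has_sum_box F s :
  has_sum F s ->
  forall eps, (0 < eps)%R -> exists N0, forall N, (N0 <= N)%nat ->
    (Cmod (csum F (box N) - s) < eps)%R.
Proof.
  intros HF eps He. destruct (HF eps He) as [l0 H].
  destruct (incl_box l0) as [N0 H0]. exists N0. intros N HN.
  apply H; [apply NoDup_box | auto].
Qed.

(** A total choice of the sum, meaningful under [has_sum]. Taking the limit over squares, as in the
    definition of [wp], makes the comparison with [wp] termwise. *)
Definition Csum (F : idx -> C) : C := CLim_seq (fun N => csum F (box N)).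

Lemma has_sum_Csum F s : has_sum F s -> Csum F = s.
Proof.
  intros HF. unfold Csum, CLim_seq. apply C_ext.
  - apply (f_equal real (y := Finite (Re s))), is_lim_seq_unique, is_lim_seq_spec. intros eps.
    destruct (has_sum_box F s HF eps (cond_pos eps)) as [N0 H].
    exists N0. intros N HN. eapply Rle_lt_trans; [|apply (H N HN)].
    apply (re_le_Cmod (csum F (box N) - s)).
  - apply (f_equal real (y := Finite (Im s))), is_lim_seq_unique, is_lim_seq_spec. intros eps.
    destruct (has_sum_box F s HF eps (cond_pos eps)) as [N0 H].
    exists N0. intros N HN. eapply Rle_lt_trans; [|apply (H N HN)].
    apply (im_le_Cmod (csum F (box N) - s)).
Qed.

Lemma sum_n_csum (f : nat -> C) n : sum_n f n = csum f (seq 0 (n + 1)).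
Proof.
  induction n as [|n IH].
  - rewrite sum_O. simpl. ring.
  - rewrite sum_Sn, IH. replace (S n + 1)%nat with (S (n + 1)) by lia.
    rewrite (seq_S (n + 1)), csum_app. simpl.
    replace (n + 1)%nat with (S n) by lia.
    change (plus (csum f (seq 0 (S n))) (f (S n)) = csum f (seq 0 (S n)) + (f (S n) + 0)).
    rewrite Cplus_0_r. easy.
Qed.

Lemma wp_partial_csum z w w' N :
  wp_partial z w w' N = csum (fun p => wp_term z w w' (fst p) (snd p)) (box N).
Proof.
  unfold wp_partial, box. rewrite csum_list_prod. unfold zrange.
  rewrite sum_n_csum, csum_map. apply csum_ext. intros i _.
  rewrite sum_n_csum, csum_map. easy.
Qed.

Lemma telescope_zrange (a : Z -> C) N :
  csum (fun m => a (m - 1)%Z - a m) (zrange N) =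
  a (- Z.of_nat N - 1)%Z - a (Z.of_nat N).
Proof.
  unfold zrange. rewrite csum_map.
  assert (H : forall k,
    csum (fun i => a (Z.of_nat i - Z.of_nat N - 1)%Z - a (Z.of_nat i - Z.of_nat N)%Z) (seq 0 k)
    = a (- Z.of_nat N - 1)%Z - a (Z.of_nat k - Z.of_nat N - 1)%Z).
  { induction k as [|k IH].
    - simpl csum. replace (Z.of_nat 0 - Z.of_nat N - 1)%Z with (- Z.of_nat N - 1)%Z by lia. ring.
    - rewrite seq_S, csum_app, IH. simpl csum.
      replace (Z.of_nat (S k) - Z.of_nat N - 1)%Z with (Z.of_nat k - Z.of_nat N)%Z by lia.
      ring. }
  rewrite H. do 2 f_equal. f_equal. lia.
Qed.

(** * A summable weight on the integer lattice *)

Definition zabs (k : Z) : R := IZR (Z.abs k).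

Lemma zabs_ge_0 k : (0 <= zabs k)%R.
Proof. apply IZR_le, Z.abs_nonneg. Qed.

Lemma zabs_Rabs k : zabs k = Rabs (IZR k).
Proof. symmetry. apply Rabs_Zabs. Qed.

(** The exponent 3/2 is chosen from two sides: above 1, so that the product weight is summable one
    coordinate at a time, and half of 3, so that the product of two such factors is at most a cube
    ([pow32_mult_le]) and cubic decay is enough. *)
Definition pow32 (x : R) : R := (x * sqrt x)%R.

Definition wt1 (k : Z) : R := (/ pow32 (1 + zabs k))%R.

Definition wt (p : idx) : R := (wt1 (fst p) * wt1 (snd p))%R.

Lemma pow32_pos x : (0 < x)%R -> (0 < pow32 x)%R.
Proof. intros H. apply Rmult_lt_0_compat; [easy | now apply sqrt_lt_R0]. Qed.

Lemma wt1_pos k : (0 < wt1 k)%R.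
Proof. apply Rinv_0_lt_compat, pow32_pos. pose proof (zabs_ge_0 k). lra. Qed.

Lemma wt_pos p : (0 < wt p)%R.
Proof. apply Rmult_lt_0_compat; apply wt1_pos. Qed.

(** The right side is the integral of t^(-3/2) from [x] to [x + 1], so this is the integral test in
    telescoping form. *)
Lemma pow32_telescope x :
  (0 < x)%R -> (/ pow32 (x + 1) <= 2 / sqrt x - 2 / sqrt (x + 1))%R.
Proof.
  intros Hx. unfold pow32.
  set (a := sqrt x). set (b := sqrt (x + 1)).
  assert (Ha : (0 < a)%R) by (apply sqrt_lt_R0; lra).
  assert (Hb : (0 < b)%R) by (apply sqrt_lt_R0; lra).
  assert (Ea : (a * a = x)%R) by (apply sqrt_sqrt; lra).
  assert (Eb : (b * b = x + 1)%R) by (apply sqrt_sqrt; lra).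
  assert (Hab : (a <= b)%R) by (apply sqrt_le_1; lra).
  rewrite <- Eb.
  replace (2 / a - 2 / b)%R with (/ (a * b * (a + b) / 2))%R.
  - apply Rinv_le_contravar.
    + apply Rdiv_lt_0_compat; [|lra]. repeat apply Rmult_lt_0_compat; lra.
    + assert (a * b <= b * b)%R by nra. assert (a + b <= 2 * b)%R by lra.
      assert (0 < a * b)%R by nra. assert (0 < b * b)%R by nra.
      assert (a * b * (a + b) <= b * b * (2 * b))%R by nra. lra.
  - assert (E : ((b - a) * (a + b) = 1)%R) by nra.
    replace (2 / a - 2 / b)%R with (2 * (b - a) / (a * b))%R by (field; lra).
    replace (b - a)%R with (/ (a + b))%R; [field; lra|].
    apply Rmult_eq_reg_r with (a + b)%R; [|lra]. rewrite E. field. lra.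
Qed.

Lemma rsum_wt1_nat N :
  (rsum (fun i => wt1 (Z.of_nat i)) (seq 0 (N + 1)) <= 3 - 2 / sqrt (INR (N + 1)))%R.
Proof.
  assert (Ew : forall i, wt1 (Z.of_nat i) = (/ pow32 (INR (i + 1)))%R).
  { intros i. unfold wt1, zabs. rewrite Z.abs_eq by lia.
    rewrite <- INR_IZR_INZ, plus_INR. f_equal. f_equal. simpl. lra. }
  induction N as [|N IH].
  - simpl. change 0%Z with (Z.of_nat 0). rewrite Ew. simpl.
    unfold pow32. rewrite sqrt_1. lra.
  - replace (S N + 1)%nat with (S (N + 1)) by lia.
    rewrite seq_S, rsum_app. simpl (0 + (N + 1))%nat. simpl rsum at 2.
    rewrite Ew. rewrite plus_INR, (S_INR (N + 1)).
    change (INR 1) with 1%R.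
    pose proof (pow32_telescope (INR (N + 1))) as T.
    assert (0 < INR (N + 1))%R by (apply lt_0_INR; lia). lra.
Qed.

(** Each half-line contributes at most 3, the index 0 being counted in both; the square of 6 is the
    constant 36 of the lattice. *)
Lemma rsum_wt1_le (l : list Z) : NoDup l -> (rsum wt1 l <= 6)%R.
Proof.
  intros ND.
  assert (HN : exists N, forall k, In k l -> (Z.abs k <= Z.of_nat N)%Z).
  { clear ND. induction l as [|a l [N H]]; [exists 0%nat; now intros|].
    exists (Nat.max N (Z.to_nat (Z.abs a))). intros k [<-|Hk]; [lia|].
    specialize (H k Hk). lia. }
  destruct HN as [N HN].
  set (sg := fun i : nat => (- Z.of_nat i)%Z).
  eapply Rle_trans.
  - apply (rsum_incl wt1 l (map Z.of_nat (seq 0 (N + 1)) ++ map sg (seq 0 (N + 1)))); auto.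
    + intros p. apply Rlt_le, wt1_pos.
    + intros k Hk. specialize (HN k Hk). apply in_or_app.
      destruct (Z_le_gt_dec 0 k) as [K|K]; [left|right]; apply in_map_iff;
        exists (Z.to_nat (Z.abs k)); rewrite in_seq; unfold sg; lia.
  - rewrite rsum_app, !rsum_map.
    assert (E : rsum (fun p => wt1 (sg p)) (seq 0 (N + 1))
      = rsum (fun i => wt1 (Z.of_nat i)) (seq 0 (N + 1))).
    { apply Rle_antisym; apply rsum_le; intros p _; unfold wt1, sg, zabs;
        rewrite Z.abs_opp; apply Rle_refl. }
    rewrite E. pose proof (rsum_wt1_nat N).
    assert (0 < 2 / sqrt (INR (N + 1)))%R.
    { apply Rdiv_lt_0_compat; [lra|]. apply sqrt_lt_R0, lt_0_INR. lia. }
    lra.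
Qed.

Lemma rsum_wt_le (l : list idx) : NoDup l -> (rsum wt l <= 36)%R.
Proof.
  intros ND. destruct (incl_box l) as [N HN].
  eapply Rle_trans; [apply (rsum_incl wt l (box N)); auto; intros p; apply Rlt_le, wt_pos|].
  eapply Rle_trans; [apply Req_le, (rsum_list_prod wt (zrange N) (zrange N))|].
  pose proof (rsum_wt1_le _ (NoDup_zrange N)) as H.
  set (B := rsum wt1 (zrange N)) in *.
  apply Rle_trans with (rsum (fun i => B * wt1 i)%R (zrange N)).
  - apply rsum_le. intros i _. unfold wt; simpl.
    rewrite rsum_scal. fold B. lra.
  - rewrite rsum_scal. fold B.
    assert (0 <= B)%R; [|nra].
    replace 0%R with (rsum (fun _ : Z => 0%R) (zrange N)) by (rewrite rsum_const; ring).
    apply rsum_le. intros p _. apply Rlt_le, wt1_pos.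
Qed.

Lemma pow32_mult_le a b u :
  (0 < a)%R -> (0 < b)%R -> (a <= u)%R -> (b <= u)%R -> (pow32 a * pow32 b <= u ^ 3)%R.
Proof.
  intros Ha Hb Hau Hbu. unfold pow32.
  assert (Hs : (sqrt a * sqrt b <= u)%R).
  { replace u with (sqrt u * sqrt u)%R at 1 by (apply sqrt_sqrt; lra).
    apply Rmult_le_compat; try apply sqrt_pos; apply sqrt_le_1; lra. }
  pose proof (sqrt_pos a). pose proof (sqrt_pos b).
  replace (a * sqrt a * (b * sqrt b))%R with (a * b * (sqrt a * sqrt b))%R by ring.
  replace (u ^ 3)%R with (u * u * u)%R by ring.
  apply Rmult_le_compat; auto; try apply Rmult_le_compat; try lra.
  - apply Rmult_le_pos; lra.
  - apply Rmult_le_pos; lra.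
Qed.

Definition summable (F : idx -> C) : Prop := exists K, forall p, (Cmod (F p) <= K * wt p)%R.

Lemma rsum_scal_wt_le K (l : list idx) :
  (0 <= K)%R -> NoDup l -> (rsum (fun p => K * wt p)%R l <= K * 36)%R.
Proof.
  intros HK ND. rewrite rsum_scal. apply Rmult_le_compat_l; auto. now apply rsum_wt_le.
Qed.

Lemma bound_nonneg F K (p : idx) : (Cmod (F p) <= K * wt p)%R -> (0 <= K)%R.
Proof.
  intros H. pose proof (Cmod_ge_0 (F p)). pose proof (wt_pos p). nra.
Qed.

Lemma summable_has_sum F : summable F -> has_sum F (Csum F).
Proof.
  intros [K HK].
  destruct (has_sum_dominated F (fun p => K * wt p)%R (K * 36)%R HK) as [s Hs].
  { intros l. apply rsum_scal_wt_le. exact (bound_nonneg F K (0, 0)%Z (HK _)). }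
  now rewrite (has_sum_Csum F s Hs).
Qed.

Lemma has_sum_wt_bound F K s :
  (forall p, Cmod (F p) <= K * wt p)%R -> has_sum F s -> (Cmod s <= K * 36)%R.
Proof.
  intros HK. apply has_sum_bound with (fun p => K * wt p)%R; auto.
  intros l. apply rsum_scal_wt_le. exact (bound_nonneg F K (0, 0)%Z (HK _)).
Qed.

Definition size (p : idx) : R := (1 + zabs (fst p) + zabs (snd p))%R.

Lemma size_ge_1 p : (1 <= size p)%R.
Proof. unfold size. pose proof (zabs_ge_0 (fst p)). pose proof (zabs_ge_0 (snd p)). lra. Qed.

Lemma size_inv_cube p : ((/ size p) ^ 3 <= wt p)%R.
Proof.
  pose proof (zabs_ge_0 (fst p)). pose proof (zabs_ge_0 (snd p)).
  pose proof (size_ge_1 p).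
  rewrite pow_inv. unfold wt, wt1. rewrite <- Rinv_mult.
  apply Rinv_le_contravar.
  - apply Rmult_lt_0_compat; apply pow32_pos; lra.
  - apply pow32_mult_le; unfold size; lra.
Qed.

Lemma size_inv_pow p k : (3 <= k)%nat -> ((/ size p) ^ k <= wt p)%R.
Proof.
  intros Hk. eapply Rle_trans; [|apply size_inv_cube].
  pose proof (size_ge_1 p). rewrite !pow_inv.
  apply Rinv_le_contravar; [apply pow_lt; lra | now apply Rle_pow].
Qed.

(** * Families of uniformly C^{1,1} functions of a complex variable *)

(* The quadratic remainder is required between any two points of a disc, so it also makes
   F' Lipschitz there. *)
Definition tame {I : Type} (W : I -> R) (F F' : C -> I -> C) (t0 : C) : Prop :=
  exists d K : R, (0 < d)%R /\ (0 <= K)%R /\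
    forall i s t, (Cmod (s - t0) < d)%R -> (Cmod (t - t0) < d)%R ->
      (Cmod (F s i) <= K * W i)%R /\ (Cmod (F' s i) <= K * W i)%R /\
      (Cmod (F t i - F s i - (t - s) * F' s i) <= K * W i * Cmod (t - s) ^ 2)%R.

Section Tame.
Context {I : Type}.
Implicit Types (W : I -> R) (F G : C -> I -> C).

Lemma tame_ext_near W F F' G G' t0 d0 : (0 < d0)%R ->
  (forall s i, (Cmod (s - t0) < d0)%R -> F s i = G s i /\ F' s i = G' s i) ->
  tame W F F' t0 -> tame W G G' t0.
Proof.
  intros Hd0 E [d [K [Hd [HK H]]]]. exists (Rmin d d0), K.
  split; [now apply Rmin_pos|]. split; [easy|]. intros i s t Hs Ht.
  pose proof (Rmin_l d d0). pose proof (Rmin_r d d0).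
  destruct (E s i) as [E1 E2]; [lra|]. destruct (E t i) as [E3 _]; [lra|].
  rewrite <- E1, <- E2, <- E3. apply H; lra.
Qed.

Lemma tame_ext W F F' G G' t0 :
  (forall s i, F s i = G s i) -> (forall s i, F' s i = G' s i) ->
  tame W F F' t0 -> tame W G G' t0.
Proof. intros E E'. apply tame_ext_near with 1%R; [lra | auto]. Qed.

Lemma tame_weight W V F F' t0 : (forall i, W i <= V i)%R ->
  tame W F F' t0 -> tame V F F' t0.
Proof.
  intros E [d [K [Hd [HK H]]]]. exists d, K. split; [easy|]. split; [easy|].
  intros i s t Hs Ht. destruct (H i s t Hs Ht) as [A [B D]].
  assert (K * W i <= K * V i)%R by (apply Rmult_le_compat_l; auto).
  repeat split; try lra.
  eapply Rle_trans; [apply D|]. apply Rmult_le_compat_r; auto. apply pow2_ge_0.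
Qed.

Lemma tame_const W (c : I -> C) t0 :
  (exists K, 0 <= K /\ forall i, Cmod (c i) <= K * W i)%R -> (forall i, 0 <= W i)%R ->
  tame W (fun _ => c) (fun _ _ => 0) t0.
Proof.
  intros [K [HK H]] HW. exists 1%R, K. split; [lra|]. split; [easy|].
  intros i s t _ _. specialize (HW i).
  assert (0 <= K * W i)%R by now apply Rmult_le_pos.
  rewrite Cmod_0. repeat split; auto.
  replace (c i - c i - (t - s) * 0) with (RtoC 0) by ring. rewrite Cmod_0.
  apply Rmult_le_pos; auto. apply pow2_ge_0.
Qed.

Lemma tame_id t0 : tame (fun _ : I => 1%R) (fun t _ => t) (fun _ _ => 1) t0.
Proof.
  exists 1%R, (Cmod t0 + 1)%R. pose proof (Cmod_ge_0 t0). split; [lra|]. split; [lra|].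
  intros i s t Hs Ht. repeat split.
  - replace s with ((s - t0) + t0) by ring.
    eapply Rle_trans; [apply Cmod_triangle|]. lra.
  - rewrite Cmod_1. lra.
  - replace (t - s - (t - s) * 1) with (RtoC 0) by ring. rewrite Cmod_0.
    apply Rmult_le_pos; [lra | apply pow2_ge_0].
Qed.

Lemma tame_plus W F F' G G' t0 :
  tame W F F' t0 -> tame W G G' t0 ->
  tame W (fun t i => F t i + G t i) (fun t i => F' t i + G' t i) t0.
Proof.
  intros [d [K [Hd [HK H]]]] [d2 [K2 [Hd2 [HK2 H2]]]].
  exists (Rmin d d2), (K + K2)%R. split; [now apply Rmin_pos|]. split; [lra|].
  intros i s t Hs Ht.
  destruct (H i s t) as [A [B D]]; try (eapply Rlt_le_trans; eauto; apply Rmin_l).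
  destruct (H2 i s t) as [A2 [B2 D2]]; try (eapply Rlt_le_trans; eauto; apply Rmin_r).
  repeat split.
  - eapply Rle_trans; [apply Cmod_triangle|]. lra.
  - eapply Rle_trans; [apply Cmod_triangle|]. lra.
  - replace (F t i + G t i - (F s i + G s i) - (t - s) * (F' s i + G' s i))
      with ((F t i - F s i - (t - s) * F' s i) + (G t i - G s i - (t - s) * G' s i)) by ring.
    eapply Rle_trans; [apply Cmod_triangle|]. lra.
Qed.

Lemma tame_scal W c F F' t0 :
  tame W F F' t0 -> tame W (fun t i => c * F t i) (fun t i => c * F' t i) t0.
Proof.
  intros [d [K [Hd [HK H]]]]. pose proof (Cmod_ge_0 c) as Hc.
  exists d, (Cmod c * K)%R. split; [easy|]. split; [now apply Rmult_le_pos|].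
  intros i s t Hs Ht. destruct (H i s t Hs Ht) as [A [B D]].
  rewrite !Cmod_mult, !Rmult_assoc.
  repeat split; try (apply Rmult_le_compat_l; auto).
  replace (c * F t i - c * F s i - (t - s) * (c * F' s i))
    with (c * (F t i - F s i - (t - s) * F' s i)) by ring.
  rewrite Cmod_mult. apply Rmult_le_compat_l; auto. lra.
Qed.

Lemma tame_minus W F F' G G' t0 :
  tame W F F' t0 -> tame W G G' t0 ->
  tame W (fun t i => F t i - G t i) (fun t i => F' t i - G' t i) t0.
Proof.
  intros HF HG. apply (tame_scal W (-1)) in HG.
  pose proof (tame_plus _ _ _ _ _ _ HF HG) as H.
  revert H. apply tame_ext; intros; ring.
Qed.

Lemma tame_mult W V F F' G G' t0 :
  tame W F F' t0 -> tame V G G' t0 ->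
  tame (fun i => W i * V i)%R (fun t i => F t i * G t i)
    (fun t i => F' t i * G t i + F t i * G' t i) t0.
Proof.
  intros [d [K [Hd [HK H]]]] [d2 [K2 [Hd2 [HK2 H2]]]].
  exists (Rmin 1 (Rmin d d2)), (7 * (K * K2))%R.
  assert (HKK : (0 <= K * K2)%R) by now apply Rmult_le_pos.
  split; [apply Rmin_pos; [lra | now apply Rmin_pos]|]. split; [lra|].
  intros i s t Hs Ht.
  assert (M1 : (Rmin 1 (Rmin d d2) <= 1)%R) by apply Rmin_l.
  assert (M2 : (Rmin 1 (Rmin d d2) <= d)%R)
    by (eapply Rle_trans; [apply Rmin_r | apply Rmin_l]).
  assert (M3 : (Rmin 1 (Rmin d d2) <= d2)%R)
    by (eapply Rle_trans; [apply Rmin_r | apply Rmin_r]).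
  destruct (H i s t) as [A [B D]]; try lra.
  destruct (H2 i s t) as [A2 [B2 D2]]; try lra.
  set (a := (K * W i)%R) in *. set (b := (K2 * V i)%R) in *.
  replace (7 * (K * K2) * (W i * V i))%R with (7 * (a * b))%R by (unfold a, b; ring).
  assert (Ha : (0 <= a)%R) by (eapply Rle_trans; [apply Cmod_ge_0 | apply A]).
  assert (Hb : (0 <= b)%R) by (eapply Rle_trans; [apply Cmod_ge_0 | apply A2]).
  assert (Hab : (0 <= a * b)%R) by now apply Rmult_le_pos.
  assert (Mul : forall x y, (Cmod x <= a)%R -> (Cmod y <= b)%R -> (Cmod (x * y) <= a * b)%R).
  { intros x y Hx Hy. rewrite Cmod_mult. apply Rmult_le_compat; auto; apply Cmod_ge_0. }
  repeat split.
  - specialize (Mul _ _ A A2). lra.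
  - eapply Rle_trans; [apply Cmod_triangle|].
    pose proof (Mul _ _ B A2). pose proof (Mul _ _ A B2). lra.
  - set (h := t - s) in *. set (r := Cmod h) in *.
    assert (Hr : (0 <= r <= 2)%R).
    { split; [apply Cmod_ge_0|]. unfold r, h.
      replace (t - s) with ((t - t0) - (s - t0)) by ring.
      eapply Rle_trans; [apply Cmod_triangle_minus|]. lra. }
    set (RF := F t i - F s i - h * F' s i) in *.
    set (RG := G t i - G s i - h * G' s i) in *.
    (* The last bracket is [G t i - G s i]. Capping the radius at 1 gives [r <= 2], which makes that
       bracket at most [3 * b * r]; the three summands then cost 1, 1 and 3, within the constant
       7. *)
    replace (F t i * G t i - F s i * G s i - h * (F' s i * G s i + F s i * G' s i))
      with (RF * G t i + F s i * RG + h * F' s i * (RG + h * G' s i))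
      by (unfold RF, RG; ring).
    destruct (H2 i t t) as [A3 _]; try lra.
    assert (E1 : (Cmod (RF * G t i) <= a * b * r ^ 2)%R).
    { rewrite Cmod_mult. replace (a * b * r ^ 2)%R with (a * r ^ 2 * b)%R by ring.
      apply Rmult_le_compat; auto; apply Cmod_ge_0. }
    assert (E2 : (Cmod (F s i * RG) <= a * b * r ^ 2)%R).
    { rewrite Cmod_mult. replace (a * b * r ^ 2)%R with (a * (b * r ^ 2))%R by ring.
      apply Rmult_le_compat; auto; apply Cmod_ge_0. }
    assert (E3 : (Cmod (h * F' s i * (RG + h * G' s i)) <= 3 * (a * b) * r ^ 2)%R).
    { rewrite !Cmod_mult. fold r.
      assert (T : (Cmod (RG + h * G' s i) <= 3 * b * r)%R).
      { eapply Rle_trans; [apply Cmod_triangle|]. rewrite Cmod_mult. fold r.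
        assert (r * Cmod (G' s i) <= r * b)%R by (apply Rmult_le_compat_l; lra).
        assert (0 <= b * r)%R by (apply Rmult_le_pos; lra).
        assert (b * r ^ 2 <= 2 * (b * r))%R.
        { replace (b * r ^ 2)%R with (r * (b * r))%R by ring.
          apply Rmult_le_compat_r; lra. }
        lra. }
      replace (3 * (a * b) * r ^ 2)%R with (r * a * (3 * b * r))%R by ring.
      apply Rmult_le_compat; auto; try apply Cmod_ge_0.
      - apply Rmult_le_pos; [lra | apply Cmod_ge_0].
      - apply Rmult_le_compat_l; lra. }
    eapply Rle_trans; [apply Cmod_triangle|].
    eapply Rle_trans; [apply Rplus_le_compat_r, Cmod_triangle|].
    assert (0 <= a * b * r ^ 2)%R by (apply Rmult_le_pos; auto; apply pow2_ge_0).
    lra.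
Qed.

Lemma tame_pow W F F' t0 k :
  tame W F F' t0 ->
  tame (fun i => W i ^ S k)%R (fun t i => F t i ^ S k)
    (fun t i => INR (S k) * (F' t i * F t i ^ k)) t0.
Proof.
  intros H. induction k as [|k IH].
  - apply tame_weight with W; [intros; lra|].
    revert H. apply tame_ext; intros; simpl; ring.
  - pose proof (tame_mult _ _ _ _ _ _ _ H IH) as HM.
    apply (tame_weight _ (fun i => W i ^ S (S k))%R) in HM; [|intros; simpl; lra].
    revert HM. apply tame_ext; intros s i; [easy|].
    rewrite (S_INR (S k)), RtoC_plus. rewrite (Cpow_S _ k). ring.
Qed.

(** One estimate serves differentiation in z, where [b i] is 1, and in tau, where [b i] grows with
    the lattice index; hence the bound [Cb * M i]. The radius [d] is such that the denominator loses
    at most half of its lower bound [dl * M i], and the remainder is exactly [b^2 (t - s)^2 x^2 y]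
    for the two inverses [x], [y]. The mask [e] removes the index at which the denominator may
    vanish. *)
Lemma tame_inv_affine (e : I -> bool) (a b : I -> C) (M : I -> R) t0 dl Cb :
  (0 < dl)%R -> (0 <= Cb)%R -> (forall i, 0 < M i)%R ->
  (forall i, e i = false -> dl * M i <= Cmod (a i + b i * t0))%R ->
  (forall i, Cmod (b i) <= Cb * M i)%R ->
  tame (fun i => / M i)%R
    (fun t i => if e i then 0 else / (a i + b i * t))
    (fun t i => if e i then 0 else - b i * (/ (a i + b i * t)) ^ 2) t0.
Proof.
  intros Hdl HCb HM Hlow Hb.
  set (d := (dl / (2 * (Cb + 1)))%R).
  assert (Hd : (0 < d)%R) by (apply Rdiv_lt_0_compat; lra).
  set (k1 := (2 / dl)%R).
  assert (Hk1 : (0 < k1)%R) by (apply Rdiv_lt_0_compat; lra).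
  exists d, (k1 + Cb * k1 ^ 2 + Cb ^ 2 * k1 ^ 3)%R.
  assert (T2 : (0 <= Cb * k1 ^ 2)%R) by (apply Rmult_le_pos; auto; apply pow2_ge_0).
  assert (T3 : (0 <= Cb ^ 2 * k1 ^ 3)%R)
    by (apply Rmult_le_pos; [apply pow2_ge_0 | apply pow_le; lra]).
  split; [easy|]. split; [lra|].
  intros i s t Hs Ht. specialize (HM i).
  assert (HMi : (0 < / M i)%R) by now apply Rinv_0_lt_compat.
  destruct (e i) eqn:Ei.
  - rewrite Cmod_0. replace (0 - 0 - (t - s) * 0) with (RtoC 0) by ring. rewrite Cmod_0.
    assert (P : (0 <= (k1 + Cb * k1 ^ 2 + Cb ^ 2 * k1 ^ 3) * / M i)%R)
      by (apply Rmult_le_pos; lra).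
    repeat split; auto. apply Rmult_le_pos; [easy | apply pow2_ge_0].
  - specialize (Hlow i Ei). specialize (Hb i).
    assert (low : forall u, (Cmod (u - t0) < d)%R -> (dl / 2 * M i <= Cmod (a i + b i * u))%R).
    { intros u Hu.
      pose proof (Cmod_triangle_inv (a i + b i * t0) (b i * (u - t0))) as T.
      replace (a i + b i * t0 + b i * (u - t0)) with (a i + b i * u) in T by ring.
      rewrite Cmod_mult in T.
      assert (Cmod (b i) * Cmod (u - t0) <= (Cb * M i) * d)%R
        by (apply Rmult_le_compat; try apply Cmod_ge_0; lra).
      assert (Cb * M i * d <= dl / 2 * M i)%R.
      { unfold d. replace (Cb * M i * (dl / (2 * (Cb + 1))))%R
          with (dl / 2 * M i * (Cb / (Cb + 1)))%R by (field; lra).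
        rewrite <- (Rmult_1_r (dl / 2 * M i)) at 2. apply Rmult_le_compat_l.
        - apply Rmult_le_pos; lra.
        - apply Rmult_le_reg_r with (Cb + 1)%R; [lra|]. field_simplify; lra. }
      lra. }
    assert (inv : forall u, (Cmod (u - t0) < d)%R ->
        a i + b i * u <> 0 /\ (Cmod (/ (a i + b i * u)) <= k1 * / M i)%R).
    { intros u Hu. specialize (low u Hu).
      assert (P : (0 < dl / 2 * M i)%R) by (apply Rmult_lt_0_compat; lra).
      assert (N0 : a i + b i * u <> 0) by (apply Cmod_gt_0; lra).
      split; auto. rewrite Cmod_inv; auto.
      replace (k1 * / M i)%R with (/ (dl / 2 * M i))%R by (unfold k1; field; lra).
      now apply Rinv_le_contravar. }
    destruct (inv s Hs) as [Ns Is]. destruct (inv t Ht) as [Nt It].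
    set (x := / (a i + b i * s)) in *. set (y := / (a i + b i * t)) in *.
    assert (bm : (Cmod (b i) <= Cb * M i)%R) by easy.
    assert (P1 : (0 <= k1 * / M i)%R) by (apply Rmult_le_pos; lra).
    repeat split.
    + eapply Rle_trans; [apply Is|]. apply Rmult_le_compat_r; lra.
    + replace (- b i * x ^ 2) with (- (b i * (x * x))) by (simpl; ring).
      rewrite Cmod_opp, !Cmod_mult.
      apply Rle_trans with ((Cb * M i) * ((k1 * / M i) * (k1 * / M i)))%R.
      * apply Rmult_le_compat; auto; try apply Cmod_ge_0.
        -- apply Rmult_le_pos; apply Cmod_ge_0.
        -- apply Rmult_le_compat; auto; apply Cmod_ge_0.
      * replace (Cb * M i * (k1 * / M i * (k1 * / M i)))%R with (Cb * k1 ^ 2 * / M i)%R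
          by (field; lra).
        apply Rmult_le_compat_r; lra.
    + replace (y - x - (t - s) * (- b i * x ^ 2)) with ((b i * b i) * ((t - s) * (t - s)) * (x * x * y))
        by (unfold x, y; field; auto).
      rewrite !Cmod_mult.
      apply Rle_trans with ((Cb * M i) * (Cb * M i) * (Cmod (t - s) * Cmod (t - s)) *
         ((k1 * / M i) * (k1 * / M i) * (k1 * / M i)))%R.
      * pose proof (Cmod_ge_0 (t - s)). pose proof (Cmod_ge_0 (b i)).
        pose proof (Cmod_ge_0 x). pose proof (Cmod_ge_0 y).
        repeat first [apply Rmult_le_compat | apply Rmult_le_pos | lra].
      * replace (Cb * M i * (Cb * M i) * (Cmod (t - s) * Cmod (t - s))
             * (k1 * / M i * (k1 * / M i) * (k1 * / M i)))%R
          with (Cb ^ 2 * k1 ^ 3 * / M i * Cmod (t - s) ^ 2)%R by (field; lra).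
        apply Rmult_le_compat_r; [apply pow2_ge_0|].
        apply Rmult_le_compat_r; lra.
Qed.

End Tame.

(** * Single functions of a complex variable *)

Definition ctame (f f' : C -> C) (t0 : C) : Prop :=
  tame (fun _ : unit => 1%R) (fun t _ => f t) (fun t _ => f' t) t0.

(** Termwise differentiation: the quadratic remainders are dominated by the weight as well, so they
    add up to a quadratic remainder of the sum. *)
Lemma ctame_Csum F F' t0 :
  tame wt F F' t0 -> ctame (fun t => Csum (F t)) (fun t => Csum (F' t)) t0.
Proof.
  intros [d [K [Hd [HK H]]]]. exists d, (K * 36)%R. split; [easy|]. split; [lra|].
  intros _ s t Hs Ht. rewrite !Rmult_1_r.
  assert (HF : forall u, (Cmod (u - t0) < d)%R -> has_sum (F u) (Csum (F u))).
  { intros u Hu. apply summable_has_sum. exists K. intros p. apply (H p u u Hu Hu). }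
  assert (HF' : has_sum (F' s) (Csum (F' s))).
  { apply summable_has_sum. exists K. intros p. apply (H p s s Hs Hs). }
  repeat split.
  - apply has_sum_wt_bound with (F s); auto. intros p. apply (H p s s Hs Hs).
  - apply has_sum_wt_bound with (F' s); auto. intros p. apply (H p s s Hs Hs).
  - set (r := Cmod (t - s)).
    replace (K * 36 * r ^ 2)%R with (K * r ^ 2 * 36)%R by ring.
    apply has_sum_wt_bound with (fun p => F t p - F s p - (t - s) * F' s p).
    + intros p. destruct (H p s t Hs Ht) as [_ [_ D]]. fold r in D. lra.
    + apply has_sum_minus; [apply has_sum_minus; auto | apply has_sum_scal; auto].
Qed.

Lemma ctame_ext_near f f' g g' z d : (0 < d)%R ->
  (forall s, (Cmod (s - z) < d)%R -> f s = g s /\ f' s = g' s) ->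
  ctame f f' z -> ctame g g' z.
Proof. intros Hd E. apply tame_ext_near with d; auto. Qed.

Lemma ctame_ext f f' g g' z :
  (forall s, f s = g s) -> (forall s, f' s = g' s) -> ctame f f' z -> ctame g g' z.
Proof. intros E E'. apply tame_ext; auto. Qed.

Lemma ctame_const c z : ctame (fun _ => c) (fun _ => 0) z.
Proof.
  apply (tame_const (fun _ : unit => 1%R) (fun _ => c)); [|intros; lra].
  exists (Cmod c). pose proof (Cmod_ge_0 c). split; intros; lra.
Qed.

Lemma ctame_plus f f' g g' z : ctame f f' z -> ctame g g' z ->
  ctame (fun t => f t + g t) (fun t => f' t + g' t) z.
Proof. apply tame_plus. Qed.

Lemma ctame_minus f f' g g' z : ctame f f' z -> ctame g g' z ->
  ctame (fun t => f t - g t) (fun t => f' t - g' t) z.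
Proof. apply tame_minus. Qed.

Lemma ctame_scal c f f' z : ctame f f' z ->
  ctame (fun t => c * f t) (fun t => c * f' t) z.
Proof. apply tame_scal. Qed.

Lemma ctame_mult f f' g g' z : ctame f f' z -> ctame g g' z ->
  ctame (fun t => f t * g t) (fun t => f' t * g t + f t * g' t) z.
Proof.
  intros Hf Hg. apply (tame_weight _ _ _ _ _ (fun _ => Req_le _ _ (Rmult_1_r 1))).
  now apply (tame_mult _ _ _ _ _ _ _ Hf Hg).
Qed.

Lemma ctame_pow f f' z k : ctame f f' z ->
  ctame (fun t => f t ^ S k) (fun t => INR (S k) * (f' t * f t ^ k)) z.
Proof.
  intros Hf.
  apply (tame_weight (fun _ => 1 ^ S k)%R _ _ _ _ (fun _ => Req_le _ _ (pow1 (S k)))).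
  now apply (tame_pow _ _ _ _ k Hf).
Qed.

Lemma ctame_inv (z : C) : z <> 0 -> ctame (fun t => / t) (fun t => - (/ t) ^ 2) z.
Proof.
  intros Hz. apply (proj1 (Cmod_gt_0 z)) in Hz.
  apply (tame_weight (fun _ : unit => / 1)%R); [intros; lra|].
  assert (H : tame (fun _ : unit => / 1)%R
    (fun t _ => if false then 0 else / (0 + 1 * t))
    (fun t _ => if false then 0 else - (1) * (/ (0 + 1 * t)) ^ 2) z).
  { apply (tame_inv_affine (fun _ => false) (fun _ => 0) (fun _ => 1) (fun _ => 1%R) z (Cmod z) 1);
      try lra; intros; try lra.
    - replace (0 + 1 * z) with z by ring. lra.
    - rewrite Cmod_1. lra. }
  revert H. apply tame_ext; intros s _; replace (0 + 1 * s) with s by ring; ring.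
Qed.

Lemma ctame_opp_arg f f' z :
  ctame f f' (- z) -> ctame (fun t => f (- t)) (fun t => - f' (- t)) z.
Proof.
  intros [d [K [Hd [HK H]]]]. exists d, K. split; [easy|]. split; [easy|].
  intros i s t Hs Ht.
  assert (E : forall u, Cmod (- u - - z) = Cmod (u - z)).
  { intros u. rewrite <- Cmod_opp. f_equal. ring. }
  destruct (H i (- s) (- t)) as [A [B D]]; try now rewrite E.
  rewrite Cmod_opp. repeat split; auto.
  replace (f (- t) - f (- s) - (t - s) * - f' (- s))
    with (f (- t) - f (- s) - (- t - - s) * f' (- s)) by ring.
  eapply Rle_trans; [apply D|]. right. f_equal. f_equal.
  rewrite <- Cmod_opp. f_equal. ring.
Qed.

Lemma ctame_shift f f' z w :
  ctame f f' (z + w) -> ctame (fun t => f (t + w)) (fun t => f' (t + w)) z.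
Proof.
  intros [d [K [Hd [HK H]]]]. exists d, K. split; [easy|]. split; [easy|].
  intros i s t Hs Ht.
  assert (E : forall u v, u + w - (v + w) = u - v) by (intros; ring).
  specialize (H i (s + w) (t + w)). rewrite !E in H. now apply H.
Qed.

Lemma ctame_unique f f' g g' z d : (0 < d)%R ->
  (forall s, (Cmod (s - z) < d)%R -> f s = g s) ->
  ctame f f' z -> ctame g g' z -> f' z = g' z.
Proof.
  intros Hd E Hf Hg.
  pose proof (ctame_minus _ _ _ _ _ Hf Hg) as [d2 [K [Hd2 [HK H]]]].
  set (l := f' z - g' z) in *.
  assert (Hl : (Cmod l <= 0)%R).
  { apply le_epsilon. intros eps He.
    set (r := (Rmin (Rmin (d / 2) (d2 / 2)) (eps / (K + 1)))%R).
    assert (Hr : (0 < r)%R).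
    { unfold r. repeat apply Rmin_pos; try lra. apply Rdiv_lt_0_compat; lra. }
    assert (R1 : (r <= d / 2)%R) by (unfold r; eapply Rle_trans; [apply Rmin_l | apply Rmin_l]).
    assert (R2 : (r <= d2 / 2)%R) by (unfold r; eapply Rle_trans; [apply Rmin_l | apply Rmin_r]).
    assert (R3 : (r <= eps / (K + 1))%R) by apply Rmin_r.
    assert (Ez : z - z = 0) by ring.
    assert (Er : z + RtoC r - z = RtoC r) by ring.
    destruct (H tt z (z + RtoC r)) as [_ [_ D]].
    { rewrite Ez, Cmod_0. lra. }
    { rewrite Er, Cmod_R, Rabs_pos_eq; lra. }
    rewrite (E z) in D by (rewrite Ez, Cmod_0; lra).
    rewrite (E (z + RtoC r)) in D by (rewrite Er, Cmod_R, Rabs_pos_eq; lra).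
    rewrite Er in D. fold l in D.
    replace (g (z + r) - g (z + r) - (g z - g z) - r * l) with (- (r * l)) in D by ring.
    rewrite Cmod_opp, Cmod_mult, Cmod_R, Rabs_pos_eq, Rmult_1_r in D by lra.
    assert (Cmod l <= K * r)%R.
    { apply Rmult_le_reg_l with r; [easy|]. lra. }
    assert (K * r <= (K + 1) * (eps / (K + 1)))%R.
    { apply Rmult_le_compat; lra. }
    replace ((K + 1) * (eps / (K + 1)))%R with eps in * by (field; lra). lra. }
  assert (l = 0) by (apply Cmod_eq_0; pose proof (Cmod_ge_0 l); lra).
  unfold l in *. replace (f' z) with ((f' z - g' z) + g' z) by ring. rewrite H0. ring.
Qed.

Definition lipschitz_near (f : C -> C) (z : C) : Prop :=
  exists d K, (0 < d)%R /\ (0 <= K)%R /\ forall s t,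
    (Cmod (s - z) < d)%R -> (Cmod (t - z) < d)%R -> (Cmod (f t - f s) <= K * Cmod (t - s))%R.

Lemma ctame_lipschitz_near f f' z : ctame f f' z -> lipschitz_near f z.
Proof.
  intros [d [K [Hd [HK H]]]]. exists (Rmin d 1), (3 * K)%R.
  split; [apply Rmin_pos; lra|]. split; [lra|]. intros s t Hs Ht.
  pose proof (Rmin_l d 1). pose proof (Rmin_r d 1).
  destruct (H tt s t) as [_ [B D]]; try lra.
  set (h := t - s) in *.
  assert (Hh : (0 <= Cmod h <= 2)%R).
  { split; [apply Cmod_ge_0|]. unfold h. replace (t - s) with ((t - z) - (s - z)) by ring.
    eapply Rle_trans; [apply Cmod_triangle_minus|]. lra. }
  replace (f t - f s) with ((f t - f s - h * f' s) + h * f' s) by ring.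
  eapply Rle_trans; [apply Cmod_triangle|]. rewrite Cmod_mult.
  assert (Cmod h * Cmod (f' s) <= Cmod h * K)%R by (apply Rmult_le_compat_l; lra).
  assert (K * Cmod h ^ 2 <= K * (2 * Cmod h))%R.
  { apply Rmult_le_compat_l; auto. simpl. rewrite Rmult_1_r. apply Rmult_le_compat_r; lra. }
  lra.
Qed.

Lemma ctame_is_derive f f' z :
  ctame f f' z -> is_derive (K := C_AbsRing) (V := C_NormedModule) f z (f' z).
Proof.
  intros [d [K [Hd [HK H]]]]. split; [apply is_linear_scal_l|].
  intros x Hx. apply (is_filter_lim_locally_unique (V := AbsRing_NormedModule C_AbsRing)) in Hx.
  rewrite <- Hx. clear x Hx.
  intros eps.
  assert (Hr : (0 < Rmin d (eps / (K + 1)))%R).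
  { apply Rmin_pos; auto. apply Rdiv_lt_0_compat; [apply cond_pos | lra]. }
  apply (locally_norm_le_locally (V := AbsRing_NormedModule C_AbsRing) z).
  exists (mkposreal _ Hr). intros t Ht.
  change (Cmod (t - z) < Rmin d (eps / (K + 1)))%R in Ht.
  pose proof (Rmin_l d (eps / (K + 1))). pose proof (Rmin_r d (eps / (K + 1))).
  change (Cmod (f t - f z - (t - z) * f' z) <= eps * Cmod (t - z))%R.
  destruct (H tt z t) as [_ [_ D]]; try lra.
  { replace (z - z) with (RtoC 0) by ring. rewrite Cmod_0. lra. }
  eapply Rle_trans; [apply D|]. simpl. rewrite !Rmult_1_r, <- Rmult_assoc.
  apply Rmult_le_compat_r; [apply Cmod_ge_0|].
  pose proof (Cmod_ge_0 (t - z)).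
  apply Rle_trans with ((K + 1) * (eps / (K + 1)))%R.
  - apply Rmult_le_compat; lra.
  - right. field. lra.
Qed.

(** * Lattice sums *)

Definition lat (tau : C) (p : idx) : C := ZtoC (fst p) + ZtoC (snd p) * tau.

Definition off_lattice (tau z : C) : Prop := forall p, z <> lat tau p.

Definition off_lattice_but_0 (tau z : C) : Prop := forall p, p <> (0, 0)%Z -> z <> lat tau p.

Definition is0 (p : idx) : bool := ((fst p =? 0) && (snd p =? 0))%Z.

Lemma is0_true p : is0 p = true -> p = (0, 0)%Z.
Proof.
  unfold is0. intros H. apply andb_prop in H. destruct p; simpl in *.
  destruct H as [H1 H2]. apply Z.eqb_eq in H1, H2. congruence.
Qed.

Lemma is0_false p : is0 p = false -> p <> (0, 0)%Z.
Proof. intros H E. subst. discriminate. Qed.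

Lemma lat_0 tau : lat tau (0, 0)%Z = 0.
Proof. unfold lat, ZtoC. cbn [fst snd]. ring. Qed.

Lemma ZtoC_plus a b : ZtoC (a + b) = ZtoC a + ZtoC b.
Proof. unfold ZtoC. now rewrite plus_IZR, RtoC_plus. Qed.

Lemma ZtoC_minus a b : ZtoC (a - b) = ZtoC a - ZtoC b.
Proof. unfold ZtoC. now rewrite minus_IZR, RtoC_minus. Qed.

Lemma ZtoC_mult a b : ZtoC (a * b) = ZtoC a * ZtoC b.
Proof. unfold ZtoC. now rewrite mult_IZR, RtoC_mult. Qed.

Lemma ZtoC_opp a : ZtoC (- a) = - ZtoC a.
Proof. unfold ZtoC. now rewrite opp_IZR, RtoC_opp. Qed.

Lemma linear_form_lower (tau : C) : (0 < Im tau)%R ->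
  exists c, (0 < c)%R /\ forall x y : R,
    (c * (Rabs x + Rabs y) <= Cmod (RtoC x + RtoC y * tau))%R.
Proof.
  intros Ht. pose proof (Cmod_ge_0 tau) as HT.
  exists (Im tau / (Im tau + 1 + Cmod tau))%R. split; [apply Rdiv_lt_0_compat; lra|].
  intros x y. set (u := RtoC x + RtoC y * tau).
  assert (H1 : (Rabs y * Im tau <= Cmod u)%R).
  { rewrite <- (Rabs_pos_eq (Im tau)) by lra. rewrite <- Rabs_mult.
    replace (y * Im tau)%R with (Im u) by (unfold u, Im; simpl; ring). apply im_le_Cmod. }
  assert (H2 : (Rabs x <= Cmod u + Rabs y * Cmod tau)%R).
  { rewrite <- !Cmod_R, <- Cmod_mult.
    replace (RtoC x) with (u - RtoC y * tau) by (unfold u; ring).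
    apply Cmod_triangle_minus. }
  apply Rmult_le_reg_l with (Im tau + 1 + Cmod tau)%R; [lra|].
  replace ((Im tau + 1 + Cmod tau) * (Im tau / (Im tau + 1 + Cmod tau) * (Rabs x + Rabs y)))%R
    with (Im tau * Rabs x + Rabs y * Im tau)%R by (field; lra).
  assert (Im tau * Rabs x <= Im tau * (Cmod u + Rabs y * Cmod tau))%R
    by (apply Rmult_le_compat_l; lra).
  assert (Rabs y * Im tau * Cmod tau <= Cmod u * Cmod tau)%R
    by (apply Rmult_le_compat_r; lra).
  lra.
Qed.

Lemma integer_gap (a : R) :
  exists d, (0 < d)%R /\ forall m : Z, a = IZR m \/ (d <= Rabs (a - IZR m))%R.
Proof.
  destruct (archimed a) as [H1 H2]. set (k := up a) in *.
  (* [up a] lies strictly above [a] and at most 1 above it, so the distance 1 singles out the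
     integers, with value [k - 1]. *)
  destruct (Req_dec (IZR k - a) 1) as [E|E].
  - exists 1%R. split; [lra|]. intros m.
    destruct (Z.eq_dec m (k - 1)) as [->|Hm]; [left; rewrite minus_IZR; lra|].
    right. replace (a - IZR m)%R with (IZR (k - 1 - m)) by (rewrite !minus_IZR; lra).
    rewrite Rabs_Zabs. apply (IZR_le 1). lia.
  - exists (Rmin (IZR k - a) (1 - (IZR k - a)))%R. split; [apply Rmin_pos; lra|].
    intros m. right. destruct (Z_lt_le_dec m k) as [L|L].
    + assert (IZR m <= IZR (k - 1))%R by (apply IZR_le; lia). rewrite minus_IZR in *.
      rewrite Rabs_pos_eq by lra. eapply Rle_trans; [apply Rmin_r|]. lra.
    + apply IZR_le in L. rewrite Rabs_left1 by lra.
      eapply Rle_trans; [apply Rmin_l|]. lra.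
Qed.

Lemma size_shift (a b : R) (p : idx) :
  (size p <= (1 + Rabs a + Rabs b) + (Rabs (a - IZR (fst p)) + Rabs (b - IZR (snd p))))%R.
Proof.
  unfold size. rewrite !zabs_Rabs.
  pose proof (Rabs_triang a (- (a - IZR (fst p)))) as T1.
  pose proof (Rabs_triang b (- (b - IZR (snd p)))) as T2.
  rewrite Rabs_Ropp in T1, T2.
  replace (a + - (a - IZR (fst p)))%R with (IZR (fst p)) in T1 by ring.
  replace (b + - (b - IZR (snd p)))%R with (IZR (snd p)) in T2 by ring.
  lra.
Qed.

Lemma lattice_coords (tau z : C) : (0 < Im tau)%R ->
  exists a b : R, z = RtoC a + RtoC b * tau.
Proof.
  intros Ht. exists (Re z - Im z / Im tau * Re tau)%R, (Im z / Im tau)%R.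
  apply C_ext; unfold Re, Im in *; simpl; field; lra.
Qed.

(** A distance bounded below by a multiple of [size] turns inverse powers of the distance into the
    weight. Real coordinates are kept because later [a] and [b] stay fixed while [tau] moves. The
    constant comes from [size p <= A + x] and [x >= e], since [x / (A + x)] increases with [x]. *)
Lemma lattice_gap_coords (tau : C) (a b : R) : (0 < Im tau)%R ->
  exists d, (0 < d)%R /\ forall p, ~ (a = IZR (fst p) /\ b = IZR (snd p)) ->
    (d * size p <= Cmod (RtoC (a - IZR (fst p)) + RtoC (b - IZR (snd p)) * tau))%R.
Proof.
  intros Ht.
  destruct (linear_form_lower tau Ht) as [c [Hc Lc]].
  destruct (integer_gap a) as [d1 [Hd1 G1]]. destruct (integer_gap b) as [d2 [Hd2 G2]].
  set (A := (1 + Rabs a + Rabs b)%R).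
  assert (HA : (1 <= A)%R) by (pose proof (Rabs_pos a); pose proof (Rabs_pos b); unfold A; lra).
  set (e := Rmin d1 d2).
  assert (He : (0 < e)%R) by now apply Rmin_pos.
  exists (c * (e / (A + e)))%R. split.
  { apply Rmult_lt_0_compat; auto. apply Rdiv_lt_0_compat; lra. }
  intros p Hp. eapply Rle_trans; [|apply Lc].
  rewrite Rmult_assoc. apply Rmult_le_compat_l; [lra|].
  set (x := (Rabs (a - IZR (fst p)) + Rabs (b - IZR (snd p)))%R).
  assert (Hx : (e <= x)%R).
  { pose proof (Rabs_pos (a - IZR (fst p))). pose proof (Rabs_pos (b - IZR (snd p))).
    unfold x. assert (e <= d1)%R by apply Rmin_l. assert (e <= d2)%R by apply Rmin_r.
    destruct (G1 (fst p)) as [E1|E1]; [destruct (G2 (snd p)) as [E2|E2]|];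
      [exfalso; now apply Hp | lra | lra]. }
  pose proof (size_shift a b p) as Hs. fold A in Hs. fold x in Hs.
  apply Rle_trans with (e / (A + e) * (A + x))%R.
  - apply Rmult_le_compat_l; [|lra]. apply Rlt_le, Rdiv_lt_0_compat; lra.
  - apply Rmult_le_reg_l with (A + e)%R; [lra|].
    replace ((A + e) * (e / (A + e) * (A + x)))%R with (e * A + e * x)%R by (field; lra).
    nra.
Qed.

Lemma coords_minus_lat tau (a b : R) p :
  RtoC a + RtoC b * tau - lat tau p =
  RtoC (a - IZR (fst p)) + RtoC (b - IZR (snd p)) * tau.
Proof. unfold lat, ZtoC. rewrite !RtoC_minus. ring. Qed.

Lemma lattice_gap (tau z : C) : (0 < Im tau)%R ->
  exists d, (0 < d)%R /\ forall p, z <> lat tau p -> (d * size p <= Cmod (z - lat tau p))%R.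
Proof.
  intros Ht. destruct (lattice_coords tau z Ht) as [a [b ->]].
  destruct (lattice_gap_coords tau a b Ht) as [d [Hd H]].
  exists d. split; auto. intros p Hp. rewrite coords_minus_lat. apply H.
  intros [E1 E2]. apply Hp. unfold lat, ZtoC. now rewrite E1, E2.
Qed.

Lemma lat_neq_0 tau p : (0 < Im tau)%R -> p <> (0, 0)%Z -> lat tau p <> 0.
Proof.
  intros Ht Hp E. apply Hp. destruct p as [m n].
  assert (I0 : Im (lat tau (m, n)) = 0%R) by now rewrite E.
  assert (R0 : Re (lat tau (m, n)) = 0%R) by now rewrite E.
  unfold lat, ZtoC, Re, Im in *; simpl in *.
  assert (En : IZR n = 0%R).
  { apply Rmult_eq_reg_r with (snd tau); lra. }
  rewrite En in R0. assert (Em : IZR m = 0%R) by lra.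
  apply eq_IZR in En, Em. congruence.
Qed.

Lemma off_lattice_but_0_0 tau : (0 < Im tau)%R -> off_lattice_but_0 tau 0.
Proof. intros Ht p Hp E. now apply (lat_neq_0 tau p). Qed.

Lemma off_lattice_weaken tau z : off_lattice tau z -> off_lattice_but_0 tau z.
Proof. intros H p _. apply H. Qed.

Lemma off_lattice_neq_0 tau z : off_lattice tau z -> z <> 0.
Proof. intros H. rewrite <- (lat_0 tau). apply H. Qed.

Lemma off_lattice_iff tau z : off_lattice tau z <-> off_lattice_but_0 tau z /\ z <> 0.
Proof.
  split.
  - intros H. split; [now apply off_lattice_weaken | now apply (off_lattice_neq_0 tau)].
  - intros [H1 H2] p. destruct (idx_dec p (0, 0)%Z) as [->|Hp]; [now rewrite lat_0 | auto].
Qed.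

Lemma lat_neg tau p : lat tau (- fst p, - snd p)%Z = - lat tau p.
Proof. unfold lat; simpl. rewrite !ZtoC_opp. ring. Qed.

Lemma neg_neg (p : idx) :
  (- fst (- fst p, - snd p), - snd (- fst p, - snd p))%Z = p.
Proof. destruct p; simpl. f_equal; ring. Qed.

Lemma neg_neq_0 (p : idx) : p <> (0, 0)%Z -> ((- fst p, - snd p) <> (0, 0))%Z.
Proof. intros H E. apply H. destruct p; simpl in *. injection E; intros. f_equal; lia. Qed.

Lemma off_lattice_but_0_opp tau z : off_lattice_but_0 tau z -> off_lattice_but_0 tau (- z).
Proof.
  intros H p Hp E. apply (H (- fst p, - snd p)%Z); [now apply neg_neq_0|].
  rewrite lat_neg, <- E. ring.
Qed.

Lemma off_lattice_opp tau z : off_lattice tau z -> off_lattice tau (- z).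
Proof.
  intros H p E. apply (H (- fst p, - snd p)%Z). rewrite lat_neg, <- E. ring.
Qed.

Lemma off_lattice_but_0_open tau z : (0 < Im tau)%R -> off_lattice_but_0 tau z ->
  exists d, (0 < d)%R /\ forall s, (Cmod (s - z) < d)%R -> off_lattice_but_0 tau s.
Proof.
  intros Ht Hz. destruct (lattice_gap tau z Ht) as [d [Hd H]]. exists d. split; auto.
  intros s Hs p Hp E. specialize (H p (Hz p Hp)). rewrite <- E, Cmod_minus_sym in H.
  pose proof (size_ge_1 p). nra.
Qed.

Lemma off_lattice_open tau z : (0 < Im tau)%R -> off_lattice tau z ->
  exists d, (0 < d)%R /\ forall s, (Cmod (s - z) < d)%R -> off_lattice tau s.
Proof.
  intros Ht Hz. destruct (lattice_gap tau z Ht) as [d [Hd H]]. exists d. split; auto.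
  intros s Hs p E. specialize (H p (Hz p)). rewrite <- E, Cmod_minus_sym in H.
  pose proof (size_ge_1 p). nra.
Qed.

(* The lattice origin is left out, so that sums over recip are regular at z = 0. *)
Definition recip (tau z : C) (p : idx) : C := if is0 p then 0 else / (z - lat tau p).

Lemma tame_recip tau z : (0 < Im tau)%R -> off_lattice_but_0 tau z ->
  tame (fun p => / size p)%R (fun t p => recip tau t p) (fun t p => - recip tau t p ^ 2) z.
Proof.
  intros Ht Hz. destruct (lattice_gap tau z Ht) as [d [Hd H]].
  assert (Hm : forall i t, - lat tau i + 1 * t = t - lat tau i) by (intros; ring).
  assert (T : tame (fun p => / size p)%R
     (fun t p => if is0 p then 0 else / (- lat tau p + 1 * t))
     (fun t p => if is0 p then 0 else - (1) * (/ (- lat tau p + 1 * t)) ^ 2) z).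
  { apply (tame_inv_affine is0 (fun p => - lat tau p) (fun _ => 1) size z d 1); try lra.
    - intros i. pose proof (size_ge_1 i). lra.
    - intros i Hi. rewrite Hm. apply H, Hz, is0_false, Hi.
    - intros i. rewrite Cmod_1. pose proof (size_ge_1 i). lra. }
  revert T. apply tame_ext; intros s i; unfold recip; rewrite Hm; destruct (is0 i); ring.
Qed.

Lemma recip_0_bound tau : (0 < Im tau)%R ->
  exists K, (0 <= K)%R /\ forall p, (Cmod (recip tau 0 p) <= K * / size p)%R.
Proof.
  intros Ht. destruct (tame_recip tau 0 Ht (off_lattice_but_0_0 tau Ht)) as [d [K [Hd [HK H]]]].
  exists K. split; auto. intros p.
  assert (Z0 : (Cmod (0 - 0) < d)%R).
  { replace (0 - 0) with (RtoC 0) by ring. now rewrite Cmod_0. }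
  apply (H p 0 0 Z0 Z0).
Qed.

Lemma tame_recip_0 tau z : (0 < Im tau)%R ->
  tame (fun p => / size p)%R (fun _ p => recip tau 0 p) (fun _ _ => 0) z.
Proof.
  intros Ht. apply tame_const; [now apply recip_0_bound|].
  intros p. pose proof (size_ge_1 p). apply Rlt_le, Rinv_0_lt_compat. lra.
Qed.

Lemma tame_summable F F' z : tame wt F F' z -> summable (F z) /\ summable (F' z).
Proof.
  intros [d [K [Hd [HK H]]]].
  assert (Z0 : (Cmod (z - z) < d)%R).
  { replace (z - z) with (RtoC 0) by ring. now rewrite Cmod_0. }
  split; exists K; intros p; apply (H p z z Z0 Z0).
Qed.

Lemma Csum_scal c F : summable F -> Csum (fun p => c * F p) = c * Csum F.
Proof. intros H. apply has_sum_Csum, has_sum_scal. now apply summable_has_sum. Qed.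

(** The resolvent identity. With [u = recip tau z p] and [v = recip tau 0 p] it rewrites [u^2 - v^2]
    as [- z * u * v * (u + v)], a product of three factors of order [1 / size], and so exhibits the
    cubic decay that summability requires. *)
Lemma recip_relation tau z p : (0 < Im tau)%R -> off_lattice_but_0 tau z ->
  z * recip tau z p * recip tau 0 p = recip tau 0 p - recip tau z p.
Proof.
  intros Ht Hz. unfold recip. destruct (is0 p) eqn:E; [ring|]. apply is0_false in E.
  assert (N1 : z - lat tau p <> 0).
  { intros D. apply (Hz p E). replace z with ((z - lat tau p) + lat tau p) by ring.
    rewrite D. ring. }
  pose proof (lat_neq_0 tau p Ht E) as N2.
  assert (N3 : 0 - lat tau p <> 0).
  { intros D. apply N2. replace (lat tau p) with (- (0 - lat tau p)) by ring.
    rewrite D. ring. }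
  field. auto.
Qed.

Definition wpreg (tau z : C) : C := Csum (fun p => recip tau z p ^ 2 - recip tau 0 p ^ 2).

Definition esum (tau : C) (k : nat) (z : C) : C := Csum (fun p => recip tau z p ^ k).

Lemma tame_wpreg_term tau z : (0 < Im tau)%R -> off_lattice_but_0 tau z ->
  tame wt (fun t p => recip tau t p ^ 2 - recip tau 0 p ^ 2) (fun t p => - (2) * recip tau t p ^ 3) z.
Proof.
  intros Ht Hz. destruct (off_lattice_but_0_open tau z Ht Hz) as [d [Hd Ho]].
  pose proof (tame_recip tau z Ht Hz) as TA. pose proof (tame_recip_0 tau z Ht) as TA0.
  pose proof (tame_mult _ _ _ _ _ _ _ (tame_id z)
    (tame_mult _ _ _ _ _ _ _ TA
      (tame_mult _ _ _ _ _ _ _ TA0 (tame_plus _ _ _ _ _ _ TA TA0)))) as T.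
  apply (tame_scal _ (-1)) in T.
  apply (tame_weight _ wt) in T.
  2:{ intros p. eapply Rle_trans; [|apply (size_inv_cube p)]. right. ring. }
  revert T. apply tame_ext_near with d; auto. intros t p Hp.
  pose proof (recip_relation tau t p Ht (Ho t Hp)) as R.
  set (u := recip tau t p) in *. set (v := recip tau 0 p) in *. split.
  - transitivity (- (t * u * v) * (u + v)); [ring|]. rewrite R. ring.
  - transitivity (- (u * v * (u + v)) + t * u * v * (u * (u + v)) + t * u * v * u ^ 2);
      [ring|]. rewrite R. ring.
Qed.

Lemma tame_recip_pow tau z k : (0 < Im tau)%R -> off_lattice_but_0 tau z -> (3 <= k)%nat ->
  tame wt (fun t p => recip tau t p ^ k) (fun t p => - INR k * recip tau t p ^ S k) z.
Proof.
  intros Ht Hz Hk. destruct k as [|k]; [lia|].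
  pose proof (tame_pow _ _ _ _ k (tame_recip tau z Ht Hz)) as T.
  apply (tame_weight _ wt) in T; [|intros p; now apply size_inv_pow].
  revert T. apply tame_ext; intros t p; [easy|].
  rewrite !Cpow_S. ring.
Qed.

Lemma ctame_wpreg tau z : (0 < Im tau)%R -> off_lattice_but_0 tau z ->
  ctame (wpreg tau) (fun t => - (2) * esum tau 3 t) z.
Proof.
  intros Ht Hz. destruct (off_lattice_but_0_open tau z Ht Hz) as [d [Hd Ho]].
  generalize (ctame_Csum _ _ _ (tame_wpreg_term tau z Ht Hz)).
  apply ctame_ext_near with d; auto. intros t Hp. split; [easy|].
  apply Csum_scal. apply (tame_summable _ _ _ (tame_recip_pow tau t 3 Ht (Ho t Hp) (le_n 3))).
Qed.

Lemma ctame_esum tau z k : (0 < Im tau)%R -> off_lattice_but_0 tau z -> (3 <= k)%nat ->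
  ctame (esum tau k) (fun t => - INR k * esum tau (S k) t) z.
Proof.
  intros Ht Hz Hk. destruct (off_lattice_but_0_open tau z Ht Hz) as [d [Hd Ho]].
  generalize (ctame_Csum _ _ _ (tame_recip_pow tau z k Ht Hz Hk)).
  apply ctame_ext_near with d; auto. intros t Hp. split; [easy|].
  apply Csum_scal.
  apply (tame_summable _ _ _ (tame_recip_pow tau t (S k) Ht (Ho t Hp) (le_S _ _ Hk))).
Qed.

Lemma has_sum_wpreg tau z : (0 < Im tau)%R -> off_lattice_but_0 tau z ->
  has_sum (fun p => recip tau z p ^ 2 - recip tau 0 p ^ 2) (wpreg tau z).
Proof.
  intros Ht Hz. apply summable_has_sum.
  apply (tame_summable _ _ _ (tame_wpreg_term tau z Ht Hz)).
Qed.

Lemma has_sum_esum tau z k : (0 < Im tau)%R -> off_lattice_but_0 tau z -> (3 <= k)%nat ->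
  has_sum (fun p => recip tau z p ^ k) (esum tau k z).
Proof.
  intros Ht Hz Hk. apply summable_has_sum.
  apply (tame_summable _ _ _ (tame_recip_pow tau z k Ht Hz Hk)).
Qed.

Lemma recip_neg tau z p : off_lattice_but_0 tau z ->
  recip tau (- z) (- fst p, - snd p)%Z = - recip tau z p.
Proof.
  intros Hz. unfold recip. rewrite lat_neg.
  assert (E0 : is0 (- fst p, - snd p)%Z = is0 p).
  { unfold is0; simpl. destruct p as [m n]; simpl.
    destruct m, n; easy. }
  rewrite E0. destruct (is0 p) eqn:E; [ring|]. apply is0_false in E.
  assert (N1 : z - lat tau p <> 0).
  { intros D. apply (Hz p E). replace z with ((z - lat tau p) + lat tau p) by ring.
    rewrite D. ring. }
  assert (N2 : - z - - lat tau p <> 0).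
  { intros D. apply N1. replace (z - lat tau p) with (- (- z - - lat tau p)) by ring.
    rewrite D. ring. }
  field. auto.
Qed.

Lemma has_sum_neg F x : has_sum F x -> has_sum (fun p => F (- fst p, - snd p)%Z) x.
Proof.
  intros H. apply (has_sum_reindex F x (fun p => (- fst p, - snd p)%Z) (fun p => (- fst p, - snd p)%Z));
    auto using neg_neg.
Qed.

Lemma wpreg_even tau z : (0 < Im tau)%R -> off_lattice_but_0 tau z -> wpreg tau (- z) = wpreg tau z.
Proof.
  intros Ht Hz. apply has_sum_unique with (fun p => recip tau z p ^ 2 - recip tau 0 p ^ 2);
    [|now apply has_sum_wpreg].
  pose proof (has_sum_neg _ _ (has_sum_wpreg tau (- z) Ht (off_lattice_but_0_opp _ _ Hz))) as H.
  revert H. apply has_sum_ext. intros p.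
  assert (E0 : recip tau 0 (- fst p, - snd p)%Z = - recip tau 0 p).
  { rewrite <- (recip_neg tau 0) by now apply off_lattice_but_0_0. f_equal. ring. }
  rewrite recip_neg, E0 by auto. ring.
Qed.

Lemma esum_opp tau z k : (0 < Im tau)%R -> off_lattice_but_0 tau z -> (3 <= k)%nat ->
  esum tau k (- z) = (-1) ^ k * esum tau k z.
Proof.
  intros Ht Hz Hk. apply has_sum_unique with (fun p => (-1) ^ k * recip tau z p ^ k);
    [|now apply has_sum_scal, has_sum_esum].
  pose proof (has_sum_neg _ _ (has_sum_esum tau (- z) k Ht (off_lattice_but_0_opp _ _ Hz) Hk)) as H.
  revert H. apply has_sum_ext. intros p.
  rewrite recip_neg by auto. rewrite <- Cpow_mult_l. f_equal. ring.
Qed.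

(** For a period w, averaging the terms of w and -w gives (1/(z-w)^2 + 1/(z+w)^2)/2 - 1/w^2 = z^2 (3
    - z^2/w^2) / (z^2-w^2)^2. The quotient by z^2 is written through [recip] so that it stays
    regular at z = 0; it decays like the fourth power of the inverse distance. *)
Definition wpreg_quot_term (tau z : C) (p : idx) : C :=
  (3 - z ^ 2 * recip tau 0 p ^ 2) * (recip tau z p ^ 2 * recip tau (- z) p ^ 2).

Definition wpreg_quot (tau z : C) : C := Csum (wpreg_quot_term tau z).

Lemma tame_recip_opp tau z : (0 < Im tau)%R -> off_lattice_but_0 tau z ->
  tame (fun p => / size p)%R (fun t p => recip tau (- t) p) (fun t p => recip tau (- t) p ^ 2) z.
Proof.
  intros Ht Hz.
  destruct (tame_recip tau (- z) Ht (off_lattice_but_0_opp _ _ Hz)) as [d [K [Hd [HK H]]]].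
  exists d, K. split; [easy|]. split; [easy|]. intros i u t Hs Ht'.
  assert (E : forall u, Cmod (- u - - z) = Cmod (u - z)).
  { intros v. rewrite <- Cmod_opp. f_equal. ring. }
  destruct (H i (- u) (- t)) as [B [B' D]]; try now rewrite E.
  rewrite Cmod_opp in B'. repeat split; auto.
  replace (recip tau (- t) i - recip tau (- u) i - (t - u) * recip tau (- u) i ^ 2)
    with (recip tau (- t) i - recip tau (- u) i - (- t - - u) * - recip tau (- u) i ^ 2) by ring.
  eapply Rle_trans; [apply D|]. right. f_equal. f_equal.
  rewrite <- Cmod_opp. f_equal. ring.
Qed.

Lemma tame_wpreg_quot_term tau : (0 < Im tau)%R -> exists F', forall z, off_lattice_but_0 tau z ->
  tame wt (fun t p => wpreg_quot_term tau t p) F' z.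
Proof.
  intros Ht. eexists. intros z Hz. unfold wpreg_quot_term.
  pose proof (tame_mult _ _ _ _ _ _ _ (tame_pow _ _ _ _ 1 (tame_id z))
                 (tame_pow _ _ _ _ 1 (tame_recip_0 tau z Ht))) as T.
  apply (tame_weight _ (fun _ => 1)%R) in T.
  2:{ intros p. pose proof (size_ge_1 p).
      assert (/ size p <= 1)%R by (rewrite <- Rinv_1; apply Rinv_le_contravar; lra).
      assert (0 < / size p)%R by (apply Rinv_0_lt_compat; lra). simpl. nra. }
  assert (T3 : tame (fun _ : idx => 1)%R (fun _ _ => RtoC 3) (fun _ _ => 0) z).
  { apply (tame_const (fun _ => 1)%R (fun _ => RtoC 3)); [|intros; lra].
    exists 3%R. split; [lra|]. intros _. rewrite Cmod_R, Rabs_pos_eq; lra. }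
  pose proof (tame_mult _ _ _ _ _ _ _ (tame_minus _ _ _ _ _ _ T3 T) (tame_mult _ _ _ _ _ _ _
    (tame_pow _ _ _ _ 1 (tame_recip tau z Ht Hz)) (tame_pow _ _ _ _ 1 (tame_recip_opp tau z Ht Hz)))) as T4.
  apply (tame_weight _ wt) in T4; [exact T4|].
  intros p. apply Rle_trans with ((/ size p) ^ 4)%R; [right; ring|].
  apply size_inv_pow; lia.
Qed.

Lemma ctame_wpreg_quot tau : (0 < Im tau)%R ->
  exists f', forall z, off_lattice_but_0 tau z -> ctame (wpreg_quot tau) f' z.
Proof.
  intros Ht. destruct (tame_wpreg_quot_term tau Ht) as [F' T].
  eexists. intros z Hz. apply (ctame_Csum _ _ _ (T z Hz)).
Qed.

Lemma wpreg_eq_quot tau z : (0 < Im tau)%R -> off_lattice_but_0 tau z ->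
  wpreg tau z = z ^ 2 * wpreg_quot tau z.
Proof.
  intros Ht Hz.
  destruct (tame_wpreg_quot_term tau Ht) as [F' T]. specialize (T z Hz).
  pose proof (has_sum_wpreg tau z Ht Hz) as H1.
  pose proof (has_sum_neg _ _ H1) as H2.
  pose proof (has_sum_scal (/ 2) _ _ (has_sum_plus _ _ _ _ H1 H2)) as H3.
  pose proof (has_sum_scal (z ^ 2) _ _ (summable_has_sum _ (proj1 (tame_summable _ _ _ T)))) as H4.
  replace (wpreg tau z) with (/ 2 * (wpreg tau z + wpreg tau z)).
  2:{ field. }
  apply has_sum_unique with (2 := H4). revert H3. apply has_sum_ext. intros p.
  assert (Ez : recip tau z (- fst p, - snd p)%Z = - recip tau (- z) p).
  { rewrite <- (recip_neg tau (- z)) by now apply off_lattice_but_0_opp.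
    f_equal. ring. }
  assert (E0 : recip tau 0 (- fst p, - snd p)%Z = - recip tau 0 p).
  { rewrite <- (recip_neg tau 0) by now apply off_lattice_but_0_0. f_equal. ring. }
  rewrite Ez, E0. unfold wpreg_quot_term, recip.
  destruct (is0 p) eqn:E; [ring|]. apply is0_false in E.
  pose proof (Hz p E) as N1. pose proof (off_lattice_but_0_opp _ _ Hz p E) as N2.
  pose proof (lat_neq_0 tau p Ht E) as N3. set (w := lat tau p) in *.
  assert (M1 : z - w <> 0).
  { intros D. apply N1. replace z with ((z - w) + w) by ring. rewrite D. ring. }
  assert (M2 : - z - w <> 0).
  { intros D. apply N2. replace (- z) with ((- z - w) + w) by ring. rewrite D. ring. }
  assert (M3 : 0 - w <> 0).
  { intros D. apply N3. replace w with (- (0 - w)) by ring. rewrite D. ring. }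
  field. auto.
Qed.

(** * The Weierstrass function and Eisenstein sums *)

(* The lattice is Z + Z tau, so wp(4 z | 2, 2 tau) = wpL tau z / 16. *)
Definition wpL (tau z : C) : C := (/ z) ^ 2 + wpreg tau z.

(** For [k >= 3] and off the lattice this is (-1)^k / (k-1)! times the derivative of wp of order
    k-2; in particular wp' is [-2] times the sum with exponent 3. *)
Definition Esum (tau : C) (k : nat) (z : C) : C := (/ z) ^ k + esum tau k z.

Lemma ctame_inv_pow (z : C) k : z <> 0 ->
  ctame (fun t => (/ t) ^ k) (fun t => - INR k * (/ t) ^ S k) z.
Proof.
  intros Hz. destruct k as [|k].
  - generalize (ctame_const 1 z). apply ctame_ext; intros t; simpl; ring.
  - generalize (ctame_pow _ _ _ k (ctame_inv z Hz)). apply ctame_ext; intros t; [easy|].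
    rewrite !Cpow_S. ring.
Qed.

Lemma ctame_wpL tau z : (0 < Im tau)%R -> off_lattice tau z ->
  ctame (wpL tau) (fun t => - (2) * Esum tau 3 t) z.
Proof.
  intros Ht Hz. pose proof (off_lattice_neq_0 _ _ Hz) as H0.
  generalize (ctame_plus _ _ _ _ _ (ctame_inv_pow z 2 H0)
    (ctame_wpreg tau z Ht (off_lattice_weaken _ _ Hz))).
  apply ctame_ext; intros t; [easy|]. unfold Esum. simpl INR.
  rewrite RtoC_plus. ring.
Qed.

Lemma ctame_Esum tau z k : (0 < Im tau)%R -> off_lattice tau z -> (3 <= k)%nat ->
  ctame (Esum tau k) (fun t => - INR k * Esum tau (S k) t) z.
Proof.
  intros Ht Hz Hk. pose proof (off_lattice_neq_0 _ _ Hz) as H0.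
  generalize (ctame_plus _ _ _ _ _ (ctame_inv_pow z k H0)
    (ctame_esum tau z k Ht (off_lattice_weaken _ _ Hz) Hk)).
  apply ctame_ext; intros t; [easy|]. unfold Esum. ring.
Qed.

Lemma wpL_even tau z : (0 < Im tau)%R -> off_lattice tau z -> wpL tau (- z) = wpL tau z.
Proof.
  intros Ht Hz. unfold wpL. rewrite wpreg_even by (auto; now apply off_lattice_weaken).
  pose proof (off_lattice_neq_0 _ _ Hz) as H0.
  f_equal. field. auto.
Qed.

Lemma Esum_opp tau z k : (0 < Im tau)%R -> off_lattice tau z -> (3 <= k)%nat ->
  Esum tau k (- z) = (-1) ^ k * Esum tau k z.
Proof.
  intros Ht Hz Hk. unfold Esum. rewrite esum_opp by (auto; now apply off_lattice_weaken).
  pose proof (off_lattice_neq_0 _ _ Hz) as H0.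
  replace (/ - z) with (-1 * / z).
  - rewrite Cpow_mult_l. ring.
  - field. auto.
Qed.

Lemma has_sum_at_0 F x c :
  has_sum F x -> F (0, 0)%Z = 0 -> has_sum (fun p => if is0 p then c else F p) (c + x).
Proof.
  intros H H0.
  generalize (has_sum_plus _ _ _ _ (has_sum_single (0, 0)%Z c) H).
  apply has_sum_ext. intros p. destruct (is0 p) eqn:E.
  - apply is0_true in E. subst. rewrite H0. destruct (idx_dec (0, 0)%Z (0, 0)%Z); [ring | easy].
  - apply is0_false in E. destruct (idx_dec p (0, 0)%Z); [easy | ring].
Qed.

Lemma has_sum_wpL tau z : (0 < Im tau)%R -> off_lattice tau z ->
  has_sum (fun p => if is0 p then (/ z) ^ 2 else (/ (z - lat tau p)) ^ 2 - (/ lat tau p) ^ 2)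
    (wpL tau z).
Proof.
  intros Ht Hz.
  pose proof (has_sum_wpreg tau z Ht (off_lattice_weaken _ _ Hz)) as H.
  apply (has_sum_at_0 _ _ ((/ z) ^ 2)) in H; [|unfold recip; simpl; ring].
  revert H. apply has_sum_ext. intros p. unfold recip. destruct (is0 p) eqn:E; auto.
  apply is0_false in E. f_equal.
  replace (0 - lat tau p) with (- lat tau p) by ring.
  pose proof (lat_neq_0 tau p Ht E). field. auto.
Qed.

Lemma has_sum_Esum tau z k : (0 < Im tau)%R -> off_lattice tau z -> (3 <= k)%nat ->
  has_sum (fun p => (/ (z - lat tau p)) ^ k) (Esum tau k z).
Proof.
  intros Ht Hz Hk.
  pose proof (has_sum_esum tau z k Ht (off_lattice_weaken _ _ Hz) Hk) as H.
  apply (has_sum_at_0 _ _ ((/ z) ^ k)) in H.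
  2:{ unfold recip; simpl. destruct k; [lia|]. rewrite Cpow_S. ring. }
  revert H. apply has_sum_ext. intros p. unfold recip. destruct (is0 p) eqn:E; auto.
  apply is0_true in E. subst. rewrite lat_0. f_equal. f_equal. ring.
Qed.

(** This gives the periodicity of wp, where reindexing fails: the inverse squares are summable only
    in differences. On a box the sum telescopes in the direction of the shift and leaves two sides,
    of O(N) terms of size O(1/N^2) each. *)
Lemma has_sum_telescope (a : Z -> Z -> C) K x :
  (forall p, Cmod (a (fst p) (snd p)) <= K * (/ size p) ^ 2)%R ->
  has_sum (fun p => a (fst p - 1)%Z (snd p) - a (fst p) (snd p)) x -> x = 0.
Proof.
  intros Ha H.
  (* The inner sum over a box runs over the second coordinate; after the swap it is the one that
     telescopes. *)
  apply (has_sum_reindex _ _ (fun p => (snd p, fst p)) (fun p => (snd p, fst p))) in H;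
    [|now intros []|now intros []].
  cbn [fst snd] in H.
  assert (HK : (0 <= K)%R).
  { specialize (Ha (0, 0)%Z). pose proof (Cmod_ge_0 (a 0%Z 0%Z)). cbn [fst snd] in Ha.
    assert (0 < (/ size (0, 0)%Z) ^ 2)%R.
    { apply pow_lt, Rinv_0_lt_compat. pose proof (size_ge_1 (0, 0)%Z). lra. }
    nra. }
  assert (Hx : (Cmod x <= 0)%R).
  { apply le_epsilon. intros eps He.
    destruct (has_sum_box _ _ H (eps / 2)%R) as [N0 HN]; [lra|].
    (* The two sides of the box contribute at most [4 * K / (1 + N)], which is at most [eps / 2]
       from this bound on. *)
    destruct (archimed (8 * K / eps)) as [Hup _].
    set (N := Nat.max N0 (Z.to_nat (up (8 * K / eps)))).
    specialize (HN N (Nat.le_max_l _ _)).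
    assert (HNr : (8 * K / eps <= INR N)%R).
    { apply Rle_trans with (IZR (up (8 * K / eps))); [lra|].
      rewrite INR_IZR_INZ. apply IZR_le. lia. }
    assert (B : (Cmod (csum (fun p : idx => a (snd p - 1)%Z (fst p) - a (snd p) (fst p))%C (box N))
                 <= eps / 2)%R).
    { unfold box, idx. rewrite csum_list_prod. cbn [fst snd].
      rewrite (csum_ext _ (fun i => a (- Z.of_nat N - 1)%Z i - a (Z.of_nat N) i)).
      2:{ intros i _. apply (telescope_zrange (fun m => a m i)). }
      set (q := (1 + INR N)%R).
      assert (Hq : (1 <= q)%R) by (unfold q; pose proof (pos_INR N); lra).
      assert (E : forall m i, (INR N <= zabs m)%R -> (Cmod (a m i) <= K * (/ q) ^ 2)%R).
      { intros m i Hm. eapply Rle_trans; [apply (Ha (m, i))|].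
        apply Rmult_le_compat_l; auto. apply pow_incr. split.
        - apply Rlt_le, Rinv_0_lt_compat. pose proof (size_ge_1 (m, i)). lra.
        - apply Rinv_le_contravar; [lra|]. unfold size, q. cbn [fst snd].
          pose proof (zabs_ge_0 i). lra. }
      eapply Rle_trans.
      - apply (Cmod_csum_le _ (fun _ => 2 * (K * (/ q) ^ 2))%R). intros i _.
        eapply Rle_trans; [apply Cmod_triangle_minus|].
        assert (H1 : (INR N <= zabs (- Z.of_nat N - 1))%R).
        { rewrite INR_IZR_INZ. apply IZR_le. lia. }
        assert (H2 : (INR N <= zabs (Z.of_nat N))%R).
        { rewrite INR_IZR_INZ. apply IZR_le. lia. }
        pose proof (E _ i H1). pose proof (E _ i H2). lra.
      - rewrite rsum_const. unfold zrange. rewrite length_map, length_seq.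
        rewrite plus_INR, mult_INR. change (INR 1) with 1%R. change (INR 2) with 2%R.
        assert (HNq : (INR N = q - 1)%R) by (unfold q; ring). rewrite HNq in *.
        apply Rle_trans with (4 * K * / q)%R.
        + replace ((2 * (q - 1) + 1) * (2 * (K * (/ q) ^ 2)))%R
            with (4 * K * / q * ((2 * q - 1) / (2 * q)))%R by (field; lra).
          rewrite <- (Rmult_1_r (4 * K * / q)) at 2.
          apply Rmult_le_compat_l.
          * repeat apply Rmult_le_pos; try lra. apply Rlt_le, Rinv_0_lt_compat. lra.
          * apply Rmult_le_reg_r with (2 * q)%R; [lra|]. field_simplify; lra.
        + apply Rmult_le_reg_r with (2 * q / eps)%R.
          { apply Rdiv_lt_0_compat; lra. }
          replace (4 * K * / q * (2 * q / eps))%R with (8 * K / eps)%R by (field; lra).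
          replace (eps / 2 * (2 * q / eps))%R with q by (field; lra). lra. }
    match type of HN with (Cmod (?u - _) < _)%R => set (S0 := u) in * end.
    replace x with (S0 - (S0 - x)) by ring.
    eapply Rle_trans; [apply Cmod_triangle_minus|]. lra. }
  apply Cmod_eq_0. pose proof (Cmod_ge_0 x). lra.
Qed.

Lemma inv_square_bound tau z : (0 < Im tau)%R -> off_lattice tau z ->
  exists K, forall p, (Cmod ((/ (z - lat tau p)) ^ 2) <= K * (/ size p) ^ 2)%R.
Proof.
  intros Ht Hz. destruct (lattice_gap tau z Ht) as [d [Hd H]].
  exists ((/ d) ^ 2)%R. intros p. specialize (H p (Hz p)).
  pose proof (size_ge_1 p).
  assert (P : (0 < d * size p)%R) by (apply Rmult_lt_0_compat; lra).
  rewrite Cmod_pow, Cmod_inv by (apply Cmod_gt_0; lra).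
  rewrite <- Rpow_mult_distr. apply pow_incr. split.
  - apply Rlt_le, Rinv_0_lt_compat. lra.
  - rewrite <- Rinv_mult. apply Rinv_le_contravar; lra.
Qed.

Lemma lat_sub tau p q : lat tau (fst p - fst q, snd p - snd q)%Z = lat tau p - lat tau q.
Proof. unfold lat. cbn [fst snd]. rewrite !ZtoC_minus. ring. Qed.

Lemma off_lattice_shift tau z q : off_lattice tau z -> off_lattice tau (z + lat tau q).
Proof.
  intros H p E. apply (H (fst p - fst q, snd p - snd q)%Z).
  rewrite lat_sub, <- E. ring.
Qed.

Lemma Esum_periodic tau z k q : (0 < Im tau)%R -> off_lattice tau z -> (3 <= k)%nat ->
  Esum tau k (z + lat tau q) = Esum tau k z.
Proof.
  intros Ht Hz Hk.
  pose proof (has_sum_Esum tau z k Ht Hz Hk) as H1.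
  apply (has_sum_reindex _ _ (fun p => (fst p - fst q, snd p - snd q)%Z)
    (fun p => (fst p + fst q, snd p + snd q)%Z)) in H1.
  2,3: intros []; simpl; f_equal; ring.
  refine (has_sum_unique _ _ _ (has_sum_Esum tau _ k Ht (off_lattice_shift tau z q Hz) Hk) _).
  revert H1. apply has_sum_ext. intros p. rewrite lat_sub. do 2 f_equal. ring.
Qed.

Lemma lat_10 tau : lat tau (1, 0)%Z = 1.
Proof. unfold lat, ZtoC. cbn [fst snd]. ring. Qed.

Lemma lat_01 tau : lat tau (0, 1)%Z = tau.
Proof. unfold lat, ZtoC. cbn [fst snd]. ring. Qed.

Lemma has_sum_wpL_diff tau z w : (0 < Im tau)%R -> off_lattice tau z -> off_lattice tau w ->
  has_sum (fun p => (/ (z - lat tau p)) ^ 2 - (/ (w - lat tau p)) ^ 2) (wpL tau z - wpL tau w).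
Proof.
  intros Ht Hz Hw.
  generalize (has_sum_minus _ _ _ _ (has_sum_wpL tau z Ht Hz) (has_sum_wpL tau w Ht Hw)).
  apply has_sum_ext. intros p. destruct (is0 p) eqn:E; [|ring].
  apply is0_true in E. subst. rewrite lat_0. do 3 f_equal; ring.
Qed.

Lemma wpL_plus_1 tau z : (0 < Im tau)%R -> off_lattice tau z -> wpL tau (z + 1) = wpL tau z.
Proof.
  intros Ht Hz.
  pose proof (off_lattice_shift tau z (1, 0)%Z Hz) as Hz1. rewrite lat_10 in Hz1.
  destruct (inv_square_bound tau z Ht Hz) as [K HK].
  assert (E : wpL tau (z + 1) - wpL tau z = 0).
  { apply (has_sum_telescope (fun m n => (/ (z - lat tau (m, n))) ^ 2) K); [now intros []|].
    generalize (has_sum_wpL_diff tau (z + 1) z Ht Hz1 Hz).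
    apply has_sum_ext. intros [m n]. cbn [fst snd]. do 3 f_equal.
    unfold lat. cbn [fst snd]. rewrite ZtoC_minus. change (ZtoC 1) with (RtoC 1). ring. }
  replace (wpL tau (z + 1)) with ((wpL tau (z + 1) - wpL tau z) + wpL tau z) by ring.
  rewrite E. ring.
Qed.

Lemma wpL_plus_tau tau z : (0 < Im tau)%R -> off_lattice tau z -> wpL tau (z + tau) = wpL tau z.
Proof.
  intros Ht Hz.
  pose proof (off_lattice_shift tau z (0, 1)%Z Hz) as Hz1. rewrite lat_01 in Hz1.
  destruct (inv_square_bound tau z Ht Hz) as [K HK].
  assert (E : wpL tau (z + tau) - wpL tau z = 0).
  { apply (has_sum_telescope (fun m n => (/ (z - lat tau (n, m))) ^ 2) K).
    - intros [m n]. specialize (HK (n, m)). cbn [fst snd].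
      replace (size (m, n)) with (size (n, m)) by (unfold size; simpl; ring). apply HK.
    - generalize (has_sum_reindex _ _ (fun p => (snd p, fst p)) (fun p => (snd p, fst p))
        ltac:(now intros []) ltac:(now intros []) (has_sum_wpL_diff tau (z + tau) z Ht Hz1 Hz)).
      apply has_sum_ext. intros [m n]. cbn [fst snd]. do 3 f_equal.
      unfold lat. cbn [fst snd]. rewrite ZtoC_minus. change (ZtoC 1) with (RtoC 1). ring. }
  replace (wpL tau (z + tau)) with ((wpL tau (z + tau) - wpL tau z) + wpL tau z) by ring.
  rewrite E. ring.
Qed.

Lemma periodic_Z (D : C -> Prop) (f : C -> C) (w : C) :
  (forall z (k : Z), D z -> D (z + ZtoC k * w)) ->
  (forall z, D z -> f (z + w) = f z) ->
  forall (k : Z) z, D z -> f (z + ZtoC k * w) = f z.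
Proof.
  intros HD Hf.
  assert (Hn : forall (n : nat) z, D z -> f (z + ZtoC (Z.of_nat n) * w) = f z).
  { induction n as [|n IH]; intros z Hz.
    - f_equal. change (ZtoC (Z.of_nat 0)) with (RtoC 0). ring.
    - rewrite Nat2Z.inj_succ, <- Z.add_1_r, ZtoC_plus. change (ZtoC 1) with (RtoC 1).
      replace (z + (ZtoC (Z.of_nat n) + 1) * w) with (z + ZtoC (Z.of_nat n) * w + w) by ring.
      rewrite Hf; auto. }
  intros k z Hz. destruct (Z_le_gt_dec 0 k) as [L|L].
  - rewrite <- (Z2Nat.id k) by auto. auto.
  - rewrite <- (Hn (Z.to_nat (- k)) (z + ZtoC k * w)) by auto.
    f_equal. rewrite Z2Nat.id by lia. rewrite ZtoC_opp. ring.
Qed.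

Lemma wpL_periodic tau z q : (0 < Im tau)%R -> off_lattice tau z ->
  wpL tau (z + lat tau q) = wpL tau z.
Proof.
  intros Ht Hz. destruct q as [m n]. unfold lat. cbn [fst snd].
  replace (z + (ZtoC m + ZtoC n * tau)) with (z + ZtoC m * 1 + ZtoC n * tau) by ring.
  assert (S1 : forall z (k : Z), off_lattice tau z -> off_lattice tau (z + ZtoC k * 1)).
  { intros u k Hu. generalize (off_lattice_shift tau u (k, 0)%Z Hu). unfold lat.
    cbn [fst snd]. change (ZtoC 0) with (RtoC 0).
    now replace (u + (ZtoC k + 0 * tau)) with (u + ZtoC k * 1) by ring. }
  assert (S2 : forall z (k : Z), off_lattice tau z -> off_lattice tau (z + ZtoC k * tau)).
  { intros u k Hu. generalize (off_lattice_shift tau u (0, k)%Z Hu). unfold lat.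
    cbn [fst snd]. change (ZtoC 0) with (RtoC 0).
    now replace (u + (0 + ZtoC k * tau)) with (u + ZtoC k * tau) by ring. }
  rewrite (periodic_Z (off_lattice tau) (wpL tau) tau); auto.
  - apply (periodic_Z (off_lattice tau) (wpL tau) 1); auto.
    intros u Hu. now apply wpL_plus_1.
  - intros u Hu. now apply wpL_plus_tau.
Qed.

(** * Modular transformation *)

Lemma automorphy_neq_0 a b c d tau : SL2Z a b c d -> (0 < Im tau)%R -> automorphy c d tau <> 0.
Proof.
  intros HS Ht E. unfold automorphy in E.
  apply (lat_neq_0 tau (d, c)); auto.
  - intros E2. injection E2 as -> ->. unfold SL2Z in HS. lia.
  - unfold lat. cbn [fst snd]. rewrite <- E. ring.
Qed.

Lemma Im_mobius a b c d tau : SL2Z a b c d -> (0 < Im tau)%R ->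
  Im (mobius a b c d tau) = (Im tau / Cmod (automorphy c d tau) ^ 2)%R.
Proof.
  intros HS Ht. pose proof (automorphy_neq_0 a b c d tau HS Ht) as N.
  unfold SL2Z in HS. apply (f_equal IZR) in HS.
  rewrite minus_IZR, !mult_IZR in HS.
  apply (proj1 (Cmod_gt_0 _)) in N.
  assert (P : (0 < Cmod (automorphy c d tau) ^ 2)%R) by now apply pow_lt.
  rewrite Cmod2_alt in *. unfold mobius, automorphy, ZtoC, Re, Im in *. simpl in *.
  destruct tau as [x y]; simpl in *.
  set (u := ((IZR c * x - 0 * y + IZR d) * ((IZR c * x - 0 * y + IZR d) * 1) +
     (IZR c * y + 0 * x + 0) * ((IZR c * y + 0 * x + 0) * 1))%R) in *.
  match goal with |- ?L = _ => replace L with ((IZR a * IZR d - IZR b * IZR c) * y / u)%R end.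
  - rewrite HS. field. lra.
  - unfold u. field.
    match goal with |- ?X <> 0%R => replace X with u by (unfold u; ring) end. lra.
Qed.

Lemma Im_mobius_pos a b c d tau : SL2Z a b c d -> (0 < Im tau)%R ->
  (0 < Im (mobius a b c d tau))%R.
Proof.
  intros HS Ht. rewrite (Im_mobius a b c d tau HS Ht).
  apply Rdiv_lt_0_compat; auto. apply pow_lt. apply Cmod_gt_0.
  now apply (automorphy_neq_0 a b).
Qed.

(** The coordinates of m (c tau + d) + n (a tau + b) in the basis 1, tau. *)
Definition sl2_act (a b c d : Z) (p : idx) : idx :=
  (fst p * d + snd p * b, fst p * c + snd p * a)%Z.

Lemma lat_mobius a b c d tau p : SL2Z a b c d -> (0 < Im tau)%R ->
  lat (mobius a b c d tau) p =
  lat tau (sl2_act a b c d p) / automorphy c d tau.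
Proof.
  intros HS Ht. pose proof (automorphy_neq_0 a b c d tau HS Ht) as N.
  unfold lat, mobius, sl2_act. cbn [fst snd]. rewrite !ZtoC_plus, !ZtoC_mult.
  unfold automorphy in *. field. auto.
Qed.

Lemma sl2_act_inv a b c d p : SL2Z a b c d ->
  sl2_act d (- b) (- c) a (sl2_act a b c d p) = p.
Proof.
  intros HS. unfold SL2Z in HS. destruct p as [m n]. unfold sl2_act. cbn [fst snd]. f_equal.
  - transitivity (m * (a * d - b * c))%Z; [ring|]. rewrite HS. ring.
  - transitivity (n * (a * d - b * c))%Z; [ring|]. rewrite HS. ring.
Qed.

Lemma SL2Z_inv a b c d : SL2Z a b c d -> SL2Z d (- b) (- c) a.
Proof. unfold SL2Z. intros H. rewrite <- H. ring. Qed.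

Lemma sl2_act_inv_r a b c d p : SL2Z a b c d ->
  sl2_act a b c d (sl2_act d (- b) (- c) a p) = p.
Proof.
  intros HS. pose proof (sl2_act_inv _ _ _ _ p (SL2Z_inv _ _ _ _ HS)) as H.
  now rewrite !Z.opp_involutive in H.
Qed.

Lemma off_lattice_mobius a b c d tau z : SL2Z a b c d -> (0 < Im tau)%R ->
  off_lattice tau z -> off_lattice (mobius a b c d tau) (z / automorphy c d tau).
Proof.
  intros HS Ht Hz p E. rewrite lat_mobius in E by auto.
  pose proof (automorphy_neq_0 a b c d tau HS Ht) as N.
  set (j := automorphy c d tau) in *.
  apply (Hz (sl2_act a b c d p)).
  set (w := lat tau _) in *.
  transitivity (z / j * j); [field; auto|]. rewrite E. field. auto.
Qed.

(** The lattice of the transformed modulus is the old one divided by [automorphy c d tau], and wp is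
    homogeneous of degree -2. The origin is the only index sent to the origin, so the correction
    terms match as well. *)
Lemma wpL_mobius a b c d tau z : SL2Z a b c d -> (0 < Im tau)%R -> off_lattice tau z ->
  wpL (mobius a b c d tau) (z / automorphy c d tau) = automorphy c d tau ^ 2 * wpL tau z.
Proof.
  intros HS Ht Hz.
  pose proof (automorphy_neq_0 a b c d tau HS Ht) as N.
  pose proof (off_lattice_neq_0 _ _ Hz) as N0.
  refine (has_sum_unique _ _ _ (has_sum_wpL _ _ (Im_mobius_pos a b c d tau HS Ht)
    (off_lattice_mobius a b c d tau z HS Ht Hz)) _).
  generalize (has_sum_scal (automorphy c d tau ^ 2) _ _
    (has_sum_reindex _ _ (sl2_act a b c d) (sl2_act d (- b) (- c) a)
      (fun p => sl2_act_inv _ _ _ _ p HS) (fun p => sl2_act_inv_r _ _ _ _ p HS)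
      (has_sum_wpL tau z Ht Hz))).
  apply has_sum_ext. intros p. cbn beta.
  set (q := sl2_act a b c d p).
  assert (E0 : is0 q = is0 p).
  { destruct (is0 p) eqn:E.
    - apply is0_true in E. unfold q. now rewrite E.
    - destruct (is0 q) eqn:E'; auto. apply is0_true in E'. apply is0_false in E.
      exfalso. apply E. rewrite <- (sl2_act_inv a b c d p HS). fold q. now rewrite E'. }
  rewrite E0. rewrite lat_mobius by auto. fold q.
  set (j := automorphy c d tau) in *.
  destruct (is0 p) eqn:E.
  - field. auto.
  - assert (Nq : lat tau q <> 0) by (apply lat_neq_0; auto; apply is0_false; now rewrite E0).
    assert (Nz : z - lat tau q <> 0).
    { intros D. apply (Hz q). replace z with ((z - lat tau q) + lat tau q) by ring.
      rewrite D. ring. }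
    field. auto.
Qed.

(** * Liouville's theorem for doubly periodic functions *)

Lemma is_derive_of_quadratic (phi : R -> R) (t l d K : R) : (0 < d)%R -> (0 <= K)%R ->
  (forall u, Rabs (u - t) < d -> Rabs (phi u - phi t - (u - t) * l) <= K * (u - t) ^ 2)%R ->
  is_derive phi t l.
Proof.
  intros Hd HK H. apply is_derive_Reals. intros eps He.
  assert (Hr : (0 < Rmin d (eps / (K + 1)))%R)
    by (apply Rmin_pos; auto; apply Rdiv_lt_0_compat; lra).
  exists (mkposreal _ Hr). intros k Hk0 Hk. simpl in Hk.
  pose proof (Rmin_l d (eps / (K + 1))). pose proof (Rmin_r d (eps / (K + 1))).
  specialize (H (t + k)%R). replace (t + k - t)%R with k in H by ring.
  specialize (H ltac:(lra)).
  replace ((phi (t + k) - phi t) / k - l)%R with ((phi (t + k) - phi t - k * l) / k)%R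
    by (field; auto).
  unfold Rdiv. rewrite Rabs_mult, Rabs_inv.
  assert (Pk : (0 < Rabs k)%R) by now apply Rabs_pos_lt.
  apply Rle_lt_trans with (K * Rabs k)%R.
  - apply Rmult_le_reg_r with (Rabs k); auto. rewrite Rmult_assoc, Rinv_l by lra.
    rewrite Rmult_1_r. eapply Rle_trans; [apply H|]. rewrite <- (pow2_abs k). right. ring.
  - apply Rle_lt_trans with (K * (eps / (K + 1)))%R; [apply Rmult_le_compat_l; lra|].
    apply Rmult_lt_reg_r with (K + 1)%R; [lra|].
    replace (K * (eps / (K + 1)) * (K + 1))%R with (K * eps)%R by (field; lra). lra.
Qed.

Lemma ctame_path f f' (z : R -> C) (b : C) (t : R) :
  (forall u, z u - z t = RtoC (u - t) * b) -> ctame f f' (z t) ->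
  is_derive (fun u => Re (f (z u))) t (Re (b * f' (z t))) /\
  is_derive (fun u => Im (f (z u))) t (Im (b * f' (z t))).
Proof.
  intros Hz [d [K [Hd [HK H]]]].
  pose proof (Cmod_ge_0 b) as Hb.
  assert (Hr : (0 < d / (Cmod b + 1))%R) by (apply Rdiv_lt_0_compat; lra).
  assert (Q : forall u, (Rabs (u - t) < d / (Cmod b + 1))%R ->
    (Cmod (f (z u) - f (z t) - RtoC (u - t) * (b * f' (z t)))
      <= K * Cmod b ^ 2 * (u - t) ^ 2)%R).
  { intros u Hu. destruct (H tt (z t) (z u)) as [_ [_ D]].
    - replace (z t - z t) with (RtoC 0) by ring. now rewrite Cmod_0.
    - rewrite Hz, Cmod_mult, Cmod_R.
      apply Rle_lt_trans with (d / (Cmod b + 1) * Cmod b)%R.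
      + apply Rmult_le_compat_r; lra.
      + apply Rmult_lt_reg_r with (Cmod b + 1)%R; [lra|].
        replace (d / (Cmod b + 1) * Cmod b * (Cmod b + 1))%R with (d * Cmod b)%R
          by (field; lra). nra.
    - rewrite Hz, Cmod_mult, Cmod_R, Rpow_mult_distr, pow2_abs, Rmult_1_r in D.
      rewrite Cmult_assoc. eapply Rle_trans; [apply D|]. right. ring. }
  assert (HK2 : (0 <= K * Cmod b ^ 2)%R) by (apply Rmult_le_pos; auto; apply pow2_ge_0).
  split; apply (is_derive_of_quadratic _ _ _ _ _ Hr HK2); intros u Hu;
    (eapply Rle_trans; [|apply (Q u Hu)]).
  - eapply Rle_trans; [|apply re_le_Cmod]. right. f_equal. unfold Re; simpl. ring.
  - eapply Rle_trans; [|apply im_le_Cmod]. right. f_equal. unfold Im; simpl. ring.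
Qed.

Lemma ctame_deriv_lipschitz f f' z : ctame f f' z -> lipschitz_near f' z.
Proof.
  intros [d [K [Hd [HK H]]]]. exists d, (2 * K)%R. split; [easy|]. split; [lra|].
  intros s t Hs Ht.
  destruct (H tt s t Hs Ht) as [_ [_ D1]]. destruct (H tt t s Ht Hs) as [_ [_ D2]].
  rewrite (Cmod_minus_sym s t) in D2.
  set (r := Cmod (t - s)) in *.
  assert (E : (Cmod ((t - s) * (f' t - f' s)) <= 2 * K * r ^ 2)%R).
  { replace ((t - s) * (f' t - f' s)) with
      ((f t - f s - (t - s) * f' s) + (f s - f t - (s - t) * f' t)) by ring.
    eapply Rle_trans; [apply Cmod_triangle|]. lra. }
  rewrite Cmod_mult in E. fold r in E.
  destruct (Req_dec r 0) as [E0|E0].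
  - assert (t - s = 0) by now apply Cmod_eq_0.
    replace t with s; [|replace t with ((t - s) + s) by ring; rewrite H0; ring].
    replace (f' s - f' s) with (RtoC 0) by ring. rewrite Cmod_0, E0. lra.
  - assert (0 <= r)%R by apply Cmod_ge_0.
    apply Rmult_le_reg_l with r; [lra|]. eapply Rle_trans; [apply E|]. right. ring.
Qed.

(** The height [y] comes first so that partial application gives the function of [x] that is
    integrated along a row. *)
Definition pt (tau : C) (y x : R) : C := RtoC x + RtoC y * tau.

Lemma lipschitz_continuity_2d f tau y x : lipschitz_near f (pt tau y x) ->
  continuity_2d_pt (fun u v => Re (f (pt tau u v))) y x /\
  continuity_2d_pt (fun u v => Im (f (pt tau u v))) y x.
Proof.
  intros [d [K [Hd [HK H]]]].
  set (T := (1 + Cmod tau)%R).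
  assert (HT : (1 <= T)%R) by (pose proof (Cmod_ge_0 tau); unfold T; lra).
  assert (Q : forall eps : posreal, exists delta : posreal, forall u v,
    (Rabs (u - y) < delta -> Rabs (v - x) < delta ->
     Cmod (f (pt tau u v) - f (pt tau y x)) < eps)%R).
  { intros eps. pose proof (cond_pos eps) as He.
    assert (Hr : (0 < Rmin (d / T) (eps / ((K + 1) * T)))%R).
    { apply Rmin_pos; apply Rdiv_lt_0_compat; try lra. apply Rmult_lt_0_compat; lra. }
    exists (mkposreal _ Hr). simpl. intros u v Hu Hv.
    set (r := Rmin (d / T) (eps / ((K + 1) * T))) in *.
    assert (R1 : (r * T <= d)%R).
    { apply Rle_trans with (d / T * T)%R; [|right; field; lra].
      apply Rmult_le_compat_r; [lra | apply Rmin_l]. }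
    assert (R2 : ((K + 1) * (r * T) <= eps)%R).
    { apply Rle_trans with ((K + 1) * (eps / ((K + 1) * T) * T))%R; [|right; field; lra].
      apply Rmult_le_compat_l; [lra|]. apply Rmult_le_compat_r; [lra | apply Rmin_r]. }
    assert (D : (Cmod (pt tau u v - pt tau y x) < r * T)%R).
    { replace (pt tau u v - pt tau y x) with (RtoC (v - x) + RtoC (u - y) * tau)
        by (unfold pt; rewrite !RtoC_minus; ring).
      eapply Rle_lt_trans; [apply Cmod_triangle|]. rewrite Cmod_mult, !Cmod_R.
      pose proof (Cmod_ge_0 tau).
      assert (Rabs (u - y) * Cmod tau <= r * Cmod tau)%R by (apply Rmult_le_compat_r; lra).
      unfold T. lra. }
    eapply Rle_lt_trans.
    - apply H; [|lra]. replace (pt tau y x - pt tau y x) with (RtoC 0) by ring.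
      now rewrite Cmod_0.
    - set (q := Cmod (pt tau u v - pt tau y x)) in *.
      assert (0 <= q)%R by apply Cmod_ge_0. nra. }
  split; intros eps; destruct (Q eps) as [delta Hq]; exists delta; intros u v Hu Hv;
    (eapply Rle_lt_trans; [|apply (Hq u v Hu Hv)]).
  - apply (re_le_Cmod (f (pt tau u v) - f (pt tau y x))).
  - apply (im_le_Cmod (f (pt tau u v) - f (pt tau y x))).
Qed.

Lemma continuity_2d_continuous f y x :
  continuity_2d_pt f y x -> continuous (fun v => f y v) x.
Proof.
  intros H. apply filterlim_locally. intros eps. destruct (H eps) as [d Hd].
  exists d. intros v Hv. apply Hd; [|apply Hv].
  replace (y - y)%R with 0%R by ring. rewrite Rabs_R0. apply cond_pos.
Qed.

Lemma RInt_eq_0_pos (phi : R -> R) (a b : R) : (a < b)%R ->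
  (forall x, a <= x <= b -> continuous phi x)%R -> (forall x, 0 <= phi x)%R ->
  RInt phi a b = 0%R -> forall x, (a <= x <= b)%R -> phi x = 0%R.
Proof.
  intros Hab Hc Hpos H0 x Hx.
  destruct (Req_dec (phi x) 0) as [E|E]; auto. exfalso.
  assert (P : (0 < phi x)%R) by (specialize (Hpos x); lra).
  destruct (proj1 (filterlim_locally _ _) (Hc x Hx) (mkposreal _ P)) as [d Hd].
  assert (Hd' : forall u, (Rabs (u - x) < d -> 0 < phi u)%R).
  { intros u Hu. specialize (Hd u Hu). unfold ball in Hd. simpl in Hd.
    unfold AbsRing_ball, abs, minus, plus, opp in Hd. simpl in Hd.
    apply Rabs_def2 in Hd. lra. }
  pose proof (cond_pos d) as Pd.
  set (l := Rmax a (x - d / 2)). set (r := Rmin b (x + d / 2)).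
  assert (L1 : (a <= l)%R) by apply Rmax_l. assert (L2 : (x - d / 2 <= l)%R) by apply Rmax_r.
  assert (L3 : (l <= x)%R) by (apply Rmax_lub; lra).
  assert (R1 : (r <= b)%R) by apply Rmin_l. assert (R2 : (r <= x + d / 2)%R) by apply Rmin_r.
  assert (R3 : (x <= r)%R) by (apply Rmin_glb; lra).
  assert (LR : (l < r)%R).
  { unfold l, r. apply Rmax_lub_lt; apply Rmin_glb_lt; lra. }
  assert (EX : forall u v, (a <= u <= b)%R -> (a <= v <= b)%R -> ex_RInt phi u v).
  { intros u v Hu Hv. apply (ex_RInt_continuous (V := R_CompleteNormedModule)). intros w Hw. apply Hc.
    revert Hw. unfold Rmin, Rmax. destruct (Rle_dec u v); lra. }
  assert (I1 : (0 <= RInt phi a l)%R) by (apply RInt_ge_0; auto; apply EX; lra).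
  assert (I3 : (0 <= RInt phi r b)%R) by (apply RInt_ge_0; auto; apply EX; lra).
  assert (I2 : (0 < RInt phi l r)%R).
  { apply RInt_gt_0; auto.
    - intros u Hu. apply Hd'. apply Rabs_def1; lra.
    - intros u Hu. apply Hc. lra. }
  rewrite <- (RInt_Chasles phi a l b), <- (RInt_Chasles phi l r b) in H0 by (apply EX; lra).
  unfold plus in H0; simpl in H0. lra.
Qed.

(** Two functions are allowed so that one reflection gives both the vanishing on the row at height
    0, with [phi = psi], and the relation between the rows at heights y and 1 - y. *)
Lemma RInt_odd_reflect (phi psi : R -> R) (a : R) :
  (forall x, - a < x < a -> phi x = - psi (- x))%R -> (0 < a)%R ->
  (forall x, - a <= x <= a -> continuous psi x)%R ->
  RInt phi (- a) a = (- RInt psi (- a) a)%R.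
Proof.
  intros H Ha Hc.
  assert (EX : ex_RInt psi (- a) a).
  { apply (ex_RInt_continuous (V := R_CompleteNormedModule)). intros x.
    rewrite Rmin_left, Rmax_right by lra. apply Hc. }
  apply is_RInt_unique.
  apply (is_RInt_ext (fun x => opp (psi (- x)%R))).
  - intros x. rewrite Rmin_left, Rmax_right by lra. intros Hx. symmetry. now apply H.
  - apply (is_RInt_comp_opp psi (- a) a). rewrite Ropp_involutive.
    apply (is_RInt_swap (V := R_NormedModule) psi), (RInt_correct (V := R_CompleteNormedModule)), EX.
Qed.

Lemma off_lattice_pt tau y x : (0 < Im tau)%R -> (0 < y < 1)%R -> off_lattice tau (pt tau y x).
Proof.
  intros Ht Hy p E. apply (f_equal Im) in E.
  assert (E2 : (y * Im tau = IZR (snd p) * Im tau)%R).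
  { revert E. unfold pt, lat, ZtoC, Im. simpl. lra. }
  apply Rmult_eq_reg_r in E2; [|lra]. subst y.
  destruct Hy as [H1 H2]. apply lt_IZR in H1. apply (lt_IZR _ 1) in H2. lia.
Qed.

Lemma off_lattice_but_0_pt tau y x : (0 < Im tau)%R -> (-1 < y < 1)%R -> (-1 < x < 1)%R ->
  off_lattice_but_0 tau (pt tau y x).
Proof.
  intros Ht Hy Hx p Hp E.
  pose proof (f_equal Im E) as E1. pose proof (f_equal Re E) as E2.
  assert (E3 : (y * Im tau = IZR (snd p) * Im tau)%R).
  { revert E1. unfold pt, lat, ZtoC, Im. simpl. lra. }
  apply Rmult_eq_reg_r in E3; [|lra]. subst y.
  assert (E4 : x = IZR (fst p)).
  { revert E2. unfold pt, lat, ZtoC, Re. simpl. lra. }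
  subst x. destruct Hy as [H1 H2]. destruct Hx as [H3 H4].
  apply (lt_IZR (-1)) in H1, H3. apply (lt_IZR _ 1) in H2, H4.
  apply Hp. destruct p; simpl in *. f_equal; lia.
Qed.

(* Energy argument.  With J(y) the integral of Im (f' conj f) over the period [x + y tau],
   -1/2 <= x <= 1/2, one has J' = -2 Im(tau) * (integral of |f'|^2) <= 0 for 0 < y < 1, while parity
   and periodicity give J(1 - y) = - J(y); since f extends regularly (as E) to the origin,
   J(0+) = 0.  Hence J = 0 and f' = 0. *)
Section Energy.
Context (tau : C) (f f1 f2 E E1 : C -> C).
Context (Htau : (0 < Im tau)%R)
  (Cf : forall z, off_lattice tau z -> ctame f f1 z)
  (Cf1 : forall z, off_lattice tau z -> ctame f1 f2 z)
  (Cf2 : forall z, off_lattice tau z -> lipschitz_near f2 z)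
  (CE : forall z, off_lattice_but_0 tau z -> ctame E E1 z)
  (fE : forall z, off_lattice tau z -> f z = E z)
  (f_even : forall z, off_lattice tau z -> f (- z) = f z)
  (f_1 : forall z, off_lattice tau z -> f (z + 1) = f z)
  (f_tau : forall z, off_lattice tau z -> f (z + tau) = f z).

(** The imaginary part of [u] times the conjugate of [v]. *)
Let im_conj (u v : C) : R := (Im u * Re v - Re u * Im v)%R.

Lemma deriv_eq_ext z : off_lattice tau z -> f1 z = E1 z.
Proof.
  intros Hz. destruct (off_lattice_open tau z Htau Hz) as [d [Hd Ho]].
  apply (ctame_unique f f1 E E1 z d Hd); auto.
  apply CE. now apply off_lattice_weaken.
Qed.

Lemma deriv_odd z : off_lattice tau z -> f1 (- z) = - f1 z.
Proof.
  intros Hz. destruct (off_lattice_open tau z Htau Hz) as [d [Hd Ho]].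
  assert (H : - f1 (- z) = f1 z).
  { apply (ctame_unique (fun t => f (- t)) (fun t => - f1 (- t)) f f1 z d Hd); auto.
    apply ctame_opp_arg, Cf. now apply off_lattice_opp. }
  rewrite <- H. ring.
Qed.

Lemma deriv_shift z q : off_lattice tau z ->
  (forall u, off_lattice tau u -> f (u + lat tau q) = f u) -> f1 (z + lat tau q) = f1 z.
Proof.
  intros Hz Hp. destruct (off_lattice_open tau z Htau Hz) as [d [Hd Ho]].
  apply (ctame_unique (fun t => f (t + lat tau q)) (fun t => f1 (t + lat tau q)) f f1 z d Hd); auto.
  apply ctame_shift, Cf. now apply off_lattice_shift.
Qed.

(** [E] inherits evenness from [f] near the origin, so its derivative is odd there. The value is
    what makes the integrand odd also at the centre of the row at height 0, where nothing is assumed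
    of [f] itself. *)
Lemma ext_deriv_0 : E1 0 = 0.
Proof.
  destruct (off_lattice_but_0_open tau 0 Htau (off_lattice_but_0_0 tau Htau)) as [d [Hd Ho]].
  assert (H : - E1 (- 0) = E1 0).
  { apply (ctame_unique (fun t => E (- t)) (fun t => - E1 (- t)) E E1 0 d Hd).
    - intros u Hu. destruct (Ceq_dec u 0) as [->|Hu0]; [f_equal; ring|].
      assert (Hz : off_lattice tau u) by (apply off_lattice_iff; auto).
      rewrite <- (fE u Hz), <- (fE (- u)) by now apply off_lattice_opp. auto.
    - apply ctame_opp_arg. replace (- 0) with (RtoC 0) by ring.
      apply CE. now apply off_lattice_but_0_0.
    - apply CE. now apply off_lattice_but_0_0. }
  replace (- 0) with (RtoC 0) in H by ring.
  assert (H2 : 2 * E1 0 = 0) by (replace (2 * E1 0) with (E1 0 - - E1 0) by ring; rewrite H; ring).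
  replace (E1 0) with (/ 2 * (2 * E1 0)) by field. rewrite H2. ring.
Qed.

Let g (y x : R) : R := im_conj (f1 (pt tau y x)) (f (pt tau y x)).
Let gE (y x : R) : R := im_conj (E1 (pt tau y x)) (E (pt tau y x)).
Let J (y : R) : R := RInt (g y) (- / 2) (/ 2).
Let e (y x : R) : R :=
  (Re (f1 (pt tau y x)) * Re (f1 (pt tau y x)) + Im (f1 (pt tau y x)) * Im (f1 (pt tau y x)))%R.
Let gy (y x : R) : R :=
  ((Im (tau * f2 (pt tau y x)) * Re (f (pt tau y x))
    + Im (f1 (pt tau y x)) * Re (tau * f1 (pt tau y x)))
   - (Re (tau * f2 (pt tau y x)) * Im (f (pt tau y x))
    + Re (f1 (pt tau y x)) * Im (tau * f1 (pt tau y x))))%R.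
(** The derivatives of f in x and y are f' and tau f'. Hence the y-derivative of Im (f' conj f) is
    Im (tau f'' conj f) - Im(tau) |f'|^2, whereas the x-derivative of Im (tau f' conj f) has the
    same first term and the opposite second one. The two differ by 2 Im(tau) |f'|^2, and an
    x-derivative of a periodic function integrates to zero over a period. *)
Let k (y x : R) : R := im_conj (tau * f1 (pt tau y x)) (f (pt tau y x)).
Let kx (y x : R) : R := (gy y x + 2 * Im tau * e y x)%R.

Lemma is_derive_im_conj (p1 q1 p q : R -> R) t p1' q1' p' q' :
  is_derive q1 t q1' -> is_derive p1 t p1' -> is_derive p t p' -> is_derive q t q' ->
  is_derive (fun u => q1 u * p u - p1 u * q u)%R t
    ((q1' * p t + q1 t * p') - (p1' * q t + p1 t * q'))%R.
Proof.
  intros H1 H2 H3 H4.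
  apply (is_derive_minus (V := R_NormedModule) (fun u => q1 u * p u)%R (fun u => p1 u * q u)%R);
    apply (is_derive_mult (K := R_AbsRing)); auto; apply Rmult_comm.
Qed.

Lemma pt_path_y x : forall y u, pt tau u x - pt tau y x = RtoC (u - y) * tau.
Proof. intros. unfold pt. rewrite RtoC_minus. ring. Qed.

Lemma pt_path_x y : forall x u, pt tau y u - pt tau y x = RtoC (u - x) * 1.
Proof. intros. unfold pt. rewrite RtoC_minus. ring. Qed.

Lemma g_derive_y y x : (0 < y < 1)%R -> is_derive (fun u => g u x) y (gy y x).
Proof.
  intros Hy. pose proof (off_lattice_pt tau y x Htau Hy) as Hz.
  destruct (ctame_path f f1 (fun u => pt tau u x) tau y (pt_path_y x y) (Cf _ Hz)) as [A B].
  destruct (ctame_path f1 f2 (fun u => pt tau u x) tau y (pt_path_y x y) (Cf1 _ Hz)) as [A1 B1].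
  exact (is_derive_im_conj _ _ _ _ _ _ _ _ _ B1 A1 A B).
Qed.

Lemma k_derive_x y x : (0 < y < 1)%R -> is_derive (k y) x (kx y x).
Proof.
  intros Hy. pose proof (off_lattice_pt tau y x Htau Hy) as Hz.
  destruct (ctame_path f f1 (pt tau y) 1 x (pt_path_x y x) (Cf _ Hz)) as [A B].
  destruct (ctame_path _ _ (pt tau y) 1 x (pt_path_x y x) (ctame_scal tau _ _ _ (Cf1 _ Hz)))
    as [A1 B1].
  pose proof (is_derive_im_conj _ _ _ _ _ _ _ _ _ B1 A1 A B) as D.
  refine (eq_ind _ (fun l => is_derive (k y) x l) D _ _).
  unfold kx, gy, e, Re, Im. simpl. ring.
Qed.

Lemma lipschitz_near_scal c u z : lipschitz_near u z -> lipschitz_near (fun t => c * u t) z.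
Proof.
  intros [d [K [Hd [HK H]]]]. exists d, (Cmod c * K)%R. split; [easy|].
  split; [apply Rmult_le_pos; auto; apply Cmod_ge_0|]. intros s t Hs Ht.
  replace (c * u t - c * u s) with (c * (u t - u s)) by ring.
  rewrite Cmod_mult, Rmult_assoc. apply Rmult_le_compat_l; [apply Cmod_ge_0 | auto].
Qed.

Lemma gy_continuity y x : (0 < y < 1)%R -> continuity_2d_pt gy y x /\ continuity_2d_pt e y x
  /\ continuity_2d_pt g y x.
Proof.
  intros Hy. pose proof (off_lattice_pt tau y x Htau Hy) as Hz.
  pose proof (ctame_lipschitz_near _ _ _ (Cf _ Hz)) as L0.
  pose proof (ctame_lipschitz_near _ _ _ (Cf1 _ Hz)) as L1.
  destruct (lipschitz_continuity_2d _ _ _ _ L0) as [A0 B0].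
  destruct (lipschitz_continuity_2d _ _ _ _ L1) as [A1 B1].
  destruct (lipschitz_continuity_2d _ _ _ _ (lipschitz_near_scal tau _ _ L1)) as [A2 B2].
  destruct (lipschitz_continuity_2d _ _ _ _ (lipschitz_near_scal tau _ _ (Cf2 _ Hz))) as [A3 B3].
  split; [|split].
  - apply continuity_2d_pt_minus; apply continuity_2d_pt_plus; apply continuity_2d_pt_mult; auto.
  - apply continuity_2d_pt_plus; apply continuity_2d_pt_mult; auto.
  - apply continuity_2d_pt_minus; apply continuity_2d_pt_mult; auto.
Qed.

Lemma locally_strip y : (0 < y < 1)%R -> locally y (fun u : R => (0 < u < 1)%R).
Proof.
  intros Hy. assert (Hr : (0 < Rmin y (1 - y))%R) by (apply Rmin_pos; lra).
  exists (mkposreal _ Hr). intros u Hu.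
  change (Rabs (u - y) < Rmin y (1 - y))%R in Hu.
  pose proof (Rmin_l y (1 - y)). pose proof (Rmin_r y (1 - y)).
  apply Rabs_def2 in Hu. lra.
Qed.

Lemma ex_RInt_of_continuity phi y a b : (forall x, continuity_2d_pt phi y x) ->
  ex_RInt (phi y) a b.
Proof.
  intros H. apply (ex_RInt_continuous (V := R_CompleteNormedModule)). intros x _.
  now apply (continuity_2d_continuous phi y x).
Qed.

Lemma J_derive y : (0 < y < 1)%R ->
  is_derive J y (- (2 * Im tau) * RInt (e y) (- / 2) (/ 2))%R.
Proof.
  intros Hy.
  assert (HL := locally_strip y Hy).
  assert (D : is_derive J y (RInt (fun x => Derive (fun u => g u x) y) (- / 2) (/ 2))).
  { apply (is_derive_RInt_param g).
    - revert HL. apply filter_imp. intros u Hu x _. eexists. now apply g_derive_y.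
    - intros x _. destruct HL as [d Hd].
      apply continuity_2d_pt_ext_loc with gy; [|now apply gy_continuity].
      exists d. intros u v Hu _. symmetry. apply is_derive_unique, g_derive_y.
      now apply Hd.
    - revert HL. apply filter_imp. intros u Hu.
      apply ex_RInt_of_continuity. intros x. now apply gy_continuity. }
  assert (Eq : RInt (fun x => Derive (fun u => g u x) y) (- / 2) (/ 2)
             = (- (2 * Im tau) * RInt (e y) (- / 2) (/ 2))%R).
  { assert (Ckx : forall x, continuous (kx y) x).
    { intros x. apply (continuity_2d_continuous kx y x). destruct (gy_continuity y x Hy) as [G1 [G2 _]].
      apply (continuity_2d_pt_plus gy (fun u v => 2 * Im tau * e u v)%R); auto.
      apply (continuity_2d_pt_mult (fun _ _ => 2 * Im tau)%R e); auto.
      apply continuity_2d_pt_const. }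
    assert (Ek : k y (/ 2) = k y (- / 2)).
    { pose proof (off_lattice_pt tau y (- / 2) Htau Hy) as Hz.
      assert (Ept : pt tau y (/ 2) = pt tau y (- / 2) + 1).
      { unfold pt. replace (/ 2)%R with (- / 2 + 1)%R at 1 by field.
        rewrite RtoC_plus. ring. }
      assert (E1' : f1 (pt tau y (- / 2) + 1) = f1 (pt tau y (- / 2))).
      { rewrite <- (lat_10 tau). apply deriv_shift; auto. rewrite lat_10. auto. }
      unfold k. rewrite Ept, E1', f_1 by auto. easy. }
    apply is_RInt_unique.
    apply (is_RInt_ext (V := R_NormedModule) (fun x => minus (kx y x) (scal (2 * Im tau)%R (e y x)))).
    { intros x _. transitivity (gy y x).
      - unfold kx, minus, plus, opp, scal; simpl. unfold mult; simpl. ring.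
      - symmetry. now apply is_derive_unique, g_derive_y. }
    replace (- (2 * Im tau) * RInt (e y) (- / 2) (/ 2))%R
      with (minus (minus (k y (/ 2)) (k y (- / 2))) (scal (2 * Im tau)%R (RInt (e y) (- / 2) (/ 2)))).
    2:{ rewrite Ek. unfold minus, plus, opp, scal; simpl. unfold mult; simpl. ring. }
    apply (is_RInt_minus (V := R_NormedModule)).
    - apply (is_RInt_derive (V := R_CompleteNormedModule)); intros x _; [now apply k_derive_x | apply Ckx].
    - apply (is_RInt_scal (V := R_NormedModule)), (RInt_correct (V := R_CompleteNormedModule)).
      apply ex_RInt_of_continuity. intros x. now apply gy_continuity. }
  rewrite <- Eq. exact D.
Qed.

Lemma J_nonincreasing y1 y2 : (0 < y1)%R -> (y1 <= y2)%R -> (y2 < 1)%R -> (J y2 <= J y1)%R.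
Proof.
  intros H1 H12 H2.
  destruct (MVT_gen J y1 y2 (fun y => - (2 * Im tau) * RInt (e y) (- / 2) (/ 2))%R)
    as [c [Hc Eq]].
  - rewrite Rmin_left, Rmax_right by lra. intros x Hx. apply J_derive. lra.
  - rewrite Rmin_left, Rmax_right by lra. intros x Hx. apply derivable_continuous_pt.
    eexists. apply is_derive_Reals. apply J_derive. lra.
  - rewrite Rmin_left, Rmax_right in Hc by lra.
    assert (P : (0 <= RInt (e c) (- / 2) (/ 2))%R).
    { apply RInt_ge_0; [lra| |].
      - apply ex_RInt_of_continuity. intros x. apply gy_continuity. lra.
      - intros x _. unfold e. nra. }
    assert (0 <= 2 * Im tau * RInt (e c) (- / 2) (/ 2) * (y2 - y1))%R
      by (repeat apply Rmult_le_pos; lra).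
    lra.
Qed.

(** Since x + (1 - y) tau = tau - (-x + y tau), periodicity and parity carry one row to the other,
    changing the sign of f' but not of f. *)
Lemma J_reflect y : (0 < y < 1)%R -> J (1 - y) = (- J y)%R.
Proof.
  intros Hy. unfold J.
  apply RInt_odd_reflect; [|lra|].
  - intros x _.
    pose proof (off_lattice_pt tau y (- x) Htau Hy) as Hz.
    assert (Ept : pt tau (1 - y) x = - pt tau y (- x) + lat tau (0, 1)%Z).
    { rewrite lat_01. unfold pt. rewrite RtoC_minus, RtoC_opp. ring. }
    unfold g. rewrite Ept.
    rewrite deriv_shift; [|now apply off_lattice_opp|rewrite lat_01; auto].
    rewrite deriv_odd by auto. rewrite lat_01, f_tau by now apply off_lattice_opp.
    rewrite f_even by auto. unfold im_conj, Re, Im. simpl. ring.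
  - intros x _. apply (continuity_2d_continuous g y x). now apply gy_continuity.
Qed.

Lemma gE_continuity y x : (-1 < y < 1)%R -> (-1 < x < 1)%R -> continuity_2d_pt gE y x.
Proof.
  intros Hy Hx. pose proof (CE _ (off_lattice_but_0_pt tau y x Htau Hy Hx)) as H.
  destruct (lipschitz_continuity_2d _ _ _ _ (ctame_lipschitz_near _ _ _ H)) as [A0 B0].
  destruct (lipschitz_continuity_2d _ _ _ _ (ctame_deriv_lipschitz _ _ _ H)) as [A1 B1].
  apply continuity_2d_pt_minus; apply continuity_2d_pt_mult; auto.
Qed.

Lemma J_ext_0 : RInt (gE 0) (- / 2) (/ 2) = 0%R.
Proof.
  assert (H : RInt (gE 0) (- / 2) (/ 2) = (- RInt (gE 0) (- / 2) (/ 2))%R); [|lra].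
  apply RInt_odd_reflect; [|lra|].
  - intros x Hx. unfold gE.
    assert (Ept : pt tau 0 (- x) = - pt tau 0 x) by (unfold pt; rewrite RtoC_opp; ring).
    rewrite Ept. destruct (Req_dec x 0) as [->|Hx0].
    + replace (pt tau 0 0) with (RtoC 0) by (unfold pt; ring).
      replace (- 0) with (RtoC 0) by ring. rewrite ext_deriv_0.
      unfold im_conj, Re, Im. simpl. ring.
    + assert (Hz : off_lattice tau (pt tau 0 x)).
      { apply off_lattice_iff. split; [apply off_lattice_but_0_pt; auto; lra|].
        intros E0. apply (f_equal Re) in E0. revert E0. unfold pt, Re. simpl. lra. }
      pose proof (off_lattice_opp _ _ Hz) as Hz'.
      rewrite <- !deriv_eq_ext, <- !fE by auto. rewrite deriv_odd, f_even by auto.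
      unfold im_conj, Re, Im. simpl. ring.
  - intros x Hx. apply (continuity_2d_continuous gE 0 x). apply gE_continuity; lra.
Qed.

(** The integrand [g] is not controlled at the origin, so uniform continuity is applied to [gE],
    which agrees with [g] at the heights between 0 and 1 and integrates to zero at height 0. *)
Lemma J_limit_0 eps : (0 < eps)%R ->
  exists d, (0 < d)%R /\ forall y, (0 < y < d)%R -> (Rabs (J y) <= eps)%R.
Proof.
  intros He.
  destruct (uniform_continuity_2d_1d (fun x y => gE y x) (- / 2) (/ 2) 0) with (eps := mkposreal _ He)
    as [d Hd].
  { intros x Hx. intros ep. destruct (gE_continuity 0 x ltac:(lra) ltac:(lra) ep) as [d Hd].
    exists d. intros u v Hu Hv. now apply Hd. }
  pose proof (cond_pos d) as Pd.
  exists (Rmin d 1). split; [apply Rmin_pos; lra|]. intros y Hy.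
  pose proof (Rmin_l d 1). pose proof (Rmin_r d 1).
  assert (X : forall v, (-1 < v < 1)%R -> ex_RInt (gE v) (- / 2) (/ 2)).
  { intros v Hv. apply (ex_RInt_continuous (V := R_CompleteNormedModule)). intros x.
    rewrite Rmin_left, Rmax_right by lra.
    intros Hx. apply (continuity_2d_continuous gE v x). apply gE_continuity; lra. }
  assert (EJ : J y = RInt (fun x => minus (gE y x) (gE 0 x)) (- / 2) (/ 2)).
  { symmetry. apply is_RInt_unique.
    replace (J y) with (minus (RInt (gE y) (- / 2) (/ 2)) (RInt (gE 0) (- / 2) (/ 2))).
    - apply (is_RInt_minus (V := R_NormedModule) (gE y) (gE 0));
        apply (RInt_correct (V := R_CompleteNormedModule)), X; lra.
    - rewrite J_ext_0. transitivity (RInt (gE y) (- / 2) (/ 2)).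
      + unfold minus, plus, opp; simpl. ring.
      + apply RInt_ext. intros x _. unfold g, gE.
        pose proof (off_lattice_pt tau y x Htau ltac:(lra)) as Hz.
        rewrite (deriv_eq_ext _ Hz), (fE _ Hz). easy. }
  rewrite EJ. replace eps with ((/ 2 - - / 2) * eps)%R by field.
  apply abs_RInt_le_const; [lra| |].
  - apply (ex_RInt_minus (gE y) (gE 0)); apply X; lra.
  - intros x Hx. apply Rlt_le. apply (Hd x 0%R x y); try lra.
    replace (x - x)%R with 0%R by ring. rewrite Rabs_R0. lra.
Qed.

Lemma J_zero y : (0 < y < 1)%R -> J y = 0%R.
Proof.
  intros Hy. apply Rabs_eq_0. apply Rle_antisym; [|apply Rabs_pos].
  apply le_epsilon. intros eps He. rewrite Rplus_0_l.
  destruct (J_limit_0 eps He) as [d [Hd H]].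
  (* This height lies in the range of the limit estimate and puts [y] between [w] and [1 - w], so
     that [J y] is caught between [- J w] and [J w]. *)
  set (w := Rmin (d / 2) (Rmin y (1 - y))).
  assert (W0 : (0 < w)%R) by (unfold w; repeat apply Rmin_pos; lra).
  assert (W1 : (w <= d / 2)%R) by apply Rmin_l.
  assert (W2 : (w <= y)%R) by (eapply Rle_trans; [apply Rmin_r | apply Rmin_l]).
  assert (W3 : (w <= 1 - y)%R) by (eapply Rle_trans; [apply Rmin_r | apply Rmin_r]).
  pose proof (H w ltac:(lra)) as Hw.
  pose proof (J_nonincreasing w y ltac:(lra) ltac:(lra) ltac:(lra)) as M1.
  pose proof (J_nonincreasing y (1 - w) ltac:(lra) ltac:(lra) ltac:(lra)) as M2.
  rewrite J_reflect in M2 by lra.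
  apply Rabs_le_between in Hw. apply Rabs_le. lra.
Qed.

Lemma energy_deriv_zero y x : (0 < y < 1)%R -> (- / 2 <= x <= / 2)%R -> f1 (pt tau y x) = 0.
Proof.
  intros Hy Hx.
  assert (D0 : is_derive J y 0%R).
  { apply (is_derive_ext_loc (fun _ => 0%R)).
    - generalize (locally_strip y Hy). apply filter_imp. intros u Hu. symmetry. now apply J_zero.
    - apply (is_derive_const (V := R_NormedModule)). }
  pose proof (is_derive_unique _ _ _ D0) as U0.
  pose proof (is_derive_unique _ _ _ (J_derive y Hy)) as U1.
  rewrite U0 in U1.
  assert (I0 : RInt (e y) (- / 2) (/ 2) = 0%R).
  { apply Rmult_eq_reg_l with (- (2 * Im tau))%R; lra. }
  assert (Ee : e y x = 0%R).
  { apply (RInt_eq_0_pos (e y) (- / 2) (/ 2)); auto; [lra| |].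
    - intros u _. apply (continuity_2d_continuous e y u). now apply gy_continuity.
    - intros u. unfold e. nra. }
  unfold e in Ee. apply C_ext; simpl.
  - change (Re (f1 (pt tau y x)) = 0%R). nra.
  - change (Im (f1 (pt tau y x)) = 0%R). nra.
Qed.

End Energy.

(** * The differential equation, and separation of the values at 1/2 and tau/4 *)

(* wp'' - 6 wp^2 = 6 ode_fun, since Esum 4 = wp'' / 6. *)
Definition ode_fun (tau z : C) : C := Esum tau 4 z - wpL tau z ^ 2.

Definition ode_fun' (tau z : C) : C := 4 * (wpL tau z * Esum tau 3 z - Esum tau 5 z).

Definition ode_fun'' (tau z : C) : C :=
  4 * ((- (2) * Esum tau 3 z * Esum tau 3 z + wpL tau z * (- (3) * Esum tau 4 z)) - - (5) * Esum tau 6 z).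

Lemma ctame_wpL_Esum3 tau z : (0 < Im tau)%R -> off_lattice tau z ->
  ctame (fun t => wpL tau t * Esum tau 3 t)
    (fun t => - (2) * Esum tau 3 t * Esum tau 3 t + wpL tau t * (- (3) * Esum tau 4 t)) z.
Proof.
  intros Ht Hz.
  generalize (ctame_mult _ _ _ _ _ (ctame_wpL tau z Ht Hz) (ctame_Esum tau z 3 Ht Hz (le_n 3))).
  apply ctame_ext; intros t; auto. simpl INR. rewrite !RtoC_plus. ring.
Qed.

Lemma ctame_ode_fun tau z : (0 < Im tau)%R -> off_lattice tau z ->
  ctame (ode_fun tau) (ode_fun' tau) z.
Proof.
  intros Ht Hz.
  generalize (ctame_minus _ _ _ _ _ (ctame_Esum tau z 4 Ht Hz ltac:(lia))
    (ctame_pow _ _ _ 1 (ctame_wpL tau z Ht Hz))).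
  apply ctame_ext; intros t; [easy|]. unfold ode_fun'. simpl INR. rewrite !RtoC_plus. ring.
Qed.

Lemma ctame_ode_fun' tau z : (0 < Im tau)%R -> off_lattice tau z ->
  ctame (ode_fun' tau) (ode_fun'' tau) z.
Proof.
  intros Ht Hz.
  generalize (ctame_scal 4 _ _ _ (ctame_minus _ _ _ _ _ (ctame_wpL_Esum3 tau z Ht Hz)
    (ctame_Esum tau z 5 Ht Hz ltac:(lia)))).
  apply ctame_ext; intros t; [easy|]. unfold ode_fun''. simpl INR. rewrite !RtoC_plus. ring.
Qed.

Lemma ode_fun''_lipschitz tau z : (0 < Im tau)%R -> off_lattice tau z ->
  lipschitz_near (ode_fun'' tau) z.
Proof.
  intros Ht Hz.
  pose proof (ctame_Esum tau z 3 Ht Hz ltac:(lia)) as C3.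
  pose proof (ctame_Esum tau z 4 Ht Hz ltac:(lia)) as C4.
  pose proof (ctame_Esum tau z 6 Ht Hz ltac:(lia)) as C6.
  eapply ctame_lipschitz_near.
  apply (ctame_scal 4). apply ctame_minus; [|apply (ctame_scal (- (5)) _ _ _ C6)].
  apply ctame_plus; apply ctame_mult; try apply ctame_scal; try eassumption.
  now apply ctame_wpL.
Qed.

(** The regular continuation of [ode_fun] to the origin: with wp = 1/z^2 + z^2 q, where q is
    [wpreg_quot], the square is 1/z^4 + 2 q + [wpreg]^2, and 1/z^4 cancels against the pole of the
    sum with exponent 4. *)
Definition ode_ext (tau z : C) : C := esum tau 4 z - 2 * wpreg_quot tau z - wpreg tau z ^ 2.

Lemma ode_fun_ext tau z : (0 < Im tau)%R -> off_lattice tau z -> ode_fun tau z = ode_ext tau z.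
Proof.
  intros Ht Hz. pose proof (off_lattice_neq_0 _ _ Hz) as H0.
  unfold ode_fun, ode_ext, Esum, wpL.
  rewrite (wpreg_eq_quot tau z Ht (off_lattice_weaken _ _ Hz)). field. auto.
Qed.

Lemma ctame_ode_ext tau : (0 < Im tau)%R ->
  exists f', forall z, off_lattice_but_0 tau z -> ctame (ode_ext tau) f' z.
Proof.
  intros Ht. destruct (ctame_wpreg_quot tau Ht) as [k' Hk].
  eexists. intros z Hz.
  exact (ctame_minus _ _ _ _ _ (ctame_minus _ _ _ _ _ (ctame_esum tau z 4 Ht Hz ltac:(lia))
    (ctame_scal 2 _ _ _ (Hk z Hz))) (ctame_pow _ _ _ 1 (ctame_wpreg tau z Ht Hz))).
Qed.

Lemma ode_fun'_zero_strip tau y x : (0 < Im tau)%R -> (0 < y < 1)%R -> (- / 2 <= x <= / 2)%R ->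
  ode_fun' tau (pt tau y x) = 0.
Proof.
  intros Ht Hy Hx. destruct (ctame_ode_ext tau Ht) as [E1 HE].
  apply (energy_deriv_zero tau (ode_fun tau) (ode_fun' tau) (ode_fun'' tau) (ode_ext tau) E1);
    auto; intros z Hz.
  - now apply ctame_ode_fun.
  - now apply ctame_ode_fun'.
  - now apply ode_fun''_lipschitz.
  - now apply ode_fun_ext.
  - unfold ode_fun. rewrite wpL_even, Esum_opp by (auto; lia). simpl. ring.
  - unfold ode_fun. rewrite <- (lat_10 tau), wpL_periodic, Esum_periodic by (auto; lia). easy.
  - unfold ode_fun. rewrite <- (lat_01 tau) at 2 4.
    rewrite wpL_periodic, Esum_periodic by (auto; lia). easy.
Qed.

(** The energy argument leaves out the row at height 0, on which the path from 1/2 towards the pole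
    runs; continuity from above supplies it. *)
Lemma ode_fun'_zero tau y x : (0 < Im tau)%R -> (0 <= y < 1)%R -> (- / 2 <= x <= / 2)%R ->
  off_lattice tau (pt tau y x) -> ode_fun' tau (pt tau y x) = 0.
Proof.
  intros Ht Hy Hx Hz. destruct (Req_dec y 0) as [->|Hy0]; [|apply ode_fun'_zero_strip; auto; lra].
  destruct (lipschitz_continuity_2d _ _ _ _ (ctame_lipschitz_near _ _ _ (ctame_ode_fun' tau _ Ht Hz)))
    as [CR CI].
  assert (Q : forall phi : R -> R -> R, continuity_2d_pt phi 0 x ->
    (forall u, (0 < u < 1)%R -> phi u x = 0%R) -> phi 0%R x = 0%R).
  { intros phi Hc H0. apply Rabs_eq_0. apply Rle_antisym; [|apply Rabs_pos].
    apply le_epsilon. intros eps He. destruct (Hc (mkposreal _ He)) as [d Hd].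
    pose proof (cond_pos d) as Pd.
    set (u := Rmin (d / 2) (/ 2)).
    assert (U0 : (0 < u)%R) by (apply Rmin_pos; lra).
    assert (U1 : (u <= d / 2)%R) by apply Rmin_l. assert (U2 : (u <= / 2)%R) by apply Rmin_r.
    assert (Hu : (Rabs (u - 0) < d)%R) by (rewrite Rminus_0_r, Rabs_pos_eq; lra).
    assert (Hx' : (Rabs (x - x) < d)%R)
      by (replace (x - x)%R with 0%R by ring; rewrite Rabs_R0; lra).
    specialize (Hd u x Hu Hx'). simpl in Hd. rewrite (H0 u) in Hd by lra.
    rewrite Rabs_minus_sym, Rminus_0_r in Hd. lra. }
  apply C_ext.
  - apply (Q (fun u v => Re (ode_fun' tau (pt tau u v))) CR).
    intros u Hu. now rewrite ode_fun'_zero_strip.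
  - apply (Q (fun u v => Im (ode_fun' tau (pt tau u v))) CI).
    intros u Hu. now rewrite ode_fun'_zero_strip.
Qed.

(** * Constancy along segments and uniqueness for the differential equation *)

Lemma Rabs_dot_le (a b x y : R) :
  (Rabs (x * a + y * b) <= (a * a + b * b + (x * x + y * y)) / 2)%R.
Proof.
  apply Rabs_le.
  pose proof (Rle_0_sqr (x - a)). pose proof (Rle_0_sqr (x + a)).
  pose proof (Rle_0_sqr (y - b)). pose proof (Rle_0_sqr (y + b)).
  unfold Rsqr in *. lra.
Qed.

Lemma is_derive_continuity_pt (phi : R -> R) t l : is_derive phi t l -> continuity_pt phi t.
Proof.
  intros H. apply derivable_continuous_pt. exists l. now apply is_derive_Reals.
Qed.

Lemma constant_on_path f f' (z : R -> C) (b : C) T : (0 <= T)%R ->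
  (forall t u, z u - z t = RtoC (u - t) * b) ->
  (forall t, (0 <= t <= T)%R -> ctame f f' (z t)) ->
  (forall t, (0 < t < T)%R -> f' (z t) = 0) -> f (z T) = f (z 0%R).
Proof.
  intros HT Hz Hf H0.
  assert (Q : forall phi : R -> R, (forall t, (0 <= t <= T)%R -> continuity_pt phi t) ->
    (forall t, (0 < t < T)%R -> is_derive phi t 0%R) -> phi T = phi 0%R).
  { intros phi Hc Hd. destruct (MVT_gen phi 0 T (fun _ => 0%R)) as [c [_ E]].
    - rewrite Rmin_left, Rmax_right by lra. auto.
    - rewrite Rmin_left, Rmax_right by lra. auto.
    - lra. }
  apply C_ext.
  - apply (Q (fun t => Re (f (z t)))).
    + intros t Ht. destruct (ctame_path f f' z b t (Hz t) (Hf t Ht)) as [A _].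
      apply (is_derive_continuity_pt _ _ _ A).
    + intros t Ht. destruct (ctame_path f f' z b t (Hz t) (Hf t ltac:(lra))) as [A _].
      rewrite H0, Cmult_0_r in A by auto. exact A.
  - apply (Q (fun t => Im (f (z t)))).
    + intros t Ht. destruct (ctame_path f f' z b t (Hz t) (Hf t Ht)) as [_ A].
      apply (is_derive_continuity_pt _ _ _ A).
    + intros t Ht. destruct (ctame_path f f' z b t (Hz t) (Hf t ltac:(lra))) as [_ A].
      rewrite H0, Cmult_0_r in A by auto. exact A.
Qed.

(** The product of [phi] with exp(-K t) does not increase and starts at 0, while [phi] is
    nonnegative. *)
Lemma gronwall_zero (phi phi' : R -> R) (K T : R) : (0 <= T)%R -> phi 0%R = 0%R ->
  (forall t, 0 <= phi t)%R ->
  (forall t, (0 <= t <= T)%R -> is_derive phi t (phi' t)) ->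
  (forall t, 0 <= t <= T -> phi' t <= K * phi t)%R -> phi T = 0%R.
Proof.
  intros HT H0 Hpos Hd Hle.
  set (psi := fun t => (phi t * exp (- K * t))%R).
  set (psi' := fun t => (phi' t * exp (- K * t) + phi t * (- K * exp (- K * t)))%R).
  assert (D : forall t, (0 <= t <= T)%R -> is_derive psi t (psi' t)).
  { intros t Ht. apply (is_derive_mult (K := R_AbsRing) phi (fun t => exp (- K * t)));
      [now apply Hd| |apply Rmult_comm].
    auto_derive; [easy | ring]. }
  destruct (MVT_gen psi 0 T psi') as [c [Hc E]].
  - rewrite Rmin_left, Rmax_right by lra. intros t Ht. apply D. lra.
  - rewrite Rmin_left, Rmax_right by lra. intros t Ht. apply (is_derive_continuity_pt _ _ _ (D t Ht)).
  - rewrite Rmin_left, Rmax_right in Hc by lra.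
    assert (P : (psi' c <= 0)%R).
    { unfold psi'. pose proof (exp_pos (- K * c)). specialize (Hle c Hc).
      replace (phi' c * exp (- K * c) + phi c * (- K * exp (- K * c)))%R
        with ((phi' c - K * phi c) * exp (- K * c))%R by ring.
      nra. }
    assert (L : (psi T <= 0)%R).
    { assert (psi 0 = 0)%R by (unfold psi; rewrite H0; ring).
      assert (psi' c * (T - 0) <= 0)%R by nra. lra. }
    unfold psi in L. pose proof (exp_pos (- K * T)). specialize (Hpos T). nra.
Qed.

(* Both curves solve wp'' = 6 (wp^2 + c): in terms of u = wp, r = Esum 3 = - wp' / 2 along unit
   speed to the left, u' = 2 r and r' = 3 (u^2 + c). *)
Lemma wpL_equal_along tau c (z1 z2 : R -> C) (T : R) : (0 < Im tau)%R -> (0 <= T)%R ->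
  (forall t u, z1 u - z1 t = RtoC (u - t) * - (1)) ->
  (forall t u, z2 u - z2 t = RtoC (u - t) * - (1)) ->
  (forall t, (0 <= t <= T)%R -> off_lattice tau (z1 t) /\ ode_fun tau (z1 t) = c) ->
  (forall t, (0 <= t <= T)%R -> off_lattice tau (z2 t) /\ ode_fun tau (z2 t) = c) ->
  wpL tau (z1 0%R) = wpL tau (z2 0%R) -> Esum tau 3 (z1 0%R) = Esum tau 3 (z2 0%R) ->
  wpL tau (z1 T) = wpL tau (z2 T).
Proof.
  intros Ht HT P1 P2 O1 O2 E0 E0'.
  (* The difference of the squares of wp factors as [p * w], so the differences satisfy the linear
     system w' = 2 r, r' = 3 p w, and [p] is bounded because it is continuous on a compact
     interval. *)
  set (w := fun t => wpL tau (z1 t) - wpL tau (z2 t)).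
  set (r := fun t => Esum tau 3 (z1 t) - Esum tau 3 (z2 t)).
  set (p := fun t => wpL tau (z1 t) + wpL tau (z2 t)).
  assert (Dw : forall z : R -> C, (forall t u, z u - z t = RtoC (u - t) * - (1)) ->
    (forall t, (0 <= t <= T)%R -> off_lattice tau (z t) /\ ode_fun tau (z t) = c) ->
    forall t, (0 <= t <= T)%R ->
     is_derive (fun u => Re (wpL tau (z u))) t (Re (2 * Esum tau 3 (z t))) /\
     is_derive (fun u => Im (wpL tau (z u))) t (Im (2 * Esum tau 3 (z t))) /\
     is_derive (fun u => Re (Esum tau 3 (z u))) t (Re (3 * (c + wpL tau (z t) ^ 2))) /\
     is_derive (fun u => Im (Esum tau 3 (z u))) t (Im (3 * (c + wpL tau (z t) ^ 2)))).
  { intros z Pz Oz t Htt. destruct (Oz t Htt) as [Hz Ec].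
    destruct (ctame_path _ _ z _ t (Pz t) (ctame_wpL tau _ Ht Hz)) as [A B].
    destruct (ctame_path _ _ z _ t (Pz t) (ctame_Esum tau _ 3 Ht Hz (le_n 3))) as [A' B'].
    assert (F1 : - (1) * (- (2) * Esum tau 3 (z t)) = 2 * Esum tau 3 (z t)) by ring.
    assert (F2 : - (1) * (- INR 3 * Esum tau 4 (z t)) = 3 * (c + wpL tau (z t) ^ 2)).
    { rewrite <- Ec. unfold ode_fun. simpl INR. rewrite !RtoC_plus. ring. }
    rewrite F1 in A, B. rewrite F2 in A', B'. auto. }
  assert (HM : exists M, (0 <= M)%R /\ forall t, (0 <= t <= T)%R ->
     (Rabs (Re (p t)) <= M)%R /\ (Rabs (Im (p t)) <= M)%R).
  { assert (B : forall phi : R -> R, (forall t, (0 <= t <= T)%R -> continuity_pt phi t) ->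
      exists M, forall t, (0 <= t <= T)%R -> (Rabs (phi t) <= M)%R).
    { intros phi Hc.
      destruct (continuity_ab_maj (fun t => Rabs (phi t)) 0 T HT) as [m [Hm _]].
      - intros t Htt. apply (continuity_pt_comp phi Rabs); [now apply Hc | apply Rcontinuity_abs].
      - exists (Rabs (phi m)). intros t Htt. now apply Hm. }
    destruct (B (fun t => Re (p t))) as [M1 HM1].
    { intros t Htt. destruct (Dw z1 P1 O1 t Htt) as [A1 [B1 _]].
      destruct (Dw z2 P2 O2 t Htt) as [A2 [B2 _]].
      exact (continuity_pt_plus _ _ t (is_derive_continuity_pt _ _ _ A1)
        (is_derive_continuity_pt _ _ _ A2)). }
    destruct (B (fun t => Im (p t))) as [M2 HM2].
    { intros t Htt. destruct (Dw z1 P1 O1 t Htt) as [A1 [B1 _]].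
      destruct (Dw z2 P2 O2 t Htt) as [A2 [B2 _]].
      exact (continuity_pt_plus _ _ t (is_derive_continuity_pt _ _ _ B1)
        (is_derive_continuity_pt _ _ _ B2)). }
    exists (Rmax 0 (Rmax M1 M2)). split; [apply Rmax_l|]. intros t Htt.
    specialize (HM1 t Htt). specialize (HM2 t Htt).
    pose proof (Rmax_r 0 (Rmax M1 M2)). pose proof (Rmax_l M1 M2). pose proof (Rmax_r M1 M2). lra. }
  destruct HM as [M [HM0 HM]].
  set (phi := fun t => (Re (w t) * Re (w t) + Im (w t) * Im (w t)
    + (Re (r t) * Re (r t) + Im (r t) * Im (r t)))%R).
  set (phi' := fun t => (4 * (Re (w t) * Re (r t) + Im (w t) * Im (r t)) +
     6 * (Re (p t) * (Re (r t) * Re (w t) + Im (r t) * Im (w t)) +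
          Im (p t) * (Im (r t) * Re (w t) - Re (r t) * Im (w t))))%R).
  assert (Z : phi T = 0%R).
  (* Here [phi] is |w|^2 + |r|^2, and its derivative is 4 Re (r conj w) + 6 Re (p w conj r). Real
     and imaginary parts of the products are at most [phi / 2], which gives 2 for the first term and
     [6 * M] for the two halves of the second. *)
  { apply (gronwall_zero phi phi' (2 + 6 * M) T HT).
    - unfold phi, w, r. rewrite E0, E0'. unfold Re, Im; simpl. ring.
    - intros t. unfold phi. pose proof (Rle_0_sqr (Re (w t))). pose proof (Rle_0_sqr (Im (w t))).
      pose proof (Rle_0_sqr (Re (r t))). pose proof (Rle_0_sqr (Im (r t))). unfold Rsqr in *. lra.
    - intros t Htt.
      destruct (Dw z1 P1 O1 t Htt) as [A1 [B1 [C1 D1]]].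
      destruct (Dw z2 P2 O2 t Htt) as [A2 [B2 [C2 D2]]].
      pose proof (is_derive_minus (V := R_NormedModule) _ _ _ _ _ A1 A2) as A.
      pose proof (is_derive_minus (V := R_NormedModule) _ _ _ _ _ B1 B2) as B.
      pose proof (is_derive_minus (V := R_NormedModule) _ _ _ _ _ C1 C2) as C.
      pose proof (is_derive_minus (V := R_NormedModule) _ _ _ _ _ D1 D2) as D.
      pose proof (is_derive_mult (K := R_AbsRing) _ _ _ _ _ A A Rmult_comm) as A3.
      pose proof (is_derive_mult (K := R_AbsRing) _ _ _ _ _ B B Rmult_comm) as B3.
      pose proof (is_derive_mult (K := R_AbsRing) _ _ _ _ _ C C Rmult_comm) as C3.
      pose proof (is_derive_mult (K := R_AbsRing) _ _ _ _ _ D D Rmult_comm) as D3.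
      pose proof (is_derive_plus (V := R_NormedModule) _ _ _ _ _
        (is_derive_plus (V := R_NormedModule) _ _ _ _ _ A3 B3)
        (is_derive_plus (V := R_NormedModule) _ _ _ _ _ C3 D3)) as H.
      refine (eq_ind _ (fun l => is_derive phi t l) H _ _).
      unfold phi', w, r, p, minus, plus, opp, mult. simpl.
      unfold mult; simpl. unfold Re, Im. simpl. ring.
    - intros t Htt. destruct (HM t Htt) as [M1 M2].
      unfold phi', phi.
      set (a := Re (w t)) in *. set (b := Im (w t)) in *.
      set (x := Re (r t)) in *. set (y := Im (r t)) in *.
      set (m := Re (p t)) in *. set (n := Im (p t)) in *.
      set (S := (a * a + b * b + (x * x + y * y))%R).
      assert (Q1 : (Rabs (x * a + y * b) <= S / 2)%R) by apply Rabs_dot_le.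
      assert (Q2 : (Rabs (y * a - x * b) <= S / 2)%R) by
        (pose proof (Rabs_dot_le a (- b) y x) as Q; unfold S;
         replace (y * a - x * b)%R with (y * a + x * - b)%R by ring; lra).
      assert (Q3 : (m * (x * a + y * b) <= M * (S / 2))%R).
      { eapply Rle_trans; [apply Rle_abs|]. rewrite Rabs_mult.
        apply Rmult_le_compat; auto; apply Rabs_pos. }
      assert (Q4 : (n * (y * a - x * b) <= M * (S / 2))%R).
      { eapply Rle_trans; [apply Rle_abs|]. rewrite Rabs_mult.
        apply Rmult_le_compat; auto; apply Rabs_pos. }
      apply Rabs_le_between in Q1. fold S. lra. }
  assert (W : w T = 0).
  { unfold phi in Z. apply C_ext; [change (Re (w T) = 0%R) | change (Im (w T) = 0%R)]; nra. }
  unfold w in W. replace (wpL tau (z1 T)) with ((wpL tau (z1 T) - wpL tau (z2 T)) + wpL tau (z2 T)) by ring.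
  rewrite W. ring.
Qed.

(** The classical relation wp'^2 = 4 wp^3 - g2 wp - g3 divided by 4, with g2 = -12 [ode_fun]; the
    value is -g3/4. Keeping [ode_fun] as a function makes the derivative a multiple of [ode_fun'],
    so constancy follows wherever that vanishes. *)
Definition first_integral (tau z : C) : C :=
  Esum tau 3 z ^ 2 - wpL tau z ^ 3 - 3 * (ode_fun tau z * wpL tau z).

Lemma ctame_first_integral tau z : (0 < Im tau)%R -> off_lattice tau z ->
  ctame (first_integral tau) (fun t => -3 * (ode_fun' tau t * wpL tau t)) z.
Proof.
  intros Ht Hz.
  pose proof (ctame_wpL tau z Ht Hz) as CW.
  pose proof (ctame_Esum tau z 3 Ht Hz (le_n 3)) as C3.
  generalize (ctame_minus _ _ _ _ _ (ctame_minus _ _ _ _ _ (ctame_pow _ _ _ 1 C3) (ctame_pow _ _ _ 2 CW))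
    (ctame_scal 3 _ _ _ (ctame_mult _ _ _ _ _ (ctame_ode_fun tau z Ht Hz) CW))).
  apply ctame_ext; intros t; [easy|].
  unfold ode_fun. simpl INR. rewrite !RtoC_plus. ring.
Qed.

Lemma off_lattice_real tau x : (0 < Im tau)%R -> (-1 < x < 1)%R -> x <> 0%R ->
  off_lattice tau (pt tau 0 x).
Proof.
  intros Ht Hx Hx0. apply off_lattice_iff.
  split; [apply off_lattice_but_0_pt; auto; lra|].
  intros E. apply (f_equal Re) in E. revert E. unfold pt, Re. simpl. lra.
Qed.

Lemma Esum_3_half tau : (0 < Im tau)%R -> Esum tau 3 (pt tau 0 (/ 2)) = 0.
Proof.
  intros Ht. pose proof (off_lattice_real tau (/ 2) Ht ltac:(lra) ltac:(lra)) as Hz.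
  pose proof (off_lattice_opp _ _ Hz) as Hz'.
  assert (E : pt tau 0 (/ 2) = - pt tau 0 (/ 2) + lat tau (1, 0)%Z).
  { rewrite lat_10. unfold pt. apply C_ext; unfold Re, Im; simpl; field. }
  set (z := pt tau 0 (/ 2)) in *.
  assert (H : Esum tau 3 z = - Esum tau 3 z).
  { rewrite E at 1. rewrite Esum_periodic, Esum_opp by (auto; lia). simpl. ring. }
  replace (Esum tau 3 z) with (/ 2 * (Esum tau 3 z + Esum tau 3 z)) by field.
  rewrite H at 1. ring.
Qed.

Lemma ctame_bounded f f' z : ctame f f' z ->
  exists d K, (0 < d)%R /\ forall t, (Cmod (t - z) < d)%R -> (Cmod (f t) <= K)%R.
Proof.
  intros [d [K [Hd [HK H]]]]. exists d, K. split; auto. intros t Ht.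
  destruct (H tt t t Ht Ht) as [A _]. lra.
Qed.

(* If the values agreed, the first integral would make wp' vanish at tau/4 as it does at 1/2;
   both translates of wp would then solve the same initial value problem, so
   wp(1/2 - s) = wp(tau/4 - s) for 0 <= s < 1/2, but the left side blows up at s = 1/2. *)
Lemma wpL_half_neq_quarter tau : (0 < Im tau)%R ->
  wpL tau (pt tau (/ 4) 0) <> wpL tau (pt tau 0 (/ 2)).
Proof.
  intros Ht Heq.
  (* The segment from 1/2 to tau/4. Its interior lies in the open strip where [ode_fun'] vanishes,
     and it avoids the lattice, so both invariants have equal values at its ends. *)
  set (za := fun t : R => pt tau (t / 4) (/ 2 - t / 2)).
  assert (Pa : forall t u, za u - za t = RtoC (u - t) * (RtoC (/ 4) * tau - RtoC (/ 2))).
  { intros t u. unfold za, pt. apply C_ext; unfold Re, Im; simpl; field. }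
  assert (Oa : forall t, (0 <= t <= 1)%R -> off_lattice tau (za t)).
  { intros t Htt. unfold za. destruct (Req_dec t 0) as [->|H0].
    - replace (0 / 4)%R with 0%R by field. apply off_lattice_real; auto; lra.
    - apply off_lattice_pt; auto; lra. }
  assert (Za : forall t, (0 < t < 1)%R -> ode_fun' tau (za t) = 0).
  { intros t Htt. apply ode_fun'_zero_strip; auto; lra. }
  assert (za0 : za 0%R = pt tau 0 (/ 2)) by (unfold za; f_equal; field).
  assert (za1 : za 1%R = pt tau (/ 4) 0) by (unfold za; f_equal; field).
  assert (EF : ode_fun tau (pt tau (/ 4) 0) = ode_fun tau (pt tau 0 (/ 2))).
  { rewrite <- za0, <- za1. apply (constant_on_path _ (ode_fun' tau) za _ 1 ltac:(lra) Pa); auto.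
    intros t Htt. apply ctame_ode_fun; auto. }
  assert (EI : first_integral tau (pt tau (/ 4) 0) = first_integral tau (pt tau 0 (/ 2))).
  { rewrite <- za0, <- za1.
    apply (constant_on_path _ (fun t => -3 * (ode_fun' tau t * wpL tau t)) za _ 1 ltac:(lra) Pa).
    - intros t Htt. apply ctame_first_integral; auto.
    - intros t Htt. rewrite Za by auto. ring. }
  assert (E3 : Esum tau 3 (pt tau (/ 4) 0) = 0).
  { unfold first_integral in EI. rewrite EF, Heq, Esum_3_half in EI by auto.
    set (s3 := Esum tau 3 (pt tau (/ 4) 0)) in *.
    set (W := wpL tau (pt tau 0 (/ 2))) in *. set (c := ode_fun tau (pt tau 0 (/ 2))) in *.
    assert (S2 : s3 ^ 2 = 0).
    { replace (s3 ^ 2) with ((s3 ^ 2 - W ^ 3 - 3 * (c * W)) + W ^ 3 + 3 * (c * W)) by ring.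
      rewrite EI. ring. }
    apply Cmod_eq_0. apply (f_equal Cmod) in S2. rewrite Cmod_pow, Cmod_0 in S2.
    pose proof (Cmod_ge_0 s3). simpl in S2. nra. }
  set (c := ode_fun tau (pt tau 0 (/ 2))) in *.
  set (z1 := fun t : R => pt tau 0 (/ 2 - t)).
  set (z2 := fun t : R => pt tau (/ 4) (- t)).
  assert (P1 : forall t u, z1 u - z1 t = RtoC (u - t) * - (1)).
  { intros t u. unfold z1, pt. apply C_ext; unfold Re, Im; simpl; ring. }
  assert (P2 : forall t u, z2 u - z2 t = RtoC (u - t) * - (1)).
  { intros t u. unfold z2, pt. apply C_ext; unfold Re, Im; simpl; ring. }
  assert (z10 : z1 0%R = pt tau 0 (/ 2)) by (unfold z1; f_equal; ring).
  assert (z20 : z2 0%R = pt tau (/ 4) 0) by (unfold z2; f_equal; ring).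
  assert (O1 : forall t, (0 <= t < / 2)%R -> off_lattice tau (z1 t) /\ ode_fun tau (z1 t) = c).
  { assert (O : forall t, (0 <= t < / 2)%R -> off_lattice tau (z1 t))
      by (intros t Htt; apply off_lattice_real; auto; lra).
    intros t Htt. split; auto. unfold c. rewrite <- z10.
    apply (constant_on_path _ (ode_fun' tau) z1 _ t ltac:(lra) P1).
    - intros u Hu. apply ctame_ode_fun; auto. apply O. lra.
    - intros u Hu. apply ode_fun'_zero; auto; try lra. apply O. lra. }
  assert (O2 : forall t, (0 <= t <= / 2)%R -> off_lattice tau (z2 t) /\ ode_fun tau (z2 t) = c).
  { assert (O : forall t, off_lattice tau (z2 t))
      by (intros t; apply off_lattice_pt; auto; lra).
    intros t Htt. split; auto. rewrite <- EF, <- z20.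
    apply (constant_on_path _ (ode_fun' tau) z2 _ t ltac:(lra) P2).
    - intros u Hu. apply ctame_ode_fun; auto.
    - intros u Hu. apply ode_fun'_zero_strip; auto; lra. }
  assert (EQ : forall T, (0 <= T < / 2)%R -> wpL tau (z1 T) = wpL tau (z2 T)).
  { intros T HT. apply (wpL_equal_along tau c z1 z2 T Ht ltac:(lra) P1 P2).
    - intros t Htt. apply O1. lra.
    - intros t Htt. apply O2. lra.
    - rewrite z10, z20. auto.
    - rewrite z10, z20, E3. now apply Esum_3_half. }
  destruct (ctame_bounded _ _ _ (ctame_wpreg tau 0 Ht (off_lattice_but_0_0 tau Ht))) as [d1 [K1 [Hd1 B1]]].
  destruct (ctame_bounded _ _ _ (ctame_wpL tau (z2 (/ 2)%R) Ht (proj1 (O2 (/ 2)%R ltac:(lra)))))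
    as [d2 [K2 [Hd2 B2]]].
  (* At distance [ep] from the pole, with [ep <= / (2 * K)], the term 1/z^2 has modulus at least 4
     K^2. This exceeds the sum of [K1], which bounds the regular part, and [K2], which bounds wp on
     the other path. *)
  set (K := (Rabs K1 + Rabs K2 + 1)%R).
  assert (HK : (1 <= K)%R) by (pose proof (Rabs_pos K1); pose proof (Rabs_pos K2); unfold K; lra).
  set (ep := Rmin (Rmin (d1 / 2) (d2 / 2)) (/ (2 * K))).
  assert (Iq : (0 < / (2 * K) <= / 2)%R).
  { split; [apply Rinv_0_lt_compat; lra | apply Rinv_le_contravar; lra]. }
  assert (e0 : (0 < ep)%R) by (unfold ep; repeat apply Rmin_pos; lra).
  assert (e1 : (ep <= d1 / 2)%R) by (unfold ep; eapply Rle_trans; [apply Rmin_l | apply Rmin_l]).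
  assert (e2 : (ep <= d2 / 2)%R) by (unfold ep; eapply Rle_trans; [apply Rmin_l | apply Rmin_r]).
  assert (e3 : (ep <= / (2 * K))%R) by apply Rmin_r.
  specialize (EQ (/ 2 - ep)%R ltac:(lra)).
  specialize (B1 (RtoC ep)). specialize (B2 (z2 (/ 2 - ep)%R)).
  assert (M1 : (Cmod (RtoC ep - 0) < d1)%R).
  { replace (RtoC ep - 0) with (RtoC ep) by ring. rewrite Cmod_R, Rabs_pos_eq; lra. }
  assert (M2 : (Cmod (z2 (/ 2 - ep)%R - z2 (/ 2)%R) < d2)%R).
  { rewrite P2. replace (RtoC (/ 2 - ep - / 2) * - (1)) with (RtoC ep).
    - rewrite Cmod_R, Rabs_pos_eq; lra.
    - replace (/ 2 - ep - / 2)%R with (- ep)%R by ring. rewrite RtoC_opp. ring. }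
  specialize (B1 M1). specialize (B2 M2).
  assert (Ez : z1 (/ 2 - ep)%R = RtoC ep).
  { unfold z1, pt. replace (/ 2 - (/ 2 - ep))%R with ep by ring. ring. }
  rewrite Ez in EQ. rewrite <- EQ in B2. unfold wpL in B2.
  pose proof (Cmod_triangle_inv ((/ RtoC ep) ^ 2) (wpreg tau ep)) as T.
  rewrite Cmod_pow, Cmod_inv, Cmod_R, Rabs_pos_eq in T
    by (try lra; intros E; apply RtoC_inj in E; lra).
  assert (G : (2 * K <= / ep)%R).
  { rewrite <- (Rinv_inv (2 * K)). apply Rinv_le_contravar; lra. }
  pose proof (Rle_abs K1). pose proof (Rle_abs K2).
  assert ((2 * K) * (2 * K) <= (/ ep) ^ 2)%R.
  { simpl. rewrite Rmult_1_r. apply Rmult_le_compat; lra. }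
  unfold K in *. nra.
Qed.

(** * Values at quarter periods as functions of the modulus *)

(** An integer index for the quarter periods lets SL2(Z) act on the index by [sl2_act], and wp at
    the point depends on the index only modulo 4. *)
Definition qpt (tau : C) (u : idx) : C := lat tau u / 4.

Definition wp_quarter (tau : C) (u : idx) : C := wpL tau (qpt tau u).

Definition non_period (u : idx) : Prop := ~ ((4 | fst u)%Z /\ (4 | snd u)%Z).

Lemma off_lattice_qpt tau u : (0 < Im tau)%R -> non_period u -> off_lattice tau (qpt tau u).
Proof.
  intros Ht Hu p E. unfold qpt in E.
  assert (E2 : lat tau (fst u - 4 * fst p, snd u - 4 * snd p)%Z = 0).
  { replace (lat tau (fst u - 4 * fst p, snd u - 4 * snd p)%Z) with (4 * (lat tau u / 4 - lat tau p)).
    - rewrite E. ring.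
    - unfold lat. cbn [fst snd]. rewrite !ZtoC_minus, !ZtoC_mult.
      change (ZtoC 4) with (RtoC 4). field. }
  destruct (idx_dec (fst u - 4 * fst p, snd u - 4 * snd p)%Z (0, 0)%Z) as [D|D].
  - pose proof (f_equal fst D) as D1. pose proof (f_equal snd D) as D2. cbn [fst snd] in D1, D2.
    apply Hu. split; [exists (fst p) | exists (snd p)]; lia.
  - now apply (lat_neq_0 tau _ Ht D).
Qed.

Lemma wp_quarter_congr tau u v : (0 < Im tau)%R -> non_period u ->
  (4 | fst v - fst u)%Z -> (4 | snd v - snd u)%Z -> wp_quarter tau v = wp_quarter tau u.
Proof.
  intros Ht Hu [k1 H1] [k2 H2]. unfold wp_quarter.
  rewrite <- (wpL_periodic tau (qpt tau u) (k1, k2)) by (auto; now apply off_lattice_qpt).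
  f_equal. unfold qpt, lat. cbn [fst snd].
  replace (fst v) with (fst u + k1 * 4)%Z by lia. replace (snd v) with (snd u + k2 * 4)%Z by lia.
  rewrite !ZtoC_plus, !ZtoC_mult. change (ZtoC 4) with (RtoC 4). field.
Qed.

Lemma wp_quarter_mobius a b c d tau u : SL2Z a b c d -> (0 < Im tau)%R -> non_period (sl2_act a b c d u) ->
  wp_quarter (mobius a b c d tau) u = automorphy c d tau ^ 2 * wp_quarter tau (sl2_act a b c d u).
Proof.
  intros HS Ht Hu. unfold wp_quarter.
  rewrite <- (wpL_mobius a b c d tau) by (auto; now apply off_lattice_qpt).
  f_equal. unfold qpt. rewrite lat_mobius by auto.
  pose proof (automorphy_neq_0 a b c d tau HS Ht). field. auto.
Qed.

Lemma non_period_act a b c d u : SL2Z a b c d -> non_period u -> non_period (sl2_act a b c d u).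
Proof.
  intros HS Hu [[k1 H1] [k2 H2]]. apply Hu. rewrite <- (sl2_act_inv a b c d u HS).
  unfold sl2_act at 1 3. cbn [fst snd]. rewrite H1, H2.
  split; [exists (k1 * a - k2 * b)%Z | exists (k2 * d - k1 * c)%Z]; ring.
Qed.

(** Differentiation in the modulus: the point moves together with the lattice, its real coordinates
    being fixed. The coefficient of [t] in the denominator grows at most like [size], so the inverse
    still has a derivative of order [1 / size]. *)
Lemma tame_recip_modulus (al be : R) tau :
  (0 < Im tau)%R -> (forall p, p <> (0, 0)%Z -> ~ (al = IZR (fst p) /\ be = IZR (snd p))) ->
  exists F', tame (fun p => / size p)%R
    (fun t p => recip t (RtoC al + RtoC be * t) p) F' tau.
Proof.
  intros Ht Hab.
  destruct (lattice_gap_coords tau al be Ht) as [d [Hd H]].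
  assert (Hm : forall p t, RtoC al + RtoC be * t - lat t p =
     RtoC (al - IZR (fst p)) + RtoC (be - IZR (snd p)) * t) by (intros; apply coords_minus_lat).
  pose proof (Rabs_pos be) as Hbe.
  assert (T : tame (fun p => / size p)%R
     (fun t p => if is0 p then 0 else / (RtoC (al - IZR (fst p)) + RtoC (be - IZR (snd p)) * t))
     (fun t p => if is0 p then 0 else - RtoC (be - IZR (snd p)) *
        (/ (RtoC (al - IZR (fst p)) + RtoC (be - IZR (snd p)) * t)) ^ 2) tau).
  { apply (tame_inv_affine is0 _ _ size tau d (1 + Rabs be)); try lra.
    - intros i. pose proof (size_ge_1 i). lra.
    - intros i Hi. apply H, Hab, is0_false, Hi.
    - intros i. rewrite Cmod_R. unfold Rminus.
      eapply Rle_trans; [apply Rabs_triang|]. rewrite Rabs_Ropp, <- zabs_Rabs.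
      pose proof (zabs_ge_0 (fst i)). pose proof (zabs_ge_0 (snd i)). unfold size. nra. }
  eexists. refine (tame_ext _ _ _ _ _ _ _ (fun _ _ => eq_refl) T).
  intros t p. unfold recip. now rewrite Hm.
Qed.

Lemma qpt_coords tau u :
  qpt tau u = RtoC (IZR (fst u) / 4) + RtoC (IZR (snd u) / 4) * tau.
Proof. unfold qpt, lat, ZtoC. rewrite !RtoC_div by lra. field. Qed.

Lemma upper_half_plane_open (tau t : C) : (Cmod (t - tau) < Im tau)%R -> (0 < Im t)%R.
Proof.
  intros H. pose proof (im_le_Cmod (t - tau)) as H1.
  change (Im (t - tau)) with (Im t - Im tau)%R in H1.
  assert (H2 : (Rabs (Im t - Im tau) < Im tau)%R) by lra.
  apply Rabs_def2 in H2. lra.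
Qed.

Lemma ctame_wp_quarter tau u : (0 < Im tau)%R -> non_period u ->
  exists f', ctame (fun t => wp_quarter t u) f' tau.
Proof.
  intros Ht Hu.
  set (al := (IZR (fst u) / 4)%R). set (be := (IZR (snd u) / 4)%R).
  destruct (tame_recip_modulus al be tau Ht) as [F1 T1].
  { intros p _ [E1 E2]. apply Hu. unfold al, be in *. split.
    - exists (fst p). apply eq_IZR. rewrite mult_IZR. lra.
    - exists (snd p). apply eq_IZR. rewrite mult_IZR. lra. }
  destruct (tame_recip_modulus 0 0 tau Ht) as [F0 T0].
  { intros p Hp [E1 E2]. apply Hp. destruct p as [m n]. simpl in *.
    apply (eq_IZR 0) in E1, E2. congruence. }
  assert (TL : forall I : Type, tame (fun _ : I => 1%R) (fun t _ => RtoC al + RtoC be * t)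
     (fun _ _ => 0 + RtoC be * 1) tau).
  { intros I. apply tame_plus; [|apply tame_scal, tame_id].
    apply (tame_const (fun _ : I => 1%R) (fun _ => RtoC al)); [|intros; lra].
    exists (Cmod al). pose proof (Cmod_ge_0 al). split; intros; lra. }
  (* The factorization of [tame_wpreg_term] again, but its first factor, the point itself, now
     depends on [t] too. *)
  pose proof (tame_mult _ _ _ _ _ _ _ (TL idx)
    (tame_mult _ _ _ _ _ _ _ T1
      (tame_mult _ _ _ _ _ _ _ T0 (tame_plus _ _ _ _ _ _ T1 T0)))) as T.
  apply (tame_scal _ (-1)) in T.
  apply (tame_weight _ wt) in T.
  2:{ intros p. eapply Rle_trans; [|apply (size_inv_cube p)]. right. ring. }
  pose proof (ctame_Csum _ _ _ T) as CS.
  assert (Hz0 : RtoC al + RtoC be * tau <> 0).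
  { unfold al, be. rewrite <- qpt_coords. apply (off_lattice_neq_0 tau). now apply off_lattice_qpt. }
  assert (CI : exists g', ctame (fun t => (/ (RtoC al + RtoC be * t)) ^ 2) g' tau).
  { apply (proj1 (Cmod_gt_0 _)) in Hz0.
    pose proof (tame_inv_affine (fun _ : unit => false) (fun _ => RtoC al) (fun _ => RtoC be)
      (fun _ => 1%R) tau (Cmod (RtoC al + RtoC be * tau)) (Cmod be) Hz0 (Cmod_ge_0 _)
      (fun _ => Rlt_0_1) (fun _ _ => Req_le _ _ (Rmult_1_r _))
      (fun _ => Req_le _ _ (eq_sym (Rmult_1_r _)))) as T2.
    apply (tame_weight _ (fun _ => 1%R)) in T2; [|intros; lra].
    eexists. exact (ctame_pow _ _ _ 1 T2). }
  destruct CI as [g' CI].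
  eexists. refine (ctame_ext_near _ _ _ _ _ _ Ht _ (ctame_plus _ _ _ _ _ CI CS)).
  intros t Htt. split; [|reflexivity].
  pose proof (upper_half_plane_open tau t Htt) as Hi.
  unfold wp_quarter, wpL. rewrite qpt_coords. fold al be. f_equal.
  assert (Hz : off_lattice_but_0 t (RtoC al + RtoC be * t)).
  { unfold al, be. rewrite <- qpt_coords. now apply off_lattice_weaken, off_lattice_qpt. }
  apply has_sum_Csum. generalize (has_sum_wpreg t _ Hi Hz). apply has_sum_ext. intros p.
  pose proof (recip_relation t _ p Hi Hz) as R.
  replace (RtoC 0 + RtoC 0 * t) with (RtoC 0) by ring.
  set (z := RtoC al + RtoC be * t) in *.
  set (v := recip t z p) in *. set (v0 := recip t 0 p) in *.
  transitivity (- (z * v * v0) * (v + v0)); [rewrite R; ring | ring].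
Qed.

(** * Behaviour at the cusps *)

Lemma pow32_mult a b : (0 <= a)%R -> (0 <= b)%R -> pow32 (a * b) = (pow32 a * pow32 b)%R.
Proof. intros Ha Hb. unfold pow32. rewrite sqrt_mult by auto. ring. Qed.

(* The row of lattice points p at the height of the point u/4. *)
Definition same_row (u p : idx) : bool := (snd u =? 4 * snd p)%Z.

Definition off_row (tau : C) (u p : idx) : C :=
  if same_row u p then 0 else (/ (qpt tau u - lat tau p)) ^ 2.

(** On this row the multiples of [tau] cancel. The contribution is free of [tau], and its
    differences are what remains in the limit at infinity. *)
Definition on_row (u p : idx) : C :=
  if same_row u p then (/ RtoC (IZR (fst u) / 4 - IZR (fst p))) ^ 2 else 0.

Lemma row_split tau u p :
  (/ (qpt tau u - lat tau p)) ^ 2 = on_row u p + off_row tau u p.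
Proof.
  unfold on_row, off_row. destruct (same_row u p) eqn:E; [|ring].
  apply Z.eqb_eq in E. rewrite qpt_coords, coords_minus_lat, E, mult_IZR.
  replace (4 * IZR (snd p) / 4 - IZR (snd p))%R with 0%R by field.
  replace (RtoC (IZR (fst u) / 4 - IZR (fst p)) + 0 * tau)
    with (RtoC (IZR (fst u) / 4 - IZR (fst p))) by ring. ring.
Qed.

(** Off the row the height difference [Q] is a nonzero multiple of 1/4, so the imaginary part bounds
    the modulus from below; with the real part of [tau] bounded, the horizontal coordinate is then
    controlled by the modulus as well. The bound 4 is the period of [wp_quarter] in [tau]. *)
Lemma off_row_lower u : exists ka, (0 < ka <= 1)%R /\ forall tau p,
  (Rabs (Re tau) <= 4)%R -> (1 <= Im tau)%R -> same_row u p = false ->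
  (ka * (1 + zabs (fst p)) <= Cmod (qpt tau u - lat tau p))%R /\
  (ka * (Im tau * (1 + zabs (snd p))) <= Cmod (qpt tau u - lat tau p))%R.
Proof.
  set (al := (IZR (fst u) / 4)%R). set (be := (IZR (snd u) / 4)%R).
  pose proof (Rabs_pos al) as Hal. pose proof (Rabs_pos be) as Hbe.
  (* From [1 <= 4 * Cmod w] and [Rabs P <= 5 * Cmod w] the first estimate needs 9 + 4 |al|; from
     [1 <= 4 * Rabs Q] the second needs 5 + 4 |be|. *)
  set (N := (9 + 4 * Rabs al + 4 * Rabs be)%R).
  assert (HN : (9 <= N)%R) by (unfold N; lra).
  exists (/ N)%R. split.
  { split; [apply Rinv_0_lt_compat; lra|]. rewrite <- Rinv_1. apply Rinv_le_contravar; lra. }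
  intros tau p Hx Hy Hrow.
  rewrite qpt_coords, coords_minus_lat. fold al be.
  set (P := (al - IZR (fst p))%R). set (Q := (be - IZR (snd p))%R).
  set (w := RtoC P + RtoC Q * tau).
  assert (HQ : (/ 4 <= Rabs Q)%R).
  { assert (E : Q = (IZR (snd u - 4 * snd p) / 4)%R).
    { unfold Q, be. rewrite minus_IZR, mult_IZR. field. }
    rewrite E. unfold Rdiv. rewrite Rabs_mult, (Rabs_pos_eq (/ 4)) by lra.
    rewrite Rabs_Zabs.
    assert (1 <= IZR (Z.abs (snd u - 4 * snd p)))%R.
    { apply (IZR_le 1). unfold same_row in Hrow. apply Z.eqb_neq in Hrow. lia. }
    lra. }
  assert (I1 : (Rabs Q * Im tau <= Cmod w)%R).
  { rewrite <- (Rabs_pos_eq (Im tau)) by lra. rewrite <- Rabs_mult.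
    replace (Q * Im tau)%R with (Im w) by (unfold w, Im; simpl; ring). apply im_le_Cmod. }
  assert (I2 : (Rabs Q <= Cmod w)%R) by nra.
  assert (I3 : (Rabs P <= 5 * Cmod w)%R).
  { assert (Rabs P <= Rabs (Re w) + Rabs Q * Rabs (Re tau))%R.
    { rewrite <- Rabs_mult. replace P with (Re w - Q * Re tau)%R by (unfold w, Re; simpl; ring).
      unfold Rminus. rewrite <- (Rabs_Ropp (Q * Re tau)). apply Rabs_triang. }
    pose proof (re_le_Cmod w).
    assert (Rabs Q * Rabs (Re tau) <= Rabs Q * 4)%R by (apply Rmult_le_compat_l; lra).
    lra. }
  assert (M1 : (zabs (fst p) <= Rabs al + Rabs P)%R).
  { rewrite zabs_Rabs. replace (IZR (fst p)) with (al + - P)%R by (unfold P; ring).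
    eapply Rle_trans; [apply Rabs_triang|]. rewrite Rabs_Ropp. lra. }
  assert (M2 : (zabs (snd p) <= Rabs be + Rabs Q)%R).
  { rewrite zabs_Rabs. replace (IZR (snd p)) with (be + - Q)%R by (unfold Q; ring).
    eapply Rle_trans; [apply Rabs_triang|]. rewrite Rabs_Ropp. lra. }
  split; apply Rmult_le_reg_l with N; try lra; rewrite <- Rmult_assoc, Rinv_r, Rmult_1_l by lra.
  - unfold N. assert (/ 4 <= Cmod w)%R by lra.
    assert (Rabs al * 1 <= Rabs al * (4 * Cmod w))%R by (apply Rmult_le_compat_l; lra).
    assert (0 <= Rabs be * Cmod w)%R by (apply Rmult_le_pos; lra). lra.
  - assert (S1 : (1 + zabs (snd p) <= N * Rabs Q)%R).
    { unfold N. assert (Rabs be * 1 <= Rabs be * (4 * Rabs Q))%R by (apply Rmult_le_compat_l; lra).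
      assert (0 <= Rabs al * Rabs Q)%R by (apply Rmult_le_pos; lra). lra. }
    apply Rle_trans with (Im tau * (N * Rabs Q))%R; [apply Rmult_le_compat_l; lra|].
    replace (Im tau * (N * Rabs Q))%R with (N * (Rabs Q * Im tau))%R by ring.
    apply Rmult_le_compat_l; lra.
Qed.

Lemma inv_prod3_le (A B x1 x2 x3 : R) : (0 < A)%R -> (0 < B)%R ->
  (A <= x1 -> A <= x2 -> A <= x3 -> B <= x1 -> B <= x2 -> B <= x3 ->
   / (x1 * x2 * x3) <= / (pow32 A * pow32 B))%R.
Proof.
  intros HA HB A1 A2 A3 B1 B2 B3.
  set (U := Rmax A B).
  assert (UA : (A <= U)%R) by apply Rmax_l. assert (UB : (B <= U)%R) by apply Rmax_r.
  apply Rinv_le_contravar.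
  - apply Rmult_lt_0_compat; now apply pow32_pos.
  - eapply Rle_trans; [apply (pow32_mult_le A B U); auto|].
    assert (U <= x1)%R by now apply Rmax_lub. assert (U <= x2)%R by now apply Rmax_lub.
    assert (U <= x3)%R by now apply Rmax_lub.
    replace (U ^ 3)%R with (U * U * U)%R by ring.
    assert (0 <= U * U)%R by nra.
    apply Rmult_le_compat; try lra. apply Rmult_le_compat; lra.
Qed.

(* One row carries the weight wt1 of its height as a constant, so quadratic decay along it is
   enough. *)
Lemma off_row_single u1 u2 : exists K, (0 <= K)%R /\ forall tau p,
  (Rabs (Re tau) <= 4)%R -> (1 <= Im tau)%R -> same_row u2 p = true ->
  (Cmod (off_row tau u1 p) <= K / sqrt (Im tau) * wt p)%R.
Proof.
  destruct (off_row_lower u1) as [ka [Hka L]].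
  set (c2 := pow32 (1 + Rabs (IZR (snd u2) / 4))).
  assert (Hc2 : (0 < c2)%R) by (apply pow32_pos; pose proof (Rabs_pos (IZR (snd u2) / 4)); lra).
  assert (Hp : (0 < pow32 ka)%R) by (apply pow32_pos; lra).
  assert (Hs : (0 < sqrt ka)%R) by (apply sqrt_lt_R0; lra).
  exists (c2 / (pow32 ka * sqrt ka))%R. split.
  { apply Rlt_le, Rdiv_lt_0_compat; auto. apply Rmult_lt_0_compat; auto. }
  intros tau p Hx Hy Hrow.
  assert (Hsy : (0 < sqrt (Im tau))%R) by (apply sqrt_lt_R0; lra).
  pose proof (wt_pos p) as Hw.
  unfold off_row. destruct (same_row u1 p) eqn:E1.
  { rewrite Cmod_0. apply Rmult_le_pos; [|lra]. apply Rlt_le. repeat apply Rdiv_lt_0_compat; auto.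
    apply Rmult_lt_0_compat; auto. }
  destruct (L tau p Hx Hy E1) as [LA LB].
  set (w := qpt tau u1 - lat tau p) in *.
  pose proof (zabs_ge_0 (fst p)) as Z1. pose proof (zabs_ge_0 (snd p)) as Z2.
  assert (HB : (ka * Im tau <= Cmod w)%R).
  { eapply Rle_trans; [|apply LB]. apply Rmult_le_compat_l; [lra|]. nra. }
  assert (P0 : (0 < ka * (1 + zabs (fst p)))%R) by (apply Rmult_lt_0_compat; lra).
  assert (P1 : (0 < ka * Im tau)%R) by (apply Rmult_lt_0_compat; lra).
  assert (Pw : (0 < Cmod w)%R) by lra.
  rewrite Cmod_pow, Cmod_inv by (now apply Cmod_gt_0).
  (* The square of the modulus is split into the powers 3/2 and 1/2: the first pays for the weight
     along the row, the second for the decay in Im tau. *)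
  assert (Ew : (pow32 (ka * (1 + zabs (fst p))) * sqrt (ka * Im tau) <= Cmod w ^ 2)%R).
  { replace (Cmod w ^ 2)%R with (Cmod w * sqrt (Cmod w) * sqrt (Cmod w))%R
      by (rewrite Rmult_assoc, sqrt_sqrt; [ring | lra]).
    unfold pow32. apply Rmult_le_compat.
    - apply Rmult_le_pos; [lra | apply sqrt_pos].
    - apply sqrt_pos.
    - apply Rmult_le_compat; [lra | apply sqrt_pos | lra | apply sqrt_le_1; lra].
    - apply sqrt_le_1; lra. }
  rewrite pow32_mult, sqrt_mult in Ew by lra.
  assert (E2 : (1 = c2 * wt1 (snd p))%R).
  { apply Z.eqb_eq in Hrow. unfold c2, wt1. rewrite Hrow, mult_IZR.
    replace (4 * IZR (snd p) / 4)%R with (IZR (snd p)) by field. rewrite <- zabs_Rabs.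
    rewrite Rinv_r; auto. apply Rgt_not_eq, pow32_pos. lra. }
  assert (P32 : (0 < pow32 (1 + zabs (fst p)))%R) by (apply pow32_pos; lra).
  apply Rle_trans with (/ (pow32 ka * pow32 (1 + zabs (fst p)) * (sqrt ka * sqrt (Im tau))))%R.
  - rewrite pow_inv. apply Rinv_le_contravar; auto.
    apply Rmult_lt_0_compat; apply Rmult_lt_0_compat; auto.
  - right.
    transitivity (/ (pow32 ka * pow32 (1 + zabs (fst p)) * (sqrt ka * sqrt (Im tau)))
      * (c2 * wt1 (snd p)))%R; [rewrite <- E2; ring|].
    unfold wt. change (wt1 (fst p)) with (/ pow32 (1 + zabs (fst p)))%R.
    field. repeat split; lra.
Qed.

(** When both terms are present, 1/w1^2 - 1/w2^2 is w2 - w1 times a sum of inverse triple products.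
    The difference w2 - w1 is O(Im tau), while the triple products, once the weight is paid, save
    (Im tau)^(3/2); this is the origin of the rate 1/sqrt(Im tau). A point on the row of one term
    leaves only the other, and [off_row_single] applies. *)
Lemma off_row_diff u1 u2 : exists K, (0 <= K)%R /\ forall tau p,
  (Rabs (Re tau) <= 4)%R -> (1 <= Im tau)%R ->
  (Cmod (off_row tau u1 p - off_row tau u2 p) <= K / sqrt (Im tau) * wt p)%R.
Proof.
  destruct (off_row_single u1 u2) as [K1 [HK1 S1]].
  destruct (off_row_single u2 u1) as [K2 [HK2 S2]].
  destruct (off_row_lower u1) as [k1 [Hk1 L1]]. destruct (off_row_lower u2) as [k2 [Hk2 L2]].
  set (ka := Rmin k1 k2).
  assert (Hka : (0 < ka)%R) by (apply Rmin_pos; lra).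
  assert (ka1 : (ka <= k1)%R) by apply Rmin_l. assert (ka2 : (ka <= k2)%R) by apply Rmin_r.
  set (da := (IZR (fst u2) / 4 - IZR (fst u1) / 4)%R).
  set (db := (IZR (snd u2) / 4 - IZR (snd u1) / 4)%R).
  set (D := (Rabs da + 5 * Rabs db)%R).
  assert (HD : (0 <= D)%R) by (pose proof (Rabs_pos da); pose proof (Rabs_pos db); unfold D; lra).
  assert (Hp : (0 < pow32 ka)%R) by now apply pow32_pos.
  assert (HK3 : (0 <= 2 * D / (pow32 ka * pow32 ka))%R).
  { apply Rmult_le_pos; [lra|]. apply Rlt_le, Rinv_0_lt_compat. now apply Rmult_lt_0_compat. }
  exists (K1 + K2 + 2 * D / (pow32 ka * pow32 ka))%R. split; [lra|].
  intros tau p Hx Hy.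
  assert (Hsy : (0 < sqrt (Im tau))%R) by (apply sqrt_lt_R0; lra).
  pose proof (wt_pos p) as Hw.
  assert (Hq : (0 <= / sqrt (Im tau) * wt p)%R).
  { apply Rmult_le_pos; [|lra]. apply Rlt_le, Rinv_0_lt_compat. lra. }
  assert (Mono : forall K K', (K <= K')%R -> (K / sqrt (Im tau) * wt p <= K' / sqrt (Im tau) * wt p)%R).
  { intros K K' HK. unfold Rdiv. rewrite !Rmult_assoc. now apply Rmult_le_compat_r. }
  destruct (same_row u2 p) eqn:R2.
  { specialize (S1 tau p Hx Hy R2). unfold off_row at 2. rewrite R2.
    replace (off_row tau u1 p - 0) with (off_row tau u1 p) by ring.
    eapply Rle_trans; [apply S1 | apply Mono; lra]. }
  destruct (same_row u1 p) eqn:R1.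
  { specialize (S2 tau p Hx Hy R1). unfold off_row at 1. rewrite R1.
    replace (0 - off_row tau u2 p) with (- off_row tau u2 p) by ring. rewrite Cmod_opp.
    eapply Rle_trans; [apply S2 | apply Mono; lra]. }
  unfold off_row. rewrite R1, R2.
  destruct (L1 tau p Hx Hy R1) as [A1 B1]. destruct (L2 tau p Hx Hy R2) as [A2 B2].
  assert (Ed : qpt tau u2 - lat tau p - (qpt tau u1 - lat tau p) = RtoC da + RtoC db * tau).
  { rewrite !qpt_coords. unfold da, db. rewrite !RtoC_minus. ring. }
  set (w1 := qpt tau u1 - lat tau p) in *. set (w2 := qpt tau u2 - lat tau p) in *.
  pose proof (zabs_ge_0 (fst p)) as Z1. pose proof (zabs_ge_0 (snd p)) as Z2.
  set (A := (ka * (1 + zabs (fst p)))%R). set (B := (ka * (Im tau * (1 + zabs (snd p))))%R).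
  assert (PA : (0 < A)%R) by (apply Rmult_lt_0_compat; lra).
  assert (PB : (0 < B)%R) by (repeat apply Rmult_lt_0_compat; lra).
  assert (QB : (0 <= Im tau * (1 + zabs (snd p)))%R) by (apply Rmult_le_pos; lra).
  assert (A1' : (A <= Cmod w1)%R) by (eapply Rle_trans; [|apply A1]; apply Rmult_le_compat_r; lra).
  assert (A2' : (A <= Cmod w2)%R) by (eapply Rle_trans; [|apply A2]; apply Rmult_le_compat_r; lra).
  assert (B1' : (B <= Cmod w1)%R) by (eapply Rle_trans; [|apply B1]; apply Rmult_le_compat_r; lra).
  assert (B2' : (B <= Cmod w2)%R) by (eapply Rle_trans; [|apply B2]; apply Rmult_le_compat_r; lra).
  assert (N1 : w1 <> 0) by (apply Cmod_gt_0; lra).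
  assert (N2 : w2 <> 0) by (apply Cmod_gt_0; lra).
  assert (HDy : (Cmod (w2 - w1) <= D * Im tau)%R).
  { rewrite Ed. eapply Rle_trans; [apply Cmod_triangle|]. rewrite Cmod_mult, !Cmod_R.
    pose proof (Cmod_le_Re_Im tau) as HT. rewrite (Rabs_pos_eq (Im tau)) in HT by lra.
    pose proof (Rabs_pos da). pose proof (Rabs_pos db).
    assert (Rabs db * Cmod tau <= Rabs db * (5 * Im tau))%R by (apply Rmult_le_compat_l; lra).
    assert (Rabs da * 1 <= Rabs da * Im tau)%R by (apply Rmult_le_compat_l; lra).
    unfold D. lra. }
  replace ((/ w1) ^ 2 - (/ w2) ^ 2)
    with ((w2 - w1) * (/ (w1 * w2 * w2) + / (w1 * w1 * w2))) by (field; auto).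
  rewrite Cmod_mult.
  assert (HS : (Cmod (/ (w1 * w2 * w2) + / (w1 * w1 * w2)) <= 2 * / (pow32 A * pow32 B))%R).
  { eapply Rle_trans; [apply Cmod_triangle|].
    rewrite !Cmod_inv by (repeat apply Cmult_neq_0; auto). rewrite !Cmod_mult.
    pose proof (inv_prod3_le A B (Cmod w1) (Cmod w2) (Cmod w2) PA PB A1' A2' A2' B1' B2' B2').
    pose proof (inv_prod3_le A B (Cmod w1) (Cmod w1) (Cmod w2) PA PB A1' A1' A2' B1' B1' B2').
    lra. }
  apply Rle_trans with (D * Im tau * (2 * / (pow32 A * pow32 B)))%R.
  { apply Rmult_le_compat; auto; apply Cmod_ge_0. }
  apply Rle_trans with (2 * D / (pow32 ka * pow32 ka) / sqrt (Im tau) * wt p)%R; [|apply Mono; lra].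
  right. unfold A, B. rewrite !pow32_mult by lra. unfold wt, wt1.
  assert (P1 : (0 < pow32 (1 + zabs (fst p)))%R) by (apply pow32_pos; lra).
  assert (P2 : (0 < pow32 (1 + zabs (snd p)))%R) by (apply pow32_pos; lra).
  change (pow32 (Im tau)) with (Im tau * sqrt (Im tau))%R. field. repeat split; lra.
Qed.

Lemma wp_quarter_diff_limit_strip u1 u2 : non_period u1 -> non_period u2 ->
  exists l K, forall tau, (Rabs (Re tau) <= 4)%R -> (1 <= Im tau)%R ->
    (Cmod (wp_quarter tau u1 - wp_quarter tau u2 - l) <= K / sqrt (Im tau))%R.
Proof.
  intros H1 H2. destruct (off_row_diff u1 u2) as [K [HK HO]].
  assert (HX : forall tau, (0 < Im tau)%R ->
    has_sum (fun p => (on_row u1 p - on_row u2 p) + (off_row tau u1 p - off_row tau u2 p))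
      (wp_quarter tau u1 - wp_quarter tau u2)).
  { intros tau Ht.
    generalize (has_sum_wpL_diff tau (qpt tau u1) (qpt tau u2) Ht
      (off_lattice_qpt _ _ Ht H1) (off_lattice_qpt _ _ Ht H2)).
    apply has_sum_ext. intros p. rewrite !row_split. ring. }
  assert (HT : forall tau, (Rabs (Re tau) <= 4)%R -> (1 <= Im tau)%R ->
    has_sum (fun p => off_row tau u1 p - off_row tau u2 p)
      (Csum (fun p => off_row tau u1 p - off_row tau u2 p))).
  { intros tau Hx Hy. apply summable_has_sum. exists (K / sqrt (Im tau))%R. auto. }
  assert (RCi : (Rabs (Re Ci) <= 4)%R) by (simpl; rewrite Rabs_R0; lra).
  assert (ICi : (1 <= Im Ci)%R) by (simpl; lra).
  (* The row sum does not depend on the modulus, so it is read off at [Ci] by subtracting the other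
     rows; no separate summability proof for the rows is required. *)
  set (l := wp_quarter Ci u1 - wp_quarter Ci u2 - Csum (fun p => off_row Ci u1 p - off_row Ci u2 p)).
  assert (HL : has_sum (fun p => on_row u1 p - on_row u2 p) l).
  { generalize (has_sum_minus _ _ _ _ (HX Ci ltac:(lra)) (HT Ci RCi ICi)).
    apply has_sum_ext. intros p. ring. }
  exists l, (K * 36)%R. intros tau Hx Hy.
  replace (K * 36 / sqrt (Im tau))%R with (K / sqrt (Im tau) * 36)%R by (unfold Rdiv; ring).
  apply has_sum_wt_bound with (fun p => off_row tau u1 p - off_row tau u2 p); auto.
  generalize (has_sum_minus _ _ _ _ (HX tau ltac:(lra)) HL).
  apply has_sum_ext. intros p. ring.
Qed.

Lemma wp_quarter_shift tau k u : (0 < Im tau)%R -> non_period u ->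
  wp_quarter (tau + ZtoC (4 * k)) u = wp_quarter tau u.
Proof.
  intros Ht Hu.
  assert (HS : SL2Z 1 (4 * k) 0 1) by (unfold SL2Z; ring).
  assert (EM : mobius 1 (4 * k) 0 1 tau = tau + ZtoC (4 * k)).
  { unfold mobius, automorphy. change (ZtoC 1) with (RtoC 1). change (ZtoC 0) with (RtoC 0).
    replace (0 * tau + 1) with (RtoC 1) by ring. field. }
  rewrite <- EM. rewrite wp_quarter_mobius by (auto; now apply non_period_act).
  rewrite (wp_quarter_congr tau u).
  - unfold automorphy. change (ZtoC 1) with (RtoC 1). change (ZtoC 0) with (RtoC 0). ring.
  - auto.
  - auto.
  - exists (snd u * k)%Z. unfold sl2_act. cbn [fst snd]. ring.
  - exists 0%Z. unfold sl2_act. cbn [fst snd]. ring.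
Qed.

Lemma wp_quarter_diff_limit u1 u2 : non_period u1 -> non_period u2 ->
  exists l K, forall tau, (1 <= Im tau)%R ->
    (Cmod (wp_quarter tau u1 - wp_quarter tau u2 - l) <= K / sqrt (Im tau))%R.
Proof.
  intros H1 H2. destruct (wp_quarter_diff_limit_strip u1 u2 H1 H2) as [l [K H]].
  exists l, K. intros tau Hy.
  (* This translate has real part in [-4, 0). *)
  set (k := (up (Re tau / 4))).
  destruct (archimed (Re tau / 4)) as [U1 U2]. fold k in U1, U2.
  set (t0 := tau + ZtoC (4 * - k)).
  assert (I0 : Im t0 = Im tau) by (unfold t0, ZtoC, Im; simpl; ring).
  assert (R0 : Re t0 = (Re tau - 4 * IZR k)%R).
  { unfold t0, ZtoC, Re. cbn [fst snd Cplus RtoC]. rewrite mult_IZR, opp_IZR. ring. }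
  rewrite <- (wp_quarter_shift tau (- k) u1), <- (wp_quarter_shift tau (- k) u2) by (auto; lra).
  fold t0. rewrite <- I0. apply H; [|lra].
  rewrite R0. apply Rabs_le. lra.
Qed.

Lemma filterlim_at_i_infty (f : C -> C) (l : C) (K : R) :
  (forall tau, (1 <= Im tau)%R -> (Cmod (f tau - l) <= K / sqrt (Im tau))%R) ->
  filterlim f at_i_infty (locally l).
Proof.
  intros H P [eps HP]. pose proof (cond_pos eps) as He.
  set (M := (Rabs K / eps + 1)%R).
  assert (HM : (1 <= M)%R).
  { unfold M. assert (0 <= Rabs K / eps)%R; [|lra].
    apply Rmult_le_pos; [apply Rabs_pos | apply Rlt_le, Rinv_0_lt_compat; lra]. }
  exists (M * M)%R. intros tau Htau. apply HP. apply C_NormedModule_mixin_compat1.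
  change (Cmod (f tau - l) < eps)%R.
  assert (Hs : (M < sqrt (Im tau))%R).
  { rewrite <- (sqrt_square M) by lra. apply sqrt_lt_1; nra. }
  eapply Rle_lt_trans; [apply H; nra|].
  apply Rmult_lt_reg_r with (sqrt (Im tau)); [lra|].
  unfold Rdiv. rewrite Rmult_assoc, Rinv_l, Rmult_1_r by lra.
  apply Rle_lt_trans with (Rabs K); [apply Rle_abs|].
  apply Rlt_le_trans with (eps * M)%R.
  - unfold M. rewrite Rmult_plus_distr_l.
    replace (eps * (Rabs K / eps))%R with (Rabs K) by (field; lra). lra.
  - apply Rmult_le_compat_l; lra.
Qed.

(** Every element of SL2(Z) carries such a difference to another one of the same kind, up to the
    automorphy factor. All cusps are thus reduced to infinity, and invariance under [Gamma 4] is the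
    congruence of the indices modulo 4. *)
Lemma holomorphic_modular_form_wp_quarter_diff f u1 u2 : non_period u1 -> non_period u2 ->
  (forall tau, (0 < Im tau)%R -> f tau = / 16 * (wp_quarter tau u1 - wp_quarter tau u2)) ->
  holomorphic_modular_form (Gamma 4) 2 f.
Proof.
  intros H1 H2 Hf.
  assert (Hfm : forall a b c d tau, SL2Z a b c d -> (0 < Im tau)%R ->
    f (mobius a b c d tau) = automorphy c d tau ^ 2 *
      (/ 16 * (wp_quarter tau (sl2_act a b c d u1) - wp_quarter tau (sl2_act a b c d u2)))).
  { intros a b c d tau HS Ht. rewrite Hf by now apply Im_mobius_pos.
    rewrite !wp_quarter_mobius by (auto; now apply non_period_act). ring. }
  split; [|split].
  - intros tau Ht.
    destruct (ctame_wp_quarter tau u1 Ht H1) as [f1 C1]. destruct (ctame_wp_quarter tau u2 Ht H2) as [f2 C2].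
    eexists. apply (ctame_is_derive f (fun t => / 16 * (f1 t - f2 t))).
    generalize (ctame_scal (/ 16) _ _ _ (ctame_minus _ _ _ _ _ C1 C2)).
    apply ctame_ext_near with (Im tau); auto.
    intros t Htt. split; [|reflexivity]. symmetry. apply Hf.
    now apply (upper_half_plane_open tau).
  - intros a b c d [HS [Ha [Hb [Hc Hd]]]] tau Ht. rewrite Hfm, Hf by auto.
    assert (E : forall u, non_period u -> wp_quarter tau (sl2_act a b c d u) = wp_quarter tau u).
    { intros u Hu. apply wp_quarter_congr; auto; unfold sl2_act; cbn [fst snd].
      - replace (fst u * d + snd u * b - fst u)%Z with (fst u * (d - 1) + snd u * b)%Z by ring.
        apply Z.divide_add_r; now apply Z.divide_mul_r.
      - replace (fst u * c + snd u * a - snd u)%Z with (fst u * c + snd u * (a - 1))%Z by ring.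
        apply Z.divide_add_r; now apply Z.divide_mul_r. }
    now rewrite !E.
  - intros a b c d HS.
    destruct (wp_quarter_diff_limit _ _ (non_period_act a b c d u1 HS H1) (non_period_act a b c d u2 HS H2))
      as [l [K HK]].
    exists (/ 16 * l). apply (filterlim_at_i_infty _ _ (/ 16 * K)%R).
    intros tau Hy. assert (Ht : (0 < Im tau)%R) by lra.
    rewrite Hfm by auto. pose proof (automorphy_neq_0 a b c d tau HS Ht) as Nj.
    specialize (HK tau Hy).
    set (v1 := wp_quarter tau _) in *. set (v2 := wp_quarter tau (sl2_act a b c d u2)) in *.
    replace (automorphy c d tau ^ 2 * (/ 16 * (v1 - v2)) / automorphy c d tau ^ 2 - / 16 * l)
      with (RtoC (/ 16) * (v1 - v2 - l)).
    + rewrite Cmod_mult, Cmod_R, Rabs_pos_eq by lra. unfold Rdiv. rewrite Rmult_assoc.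
      apply Rmult_le_compat_l; [lra | exact HK].
    + rewrite RtoC_inv by lra. field. auto.
Qed.

(** * The two forms *)

(** The lattice of half-periods 2 and 2 tau is 4 (Z + Z tau), and homogeneity of degree -2 gives the
    factor 1/16. Unconditional summability identifies the limit over squares with the sum. *)
Lemma wp_eq_wp_quarter tau u : (0 < Im tau)%R -> non_period u ->
  wp (lat tau u) 2 (2 * tau) = / 16 * wp_quarter tau u.
Proof.
  intros Ht Hu. pose proof (off_lattice_qpt tau u Ht Hu) as Hz.
  pose proof (off_lattice_neq_0 _ _ Hz) as N0.
  unfold wp_quarter, wpL, wp.
  assert (Ez : lat tau u = 4 * qpt tau u) by (unfold qpt; field).
  set (z := qpt tau u) in *. rewrite Ez.
  assert (HS : has_sum (fun p => wp_term (4 * z) 2 (2 * tau) (fst p) (snd p)) (/ 16 * wpreg tau z)).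
  { generalize (has_sum_scal (/ 16) _ _ (has_sum_wpreg tau z Ht (off_lattice_weaken _ _ Hz))).
    apply has_sum_ext. intros p. unfold wp_term, recip.
    change ((fst p =? 0)%Z && (snd p =? 0)%Z)%bool with (is0 p).
    destruct (is0 p) eqn:E; [ring|].
    assert (Ep : period 2 (2 * tau) (fst p) (snd p) = 4 * lat tau p)
      by (unfold period, lat; ring).
    rewrite Ep. pose proof (lat_neq_0 tau p Ht (is0_false p E)) as N1.
    assert (N2 : z - lat tau p <> 0).
    { intros D. apply (Hz p). replace z with ((z - lat tau p) + lat tau p) by ring. rewrite D. ring. }
    set (w := lat tau p) in *.
    replace (4 * z - 4 * w) with (4 * (z - w)) by ring. replace (0 - w) with (- w) by ring.
    field. auto. }
  assert (EL : CLim_seq (wp_partial (4 * z) 2 (2 * tau)) = / 16 * wpreg tau z).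
  { rewrite <- (has_sum_Csum _ _ HS). unfold Csum, CLim_seq.
    f_equal; f_equal; apply Lim_seq_ext; intros N; now rewrite wp_partial_csum. }
  rewrite EL. field. auto.
Qed.

Lemma non_period_10 : non_period (1, 0)%Z.
Proof. intros [[k Hk] _]. cbn [fst] in Hk. lia. Qed.

Lemma non_period_20 : non_period (2, 0)%Z.
Proof. intros [[k Hk] _]. cbn [fst] in Hk. lia. Qed.

Lemma non_period_01 : non_period (0, 1)%Z.
Proof. intros [_ [k Hk]]. cbn [snd] in Hk. lia. Qed.

Lemma lat_20 tau : lat tau (2, 0)%Z = 2.
Proof. unfold lat, ZtoC. cbn [fst snd]. ring. Qed.

Lemma Theta1_wp_quarter tau : (0 < Im tau)%R ->
  Theta1 tau = / 16 * (wp_quarter tau (1, 0)%Z - wp_quarter tau (2, 0)%Z).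
Proof.
  intros Ht. unfold Theta1.
  pose proof (wp_eq_wp_quarter tau _ Ht non_period_10) as E1. rewrite lat_10 in E1.
  pose proof (wp_eq_wp_quarter tau _ Ht non_period_20) as E2. rewrite lat_20 in E2.
  rewrite E1, E2. ring.
Qed.

Lemma Theta2_wp_quarter tau : (0 < Im tau)%R ->
  Theta2 tau = / 16 * (wp_quarter tau (0, 1)%Z - wp_quarter tau (2, 0)%Z).
Proof.
  intros Ht. unfold Theta2.
  pose proof (wp_eq_wp_quarter tau _ Ht non_period_01) as E1. rewrite lat_01 in E1.
  pose proof (wp_eq_wp_quarter tau _ Ht non_period_20) as E2. rewrite lat_20 in E2.
  rewrite E1, E2. ring.
Qed.

Theorem proposition8 :
  holomorphic_modular_form (Gamma 4) 2 Theta1 /\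
  holomorphic_modular_form (Gamma 4) 2 Theta2 /\
  (forall tau : C, (0 < Im tau)%R ->
     Theta2 tau <> 0 /\ burnside_x tau = Theta1 tau / Theta2 tau).
Proof.
  split; [|split].
  - apply (holomorphic_modular_form_wp_quarter_diff _ _ _ non_period_10 non_period_20 Theta1_wp_quarter).
  - apply (holomorphic_modular_form_wp_quarter_diff _ _ _ non_period_01 non_period_20 Theta2_wp_quarter).
  - intros tau Ht. split; [|reflexivity].
    rewrite Theta2_wp_quarter by auto. intros E. apply (wpL_half_neq_quarter tau Ht).
    assert (E1 : qpt tau (0, 1)%Z = pt tau (/ 4) 0).
    { unfold qpt, pt. rewrite lat_01, RtoC_inv by lra. field. }
    assert (E2 : qpt tau (2, 0)%Z = pt tau 0 (/ 2)).
    { unfold qpt, pt. rewrite lat_20, RtoC_inv by lra. field. }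
    rewrite <- E1, <- E2. fold (wp_quarter tau (0, 1)%Z). fold (wp_quarter tau (2, 0)%Z).
    replace (wp_quarter tau (0, 1)%Z)
      with (16 * (/ 16 * (wp_quarter tau (0, 1)%Z - wp_quarter tau (2, 0)%Z))
        + wp_quarter tau (2, 0)%Z)
      by field.
    rewrite E. ring.
Qed.
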